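(* Let $X\subset\{0,1,2\}^{\mathbb{Z}}$ be the vertex shift defined by the matrix $\left[\begin{smallmatrix}1&1&0\\1&1&1\\1&1&1\end{smallmatrix}\right]$ (rows and columns indexed by $0,1,2$ in this order), i.e. the two-sided subshift of all bi-infinite sequences over $\{0,1,2\}$ in which the word $02$ never occurs. Let $T_X$ be its mapping torus and let $h_a,h_b,h_c:T_X\to T_X$ be the homeomorphisms defined by the following local rules (where $\alpha,\beta,\gamma$ range over $\{0,1\}$): - $h_a$: $\alpha\beta(\gamma):\gamma$, $(2)2:201$, $(200):201$, $(201)\alpha:200$, $(201)2:2$, $(21)2:21$, $(21\alpha):21\alpha$; - $h_b$: $\alpha\beta(\gamma):\gamma$, $(2)2:2$, $(200):200$, $(201)\alpha:210$, $(201)2:21$, $(21)2:211$, $(210)\alpha:211$, $(211):201$; - $h_c$: $\alpha0(\beta):\beta$, $1(\alpha):\alpha$, $(2)2:21$, $(200):21$, $(201):201$, $(21)\alpha:200$, $(21)2:2$. Let $V$ be Thompson's group $V$ with generators $a,b,c$, acting on $\{0,1\}^{\mathbb{N}}$ from the right, where $a$ exchanges the prefixes $00$ and $01$ (fixing sequences beginning with $1$), $b$ replaces the prefix $01$ by $10$, $10$ by $11$ and $11$ by $01$ (fixing sequences beginning with $00$), and $c$ exchanges the prefixes $00$ and $1$ (fixing sequences beginning with $01$). Then the assignment $a\mapsto h_a$, $b\mapsto h_b$, $c\mapsto h_c$ extends to a group homomorphism $\varphi$ from $V$ to the group of orientation-preserving homeomorphisms of $T_X$, each homeomorphism in the image of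 $\varphi$ is piecewise linear along flow lines, and the composition of $\varphi$ with the quotient map onto the mapping class group $\mathrm{MCG}(X)$ (quotient by isotopy) is injective. In other words, the embedding $V\hookrightarrow \mathrm{MCG}(X)$ sending $a,b,c$ to the isotopy classes of $h_a,h_b,h_c$ splits by a homomorphism into piecewise linear homeomorphisms.
   Context: The mapping torus (suspension) of a two-sided subshift $X$ with shift map $\sigma$ is $T_X=X\times\mathbb{R}/\sim$, where $(x,t+1)\sim(\sigma x,t)$, with the natural $\mathbb{R}$-flow $s+[x,t]=[x,t+s]$; along a flow line of $[x,0]$ the configuration $x$ is read as a sequence of unit-length intervals, the interval $[i,i+1)$ carrying the symbol $x_i$. The mapping class group $\mathrm{MCG}(X)$ is the group of orientation-preserving homeomorphisms of $T_X$ (those mapping flow lines to flow lines preserving the flow direction) modulo isotopy. Local rules: a local rule is a finite list of mappings written $u(v)w:v'$ with $u,v,w,v'$ words (only words occurring in $X$ are listed), such that in every $x\in X$ every coordinate lies in the $v$-part of exactly one occurrence of a pattern $uvw$ from the list. The homeomorphism defined by the local rule replaces, in each configuration, every such block $v$ (occurring in context $u\,\cdot\,w$) by the word $v'$, the images being concatenated in order to give the image configuration; the flow segment of length $|v|$ spanned by $v$ is mapped by the affine (constant-slope) increasing map onto the flow segment of length $|v'|$ spanned by $v'$ in the image. Thompson's group $V$ is the group of homeomorphisms of $\{0,1\}^{\mathbb{N}}$ that act by finitely many prefix replacements; it is generated by the elements $a,b,c$ described in the claim. *)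

(* Defs.v *)
From Stdlib Require Import Reals Lra Lia ZArith List.
Import ListNotations.
Open Scope R_scope.

Definition config := Z -> nat.

Definition inX (x : config) : Prop :=
  forall n : Z, (x n <= 2)%nat /\ ~ (x n = 0%nat /\ x (n + 1)%Z = 2%nat).

Definition shiftZ (k : Z) (x : config) : config := fun n => x (n + k)%Z.

Lemma inX_shiftZ k x : inX x -> inX (shiftZ k x).
Proof.
  intros H n; unfold shiftZ.
  replace (n + 1 + k)%Z with ((n + k) + 1)%Z by lia. apply H.
Qed.

Definition flo (t : R) : Z := (up t - 1)%Z.

Lemma flo_spec t : 0 <= t - IZR (flo t) < 1.
Proof.
  unfold flo; destruct (archimed t) as [H1 H2].
  rewrite minus_IZR; simpl; lra.
Qed.

(* Mapping torus T_X = X x R / (x, t+1) ~ (sigma x, t).                *)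
(* Points are represented by their unique normal form (x, r) with      *)
(* x in X and 0 <= r < 1; [x, t] has normal form                       *)
(* (sigma^(floor t) x, t - floor t).                                   *)
Definition TX := {p : config * R | inX (fst p) /\ 0 <= snd p < 1}.

Definition mkT (x : config) (hx : inX x) (t : R) : TX :=
  exist _ (shiftZ (flo t) x, t - IZR (flo t))
        (conj (inX_shiftZ (flo t) x hx) (flo_spec t)).

Definition TX_cfg (p : TX) : config := fst (proj1_sig p).
Definition TX_time (p : TX) : R := snd (proj1_sig p).
Definition TX_inX (p : TX) : inX (TX_cfg p) := proj1 (proj2_sig p).

Definition flow (s : R) (p : TX) : TX :=
  mkT (TX_cfg p) (TX_inX p) (TX_time p + s).

(* Topology.  X x R carries the subspace topology of the product of    *)
(* the product (Cantor) topology on {0,1,2}^Z and the usual topology   *)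
(* of R; T_X carries the quotient topology: U is open iff its          *)
(* preimage under (x, t) |-> [x, t] is open in X x R.                  *)
Definition agree (N : nat) (x y : config) : Prop :=
  forall n : Z, (Z.abs n <= Z.of_nat N)%Z -> y n = x n.

Definition openXR (O : config -> R -> Prop) : Prop :=
  forall x t, inX x -> O x t ->
    exists (N : nat) (eps : R), 0 < eps /\
      forall y s, inX y -> agree N x y -> Rabs (s - t) < eps -> O y s.

Definition openT (U : TX -> Prop) : Prop :=
  openXR (fun x t => forall hx : inX x, U (mkT x hx t)).

Definition contT (F : TX -> TX) : Prop :=
  forall U, openT U -> openT (fun p => U (F p)).

Definition homeoT (F : TX -> TX) : Prop :=
  exists G : TX -> TX,
    (forall p, G (F p) = p) /\ (forall p, F (G p) = p) /\ contT F /\ contT G.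

(* F maps the flow line of p onto the flow line of F p, preserving the
   flow direction; g is the induced reparametrization (lifted to R). *)
Definition flow_reparam (F : TX -> TX) (p : TX) (g : R -> R) : Prop :=
  g 0 = 0 /\ (forall r s, r < s -> g r < g s) /\ (forall r, exists s, g s = r) /\
  forall s, F (flow s p) = flow (g s) (F p).

Definition homeo_plus (F : TX -> TX) : Prop :=
  homeoT F /\ forall p, exists g, flow_reparam F p g.

Definition piecewise_linear (g : R -> R) : Prop :=
  forall a b, a < b ->
    exists (n : nat) (br : nat -> R),
      br 0%nat = a /\ br n = b /\
      (forall i, (i < n)%nat -> br i < br (S i)) /\
      (forall i, (i < n)%nat -> exists m c, forall r,
          br i <= r <= br (S i) -> g r = m * r + c).

Definition PL_along_flow (F : TX -> TX) : Prop :=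
  forall p, exists g, flow_reparam F p g /\ piecewise_linear g.

(* Isotopy: a path u in [0,1] |-> H u of orientation-preserving
   homeomorphisms, jointly continuous on [0,1] x T_X (continuity on
   [0,1] x T_X is tested on [0,1] x X x R, which has [0,1] x T_X as a
   quotient since [0,1] is locally compact). *)
Definition openIXR (O : R -> config -> R -> Prop) : Prop :=
  forall u x t, 0 <= u <= 1 -> inX x -> O u x t ->
    exists (N : nat) (eps : R), 0 < eps /\
      forall u' y s, 0 <= u' <= 1 -> inX y -> agree N x y ->
        Rabs (u' - u) < eps -> Rabs (s - t) < eps -> O u' y s.

Definition isotopic (F G : TX -> TX) : Prop :=
  exists H : R -> TX -> TX,
    H 0 = F /\ H 1 = G /\
    (forall u, 0 <= u <= 1 -> homeo_plus (H u)) /\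
    forall U, openT U ->
      openIXR (fun u x t => forall hx : inX x, U (H u (mkT x hx t))).

(* Local rules.  A mapping  u(v)w : v'  is the quadruple (u, v, w, v').*)
Definition word := list nat.
Definition local_rule := list (word * word * word * word).

Definition matchAt (x : config) (k : Z) (u : word) : Prop :=
  forall i : nat, (i < length u)%nat -> x (k + Z.of_nat i)%Z = nth i u 0%nat.

(* rule_image L x t y s : the block decomposition of x given by L is
   x = ... v_(-1) v_0 v_1 ..., block n occupying [p n, p (n+1)) and
   occurring in context u_n (v_n) w_n, with v_0 the block containing
   the flow position t; y is the concatenation ... v'_(-1) v'_0 v'_1 ...
   with v'_n at [q n, q (n+1)) and q 0 = 0; and s is the image of t
   under the increasing affine map [p 0, p 1] -> [q 0, q 1]. *)
Definition rule_image (L : local_rule) (x : config) (t : R)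
           (y : config) (s : R) : Prop :=
  exists p q : Z -> Z,
    (forall n, (p n < p (n + 1))%Z) /\ (forall n, (q n < q (n + 1))%Z) /\
    IZR (p 0%Z) <= t < IZR (p 1%Z) /\ q 0%Z = 0%Z /\
    (forall n, exists u v w v',
        In (u, v, w, v') L /\
        matchAt x (p n - Z.of_nat (length u))%Z u /\
        p (n + 1)%Z = (p n + Z.of_nat (length v))%Z /\
        matchAt x (p n) v /\
        matchAt x (p (n + 1)%Z) w /\
        q (n + 1)%Z = (q n + Z.of_nat (length v'))%Z /\
        matchAt y (q n) v') /\
    s = (t - IZR (p 0%Z)) * IZR (q 1%Z - q 0%Z) / IZR (p 1%Z - p 0%Z).

Definition defined_by (L : local_rule) (F : TX -> TX) : Prop :=
  (forall x t, inX x -> exists y s, rule_image L x t y s) /\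
  (forall x (hx : inX x) t y s, rule_image L x t y s ->
     exists hy : inX y, F (mkT x hx t) = mkT y hy s).

Local Open Scope nat_scope.
Definition bits : list nat := [0%nat; 1%nat].

Definition rule_abg : local_rule :=
  flat_map (fun a => flat_map (fun b => map (fun g =>
     ([a; b], [g], @nil nat, [g])) bits) bits) bits.

Definition rule_a : local_rule :=
  rule_abg ++
  [ ([], [2], [2], [2;0;1]);
    ([], [2;0;0], [], [2;0;1]) ] ++
  map (fun a => ([], [2;0;1], [a], [2;0;0])) bits ++
  [ ([], [2;0;1], [2], [2]);
    ([], [2;1], [2], [2;1]) ] ++
  map (fun a => ([], [2;1;a], [], [2;1;a])) bits.

Definition rule_b : local_rule :=
  rule_abg ++
  [ ([], [2], [2], [2]);
    ([], [2;0;0], [], [2;0;0]) ] ++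
  map (fun a => ([], [2;0;1], [a], [2;1;0])) bits ++
  [ ([], [2;0;1], [2], [2;1]);
    ([], [2;1], [2], [2;1;1]) ] ++
  map (fun a => ([], [2;1;0], [a], [2;1;1])) bits ++
  [ ([], [2;1;1], [], [2;0;1]) ].

Definition rule_c : local_rule :=
  flat_map (fun a => map (fun b => ([a; 0%nat], [b], @nil nat, [b])) bits) bits ++
  map (fun a => ([1%nat], [a], @nil nat, [a])) bits ++
  [ ([], [2], [2], [2;1]);
    ([], [2;0;0], [], [2;1]);
    ([], [2;0;1], [], [2;0;1]) ] ++
  map (fun a => ([], [2;1], [a], [2;0;0])) bits ++
  [ ([], [2;1], [2], [2]) ].

(* Thompson's group V: homeomorphisms of Cantor space {0,1}^N acting by *)
(* finitely many prefix replacements (functions, composed as functions; *)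
(* the right action x.(gh) = (x.g).h corresponds to h o g).             *)
Definition cantor := nat -> bool.

Definition prepend (u : list bool) (w : cantor) : cantor :=
  fun n => if Nat.ltb n (length u) then nth n u false else w (n - length u)%nat.

Definition is_prefix (u : list bool) (x : cantor) : Prop :=
  forall i, (i < length u)%nat -> nth i u false = x i.

Definition complete_prefix_code (us : list (list bool)) : Prop :=
  forall x : cantor, exists! i, (i < length us)%nat /\ is_prefix (nth i us []) x.

Definition in_V (f : cantor -> cantor) : Prop :=
  exists us vs : list (list bool),
    length us = length vs /\ complete_prefix_code us /\ complete_prefix_code vs /\
    forall i w, (i < length us)%nat ->
      f (prepend (nth i us []) w) = prepend (nth i vs []) w.

Definition tail2 (x : cantor) : cantor := fun n => x (n + 2)%nat.
Definition tail1 (x : cantor) : cantor := fun n => x (n + 1)%nat.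

Definition gen_a (x : cantor) : cantor :=
  if x 0%nat then x else prepend [false; negb (x 1%nat)] (tail2 x).

Definition gen_b (x : cantor) : cantor :=
  match x 0%nat, x 1%nat with
  | false, false => x
  | false, true => prepend [true; false] (tail2 x)
  | true, false => prepend [true; true] (tail2 x)
  | true, true => prepend [false; true] (tail2 x)
  end.

Definition gen_c (x : cantor) : cantor :=
  match x 0%nat, x 1%nat with
  | true, _ => prepend [false; false] (tail1 x)
  | false, false => prepend [true] (tail2 x)
  | false, true => x
  end.

(* Main.v *)
Require Import Defs.
From Stdlib Require Import Reals Lra Lia ZArith List.
From Stdlib Require Import Classical ClassicalEpsilon FunctionalExtensionality ProofIrrelevance.
Import ListNotations.
Open Scope R_scope.

(** Let k(t) = max(2t/3, t-1) (here [contr]), an increasing homeomorphism of R that is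
    t |-> t-1 for t >= 3.  A configuration of X is cut at its 2s into blocks 2w; a finite w is empty
    or ends in 1, so it is determined by the point w000... of Cantor space, and every infinite w is
    itself such a point.  An element g of V maps the block of w to the block of g(w), and the
    segments are matched as follows.  If w is infinite and g replaces the prefix u by v near w, then
    s is sent to s' with k^|u|(s) = k^|v|(s'); this is well defined because |u| - |v| depends only
    on the germ of g at w.  If 2w is finite of length l+1, then lambda k^l maps its segment [0, l+1]
    onto [0, 1], where lambda = 1 for l = 0 and 3/4 otherwise, and s is sent to the point with the
    same image in [0, 1].  Letters before the first 2 are left alone.  The two prescriptions agree
    on long blocks and are translations far from the 2, which gives continuity; both are visibly
    compatible with composition; and on blocks of length at most 3 they are linear, which gives the
    local rules.  Under an isotopy a point moves along a path of the mapping torus and hence stays on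
    its flow line; applied to the configurations ...1112c this recovers g(c) from the isotopy
    class. *)

(** The constants come from the short blocks. The rules rewrite only blocks of lengths 1, 2 and 3,
    and there they must be affine, so the coordinate of such a block has to be s, s/2 or s/3. One
    application of k passes from length 3 to length 2, which gives the slope 2/3 on [0, 3]; then
    lambda * 2s/3 = s/2 gives 3/4. Length 1 cannot be reached in the same way, since [0, 2] is
    mapped onto [0, 1] with slope 1/2 and not 2/3; hence the exceptional scale for l = 0. The
    exception is harmless because the two prescriptions are compared only when both words are
    nonempty. The obstacle is that the relations of V have to hold exactly and not only up to
    isotopy. On finite blocks a coordinate that does not mention g settles this. An infinite block
    has no right end and so no such coordinate: only the difference of the lengths of the replaced
    prefixes is available, and the relation k^|u|(s) = k^|v|(s') uses just that. The image of a flow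
    line is therefore characterised by a relation, [line_map], instead of being computed. It is
    unique up to an integer shift, and T_X forgets this shift. *)

(** * The contraction and the coordinate of a finite block *)

Definition contr (t : R) : R := Rmax (2 * t / 3) (t - 1).
Definition expand (t : R) : R := Rmin (3 * t / 2) (t + 1).

Lemma contr_lo t : t <= 3 -> contr t = 2 * t / 3.
Proof. intros; unfold contr, Rmax; destruct Rle_dec; lra. Qed.

Lemma contr_hi t : 3 <= t -> contr t = t - 1.
Proof. intros; unfold contr, Rmax; destruct Rle_dec; lra. Qed.

Lemma expand_lo t : t <= 2 -> expand t = 3 * t / 2.
Proof. intros; unfold expand, Rmin; destruct Rle_dec; lra. Qed.

Lemma expand_hi t : 2 <= t -> expand t = t + 1.
Proof. intros; unfold expand, Rmin; destruct Rle_dec; lra. Qed.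

Lemma contr_lt s t : s < t -> contr s < contr t.
Proof. intros; unfold contr, Rmax; repeat destruct Rle_dec; lra. Qed.

Lemma contr_expand t : contr (expand t) = t.
Proof.
  destruct (Rle_dec t 2).
  - rewrite expand_lo, contr_lo; lra.
  - rewrite expand_hi, contr_hi; lra.
Qed.

Definition contr_iter (n : nat) : R -> R := Nat.iter n contr.

Lemma contr_iter_S_r n t : contr_iter (S n) t = contr_iter n (contr t).
Proof. apply Nat.iter_succ_r. Qed.

Lemma contr_iter_add m n t : contr_iter (m + n) t = contr_iter m (contr_iter n t).
Proof. apply Nat.iter_add. Qed.

Lemma contr_iter_lt n s t : s < t -> contr_iter n s < contr_iter n t.
Proof. intros; induction n; simpl; auto using contr_lt. Qed.

Lemma lt_inj (f : R -> R) (Hf : forall s t, s < t -> f s < f t) s t : f s = f t -> s = t.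
Proof.
  intros H; destruct (Rtotal_order s t) as [h|[h|h]]; auto; apply Hf in h; lra.
Qed.

Lemma lt_le (f : R -> R) (Hf : forall s t, s < t -> f s < f t) s t : s <= t -> f s <= f t.
Proof. intros [h| ->]; [left; auto | right; auto]. Qed.

Lemma lt_lt_inv (f : R -> R) (Hf : forall s t, s < t -> f s < f t) s t : f s < f t -> s < t.
Proof.
  intros H; destruct (Rle_or_lt t s) as [h|h]; auto; apply (lt_le f Hf) in h; lra.
Qed.

Lemma lt_le_inv (f : R -> R) (Hf : forall s t, s < t -> f s < f t) s t : f s <= f t -> s <= t.
Proof.
  intros H; destruct (Rle_or_lt s t) as [h|h]; auto; apply Hf in h; lra.
Qed.

Lemma contr_iter_inj n s t : contr_iter n s = contr_iter n t -> s = t.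
Proof. apply lt_inj, contr_iter_lt. Qed.

Lemma contr_iter_0 n : contr_iter n 0 = 0.
Proof. induction n; simpl; auto; rewrite IHn, contr_lo; lra. Qed.

Lemma contr_iter_expand_iter n t : contr_iter n (Nat.iter n expand t) = t.
Proof.
  induction n; auto; rewrite contr_iter_S_r; simpl; rewrite contr_expand; auto.
Qed.

Lemma contr_iter_large n t : 2 <= t -> contr_iter n (t + INR n) = t.
Proof.
  intros Ht; induction n; [simpl; lra|].
  rewrite contr_iter_S_r, contr_hi; rewrite S_INR; pose proof (pos_INR n); [|lra].
  replace (t + (INR n + 1) - 1) with (t + INR n) by lra; auto.
Qed.

Definition coord_scale (l : nat) : R := match l with O => 1 | _ => 3 / 4 end.

Definition block_coord (l : nat) (s : R) : R := coord_scale l * contr_iter l s.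

Lemma coord_scale_pos l : 0 < coord_scale l.
Proof. destruct l; simpl; lra. Qed.

Lemma block_coord_lt l s t : s < t -> block_coord l s < block_coord l t.
Proof. intros; apply Rmult_lt_compat_l; auto using coord_scale_pos, contr_iter_lt. Qed.

Lemma block_coord_inj l s t : block_coord l s = block_coord l t -> s = t.
Proof. apply lt_inj, block_coord_lt. Qed.

Definition block_point (l : nat) (t : R) : R := Nat.iter l expand (t / coord_scale l).

Lemma block_coord_block_point l t : block_coord l (block_point l t) = t.
Proof.
  unfold block_coord, block_point; rewrite contr_iter_expand_iter;
    pose proof (coord_scale_pos l); field; lra.
Qed.

Lemma block_coord_0 l : block_coord l 0 = 0.
Proof. unfold block_coord; rewrite contr_iter_0; lra. Qed.

(** For l >= 1 the end l + 1 is translated down by 1 until it reaches 2; the last contraction sends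
    it to 4/3, whence the scale 3/4. *)
Lemma block_coord_end l : block_coord l (INR l + 1) = 1.
Proof.
  unfold block_coord; destruct l; [simpl; lra|].
  change (contr_iter (S l) ?t) with (contr (contr_iter l t)).
  replace (INR (S l) + 1) with (2 + INR l) by (rewrite S_INR; lra).
  rewrite contr_iter_large, contr_lo; simpl; lra.
Qed.

Lemma block_coord_linear l s : (l <= 2)%nat -> s <= INR l + 1 -> block_coord l s = s / (INR l + 1).
Proof.
  intros Hl Hs; unfold block_coord.
  destruct l as [|[|[|l]]]; [| | |lia]; simpl in *; rewrite ?contr_lo; try lra.
  rewrite contr_lo; lra.
Qed.

(** The bridge from the finite to the infinite prescription: for nonempty words the scales cancel,
    and the l - a contractions common to both sides are injective. *)
Lemma block_coord_shift l l' a b s s' :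
  (1 <= l)%nat -> (1 <= l')%nat -> (a <= l)%nat -> (l + b = l' + a)%nat ->
  block_coord l s = block_coord l' s' -> contr_iter a s = contr_iter b s'.
Proof.
  intros H1 H2 H3 H4 H; unfold block_coord in H.
  assert (E : coord_scale l = coord_scale l') by (destruct l, l'; auto; lia).
  rewrite E in H; apply Rmult_eq_reg_l in H; [|pose proof (coord_scale_pos l'); lra].
  apply (contr_iter_inj (l - a)); rewrite <- !contr_iter_add.
  replace (l - a + a)%nat with l by lia; replace (l - a + b)%nat with l' by lia; auto.
Qed.

Lemma block_coord_shift_inv l l' a b s s' :
  (1 <= l)%nat -> (1 <= l')%nat -> (a <= l)%nat -> (l + b = l' + a)%nat ->
  contr_iter a s = contr_iter b s' -> block_coord l s = block_coord l' s'.
Proof.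
  intros H1 H2 H3 H4 H; unfold block_coord.
  assert (E : coord_scale l = coord_scale l') by (destruct l, l'; auto; lia).
  rewrite E; f_equal.
  replace l with (l - a + a)%nat by lia; replace l' with (l - a + b)%nat by lia.
  rewrite !contr_iter_add; congruence.
Qed.

(** The outermost contraction cancels by injectivity. Starting at a + 1 or later, the other a - 1
    contractions stay in the range where each subtracts 1. *)
Lemma contr_iter_translation a b s s' :
  (1 <= a)%nat -> (1 <= b)%nat -> INR a + 1 <= s -> contr_iter a s = contr_iter b s' ->
  s' = s - INR a + INR b.
Proof.
  intros Ha Hb Hs H; destruct a as [|a]; [lia|]; destruct b as [|b]; [lia|].
  change (contr (contr_iter a s) = contr (contr_iter b s')) in H.
  apply (contr_iter_inj 1) in H; rewrite !S_INR in *.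
  replace s with ((s - INR a) + INR a) in H by lra.
  rewrite contr_iter_large in H by lra.
  rewrite <- (contr_iter_large b (s - INR a)) in H by lra.
  apply contr_iter_inj in H; lra.
Qed.

(** * Increasing bijections, normal forms in the torus, two-sided recursion *)

Definition incr_bij (f : R -> R) : Prop :=
  (forall s t, s < t -> f s < f t) /\ forall r, exists s, f s = r.

Lemma flo_unique t k : IZR k <= t < IZR k + 1 -> flo t = k.
Proof.
  intros H; pose proof (flo_spec t).
  assert (H1 : IZR (flo t) < IZR (k + 1)) by (rewrite plus_IZR; lra).
  assert (H2 : IZR k < IZR (flo t + 1)) by (rewrite plus_IZR; lra).
  apply lt_IZR in H1; apply lt_IZR in H2; lia.
Qed.

Lemma flo_plus t k : flo (t + IZR k) = (flo t + k)%Z.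
Proof. apply flo_unique; rewrite plus_IZR; pose proof (flo_spec t); lra. Qed.

Lemma shiftZ_add j k x : shiftZ j (shiftZ k x) = shiftZ (k + j) x.
Proof. apply functional_extensionality; intros n; unfold shiftZ; f_equal; lia. Qed.

Lemma shiftZ_0 x : shiftZ 0 x = x.
Proof. apply functional_extensionality; intros n; unfold shiftZ; f_equal; lia. Qed.

Lemma TX_eq (p q : TX) : TX_cfg p = TX_cfg q -> TX_time p = TX_time q -> p = q.
Proof.
  destruct p as [[x r] Hp], q as [[y s] Hq]; unfold TX_cfg, TX_time; simpl.
  intros -> ->; f_equal; apply proof_irrelevance.
Qed.

Lemma mkT_shift x hx t y hy s j :
  y = shiftZ j x -> t = s + IZR j -> mkT x hx t = mkT y hy s.
Proof.
  intros -> ->; apply TX_eq; unfold TX_cfg, TX_time; simpl; rewrite flo_plus.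
  - rewrite shiftZ_add; f_equal; lia.
  - rewrite plus_IZR; lra.
Qed.

Lemma mkT_inv x hx t y hy s :
  mkT x hx t = mkT y hy s -> exists j, y = shiftZ j x /\ t = s + IZR j.
Proof.
  intros H; exists (flo t - flo s)%Z.
  pose proof (f_equal TX_cfg H) as H1; pose proof (f_equal TX_time H) as H2.
  unfold TX_cfg, TX_time in *; simpl in *; split.
  - rewrite <- (shiftZ_0 y); replace 0%Z with (flo s + - flo s)%Z by lia.
    rewrite <- shiftZ_add, <- H1, shiftZ_add; f_equal; lia.
  - rewrite minus_IZR; lra.
Qed.

Lemma mkT_self p : mkT (TX_cfg p) (TX_inX p) (TX_time p) = p.
Proof.
  destruct p as [[x r] [Hx Hr]]; unfold TX_cfg, TX_time; simpl in *.
  assert (E : flo r = 0%Z) by (apply flo_unique; lra).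
  apply TX_eq; unfold TX_cfg, TX_time; simpl; rewrite E.
  - apply shiftZ_0.
  - lra.
Qed.

Lemma flow_mkT s x hx t : flow s (mkT x hx t) = mkT x hx (t + s).
Proof.
  unfold flow; symmetry; apply (mkT_shift _ _ _ _ _ _ (flo t)).
  - reflexivity.
  - unfold TX_time; simpl; lra.
Qed.

(** Dependent choice in both directions. It yields the integer offsets for gluing and the
    decomposition of a configuration into the blocks of a local rule. *)
Lemma Z_chain (A : Type) (S : A -> Prop) (rel : A -> A -> Prop) (a0 : A) :
  S a0 -> (forall a, S a -> exists b, S b /\ rel a b) ->
  (forall b, S b -> exists a, S a /\ rel a b) ->
  exists p : Z -> A, p 0%Z = a0 /\ (forall n, S (p n)) /\ forall n, rel (p n) (p (n + 1)%Z).
Proof.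
  intros H0 Hs Hp.
  set (A' := {a | S a}).
  assert (Hs' : forall a : A', {b : A' | rel (proj1_sig a) (proj1_sig b)}).
  { intros [a Ha]; apply constructive_indefinite_description.
    destruct (Hs a Ha) as (b & Hb & Hr); exists (exist _ b Hb); auto. }
  assert (Hp' : forall b : A', {a : A' | rel (proj1_sig a) (proj1_sig b)}).
  { intros [b Hb]; apply constructive_indefinite_description.
    destruct (Hp b Hb) as (a & Ha & Hr); exists (exist _ a Ha); auto. }
  set (nx := fun a => proj1_sig (Hs' a)); set (pv := fun a => proj1_sig (Hp' a)).
  set (a0' := exist _ a0 H0 : A').
  set (p' := fun n : Z => if (0 <=? n)%Z then Nat.iter (Z.to_nat n) nx a0'
                          else Nat.iter (Z.to_nat (- n)) pv a0').
  exists (fun n => proj1_sig (p' n)); split; [reflexivity|]; split.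
  - intros n; apply (proj2_sig (p' n)).
  - intros n; unfold p'.
    destruct (Z.leb_spec 0 n); [destruct (Z.leb_spec 0 (n + 1)); [|lia]|].
    + replace (Z.to_nat (n + 1)) with (1 + Z.to_nat n)%nat by lia; simpl.
      apply (proj2_sig (Hs' _)).
    + replace (Z.to_nat (- n)) with (1 + Z.to_nat (- (n + 1)))%nat by lia; simpl.
      replace (if (0 <=? n + 1)%Z then Nat.iter (Z.to_nat (n + 1)) nx a0'
               else Nat.iter (Z.to_nat (- (n + 1))) pv a0')
        with (Nat.iter (Z.to_nat (- (n + 1))) pv a0').
      * apply (proj2_sig (Hp' _)).
      * destruct (Z.leb_spec 0 (n + 1)); auto.
        replace (n + 1)%Z with 0%Z by lia; reflexivity.
Qed.

Lemma Z_partial_sums (d : Z -> Z) : exists J : Z -> Z, forall k, J (k + 1)%Z = (J k + d k)%Z.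
Proof.
  (* The first component records the index, so that the increment may depend on it. *)
  destruct (Z_chain (Z * Z) (fun _ => True)
              (fun a b => fst b = (fst a + 1)%Z /\ snd b = (snd a + d (fst a))%Z) (0, 0)%Z)
    as (p & Hp0 & _ & Hp); auto.
  - intros [k j] _; exists (k + 1, j + d k)%Z; auto.
  - intros [k j] _; exists (k - 1, j - d (k - 1))%Z; simpl; repeat split; lia.
  - assert (E : forall k, fst (p k) = k).
    { intros k; induction k using Z.peano_ind.
      - rewrite Hp0; auto.
      - unfold Z.succ; rewrite (proj1 (Hp k)); lia.
      - pose proof (proj1 (Hp (Z.pred k))) as H.
        replace (Z.pred k + 1)%Z with k in H by lia; lia. }
    exists (fun k => snd (p k)); intros k.
    rewrite (proj2 (Hp k)), E; auto.
Qed.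

(** * Blocks and prefix replacements *)

Definition block_word (c : cantor) (i : nat) : nat :=
  match i with O => 2 | S j => if c j then 1 else 0 end%nat.

(* c = w000... where w, of length l, is empty or ends in 1. *)
Definition support_size (c : cantor) (l : nat) : Prop :=
  (forall i, (l <= i)%nat -> c i = false) /\ (forall j, l = S j -> c j = true).

Definition fin_block (x : config) (p : Z) (l : nat) (c : cantor) : Prop :=
  support_size c l /\ (forall i, (i <= l)%nat -> x (p + Z.of_nat i)%Z = block_word c i) /\
  x (p + Z.of_nat l + 1)%Z = 2%nat.

Definition inf_block (x : config) (p : Z) (c : cantor) : Prop :=
  forall i, x (p + Z.of_nat i)%Z = block_word c i.

Definition left_tail (x : config) (k : Z) : Prop := forall i, (i <= k)%Z -> x i <> 2%nat.

(* On the cylinder of c of depth a, g replaces the prefix of length a by one of length b. *)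
Definition repl_prefix (g : cantor -> cantor) (c : cantor) (a b : nat) : Prop :=
  forall c', (forall i, (i < a)%nat -> c' i = c i) ->
    (forall i, (i < b)%nat -> g c' i = g c i) /\
    (forall i, g c' (b + i)%nat = c' (a + i)%nat).

(** The form in which membership in V is used. The uniform bound L gives continuity at
    configurations without a 2 to the left; positive lengths are what makes the map a translation
    far inside a block. *)
Definition prefix_replacing (g : cantor -> cantor) : Prop :=
  exists L : nat, forall c, exists a b,
    (1 <= a <= L)%nat /\ (1 <= b)%nat /\ repl_prefix g c a b.

Lemma block_word_S c i : block_word c (S i) <> 2%nat.
Proof. simpl; destruct (c i); lia. Qed.

Lemma block_word_inj c c' i : block_word c (S i) = block_word c' (S i) -> c i = c' i.
Proof. simpl; destruct (c i), (c' i); auto; discriminate. Qed.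

Lemma support_size_unique c l l' : support_size c l -> support_size c l' -> l = l'.
Proof.
  intros [H1 H2] [H3 H4].
  destruct (lt_eq_lt_dec l l') as [[h|h]|h]; auto.
  - destruct l' as [|j]; [lia|]; specialize (H4 j eq_refl); rewrite H1 in H4; [discriminate|lia].
  - destruct l as [|j]; [lia|]; specialize (H2 j eq_refl); rewrite H3 in H2; [discriminate|lia].
Qed.

Lemma support_size_exists c n : (forall i, (n <= i)%nat -> c i = false) ->
  exists l, (l <= n)%nat /\ support_size c l.
Proof.
  induction n; intros H.
  - exists 0%nat; repeat split; auto; discriminate.
  - destruct (c n) eqn:E.
    + exists (S n); repeat split; auto; intros j [= <-]; auto.
    + destruct IHn as (l & Hl & H').
      * intros i Hi; destruct (Nat.eq_dec i n) as [->|]; auto; apply H; lia.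
      * exists l; auto.
Qed.

Lemma repl_prefix_extend g c a b e : repl_prefix g c a b -> repl_prefix g c (a + e) (b + e).
Proof.
  intros H c' Hc'; destruct (H c') as [H1 H2]; [intros; apply Hc'; lia|].
  destruct (H c) as [_ H3]; [auto|]; split.
  - intros i Hi; destruct (Nat.lt_ge_cases i b); auto.
    replace i with (b + (i - b))%nat by lia; rewrite H2, H3; apply Hc'; lia.
  - intros i; replace (b + e + i)%nat with (b + (e + i))%nat by lia; rewrite H2; f_equal; lia.
Qed.

Lemma repl_prefix_tail g c a b i : repl_prefix g c a b -> g c (b + i)%nat = c (a + i)%nat.
Proof. intros H; apply (H c); auto. Qed.

Lemma repl_prefix_agree g c c' a b : repl_prefix g c a b -> (forall i, (i < a)%nat ->
  c' i = c i) -> repl_prefix g c' a b.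
Proof.
  intros H H' d Hd; destruct (H c') as [H1 _]; auto.
  destruct (H d) as [H3 H4].
  - intros i Hi; rewrite Hd; auto.
  - split; auto; intros i Hi; rewrite H3, H1; auto.
Qed.

(* Flip the digit of c just after the prefix of length a. *)
Lemma repl_prefix_image_length g c a b b' : repl_prefix g c a b -> repl_prefix g c a b' ->
  ~ (b < b')%nat.
Proof.
  intros H H' Hb.
  set (c' := fun i => if Nat.eqb i a then negb (c i) else c i).
  assert (Hc : forall i, (i < a)%nat -> c' i = c i).
  { intros i Hi; unfold c'; destruct (Nat.eqb_spec i a); auto; lia. }
  destruct (H c' Hc) as [_ H1]; destruct (H' c' Hc) as [H2 _].
  specialize (H1 0%nat); specialize (H2 b Hb).
  pose proof (repl_prefix_tail g c a b 0 H) as H3; rewrite !Nat.add_0_r in *.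
  unfold c' in H1 at 2; rewrite Nat.eqb_refl in H1; destruct (c a); simpl in *; congruence.
Qed.

(** Extend both replacements to the common source length a + a', where the target length is
    determined. *)
Lemma repl_prefix_lag g c a b a' b' : repl_prefix g c a b -> repl_prefix g c a' b' ->
  (a + b' = a' + b)%nat.
Proof.
  intros H H'.
  pose proof (repl_prefix_extend _ _ _ _ a' H) as E1;
    pose proof (repl_prefix_extend _ _ _ _ a H') as E2.
  rewrite (Nat.add_comm a' a) in E2.
  pose proof (repl_prefix_image_length _ _ _ _ _ E1 E2);
    pose proof (repl_prefix_image_length _ _ _ _ _ E2 E1); lia.
Qed.

Lemma repl_prefix_comp f g c a b d : repl_prefix f c a b -> repl_prefix g (f c) b d ->
  repl_prefix (fun c => g (f c)) c a d.
Proof.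
  intros Hf Hg c' Hc'; destruct (Hf c' Hc') as [H1 H2].
  destruct (Hg (f c') H1) as [H3 H4]; split; auto.
  intros i; rewrite H4; auto.
Qed.

Lemma repl_prefix_inverse g h c a b :
  (forall c, h (g c) = c) -> repl_prefix g c a b -> repl_prefix h (g c) b a.
Proof.
  intros Hh H d Hd.
  (* The preimage of d under g: the prefix of c followed by the tail of d. *)
  set (c' := fun i => if Nat.ltb i a then c i else d (b + (i - a))%nat).
  assert (Hc : forall i, (i < a)%nat -> c' i = c i).
  { intros i Hi; unfold c'; destruct (Nat.ltb_spec i a); auto; lia. }
  assert (Hc' : forall i, c' (a + i)%nat = d (b + i)%nat).
  { intros i; unfold c'; destruct (Nat.ltb_spec (a + i) a); [lia|]; f_equal; lia. }
  destruct (H c' Hc) as [H1 H2].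
  assert (E : g c' = d).
  { apply functional_extensionality; intros i.
    destruct (Nat.lt_ge_cases i b).
    - rewrite H1, Hd; auto.
    - replace i with (b + (i - b))%nat by lia; rewrite H2, Hc'; auto. }
  rewrite <- E, !Hh; split; auto.
Qed.

Lemma prefix_replacing_comp f g : prefix_replacing f -> prefix_replacing g ->
  prefix_replacing (fun c => g (f c)).
Proof.
  intros [L Hf] [M Hg]; exists (L + M)%nat; intros c.
  destruct (Hf c) as (a & b & Ha & Hb & H); destruct (Hg (f c)) as (a' & b' & Ha' & Hb' & H').
  (* Both replacements are extended so that the middle prefix has length max(b, a'); with truncated
     subtraction this is b + (a' - b) = a' + (b - a'). *)
  exists (a + (a' - b))%nat, (b' + (b - a'))%nat; split; [lia|]; split; [lia|].
  apply repl_prefix_comp with (b + (a' - b))%nat; [apply repl_prefix_extend; auto|].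
  replace (b + (a' - b))%nat with (a' + (b - a'))%nat by lia; apply repl_prefix_extend; auto.
Qed.

Lemma prefix_replacing_id : prefix_replacing (fun c => c).
Proof.
  exists 1%nat; intros c; exists 1%nat, 1%nat; split; [lia|]; split; [lia|].
  intros c' H; split; auto.
Qed.

Lemma is_prefix_prepend u w : is_prefix u (prepend u w).
Proof. intros i Hi; unfold prepend; destruct (Nat.ltb_spec i (length u)); auto; lia. Qed.

Lemma prepend_prefix u c : is_prefix u c -> c = prepend u (fun i => c (length u + i)%nat).
Proof.
  intros H; apply functional_extensionality; intros i; unfold prepend.
  destruct (Nat.ltb_spec i (length u)).
  - symmetry; auto.
  - f_equal; lia.
Qed.

Lemma prepend_lo u w i : (i < length u)%nat -> prepend u w i = nth i u false.
Proof. intros; unfold prepend; destruct (Nat.ltb_spec i (length u)); auto; lia. Qed.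

Lemma prepend_hi u w i : prepend u w (length u + i)%nat = w i.
Proof.
  unfold prepend; destruct (Nat.ltb_spec (length u + i) (length u)); [lia|]; f_equal; lia.
Qed.

Lemma in_V_repl_prefix g us vs c i :
  (forall i w, (i < length us)%nat -> g (prepend (nth i us []) w) = prepend (nth i vs []) w) ->
  (i < length us)%nat -> is_prefix (nth i us []) c ->
  repl_prefix g c (length (nth i us [])) (length (nth i vs [])).
Proof.
  intros Hg Hi Hc c' Hc'.
  assert (Hp : is_prefix (nth i us []) c').
  { intros j Hj; rewrite Hc'; auto. }
  rewrite (prepend_prefix _ _ Hc), (prepend_prefix _ _ Hp), !Hg by auto; split.
  - intros j Hj; rewrite !prepend_lo; auto.
  - intros j; rewrite !prepend_hi; auto.
Qed.

Lemma list_length_bound (us : list (list bool)) :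
  exists L, forall i, (length (nth i us []) <= L)%nat.
Proof.
  induction us as [|u us [L H]].
  - exists 0%nat; intros [|i]; simpl; auto.
  - exists (length u + L)%nat; intros [|i]; simpl; [lia|]; specialize (H i); lia.
Qed.

(** Words of the code may be empty; one extra letter on both sides makes the lengths positive. *)
Lemma prefix_replacing_in_V g : in_V g -> prefix_replacing g.
Proof.
  intros (us & vs & _ & Hu & _ & Hg).
  destruct (list_length_bound us) as [L HL]; exists (L + 1)%nat; intros c.
  destruct (Hu c) as (i & [Hi Hc] & _).
  pose proof (in_V_repl_prefix g us vs c i Hg Hi Hc) as H;
    apply (repl_prefix_extend _ _ _ _ 1) in H.
  specialize (HL i); eexists _, _; split; [|split; [|exact H]]; lia.
Qed.

Definition prefix_bij (g h : cantor -> cantor) : Prop :=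
  prefix_replacing g /\ prefix_replacing h /\ (forall c, h (g c) = c) /\ (forall c, g (h c) = c).

(** Completeness of the target code gives surjectivity, and uniqueness of the matching target word
    gives injectivity. The inverse is again prefix replacing, with the lengths exchanged. *)
Lemma in_V_inverse g : in_V g -> exists h, prefix_bij g h.
Proof.
  intros Hin; pose proof (prefix_replacing_in_V g Hin) as HV.
  destruct Hin as (us & vs & Hlen & Hu & Hv & Hg).
  assert (Hsurj : forall d, exists c, g c = d).
  { intros d; destruct (Hv d) as (i & [Hi Hd] & _).
    eexists (prepend (nth i us []) _); rewrite Hg by lia; symmetry.
    apply prepend_prefix; auto. }
  assert (Hinj : forall c c', g c = g c' -> c = c').
  { intros c c' H; destruct (Hu c) as (i & [Hi Hc] & _), (Hu c') as (j & [Hj Hc'] & _).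
    rewrite (prepend_prefix _ _ Hc), (prepend_prefix _ _ Hc') in H |- *.
    rewrite !Hg in H by auto.
    (* The common image begins with the target words of index i and of index j, so i = j. *)
    match type of H with ?A = _ => destruct (Hv A) as (k & _ & Hk) end.
    assert (E : i = j).
    { transitivity k; [symmetry|]; apply Hk; split; try lia; [|rewrite H];
        apply is_prefix_prepend. }
    subst j; f_equal; apply functional_extensionality; intros n.
    apply (f_equal (fun z => z (length (nth i vs []) + n)%nat)) in H.
    rewrite !prepend_hi in H; auto. }
  set (h := fun d => proj1_sig (constructive_indefinite_description _ (Hsurj d))).
  assert (Hgh : forall d, g (h d) = d).
  { intros d; unfold h; destruct constructive_indefinite_description; auto. }
  assert (Hhg : forall c, h (g c) = c) by (intros c; apply Hinj, Hgh).
  exists h; split; auto; split; auto.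
  destruct (list_length_bound vs) as [L HL]; exists (L + 1)%nat; intros d.
  destruct (Hu (h d)) as (i & [Hi Hc] & _).
  pose proof (in_V_repl_prefix g us vs (h d) i Hg Hi Hc) as H;
    apply (repl_prefix_extend _ _ _ _ 1) in H.
  apply (repl_prefix_inverse _ h) in H; auto; rewrite Hgh in H.
  specialize (HL i); eexists _, _; split; [|split; [|exact H]]; lia.
Qed.

(** * Cutting a configuration at its 2s, and images of flow lines *)

Lemma fin_block_start x p l c : fin_block x p l c -> x p = 2%nat.
Proof. intros (_ & H & _); specialize (H 0%nat); simpl in H; rewrite Z.add_0_r in H; apply H;
  lia. Qed.

Lemma inf_block_start x p c : inf_block x p c -> x p = 2%nat.
Proof. intros H; specialize (H 0%nat); simpl in H; rewrite Z.add_0_r in H; apply H. Qed.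

Lemma fin_block_only_start x p l c k : fin_block x p l c -> (p <= k <= p + Z.of_nat l)%Z ->
  x k = 2%nat -> k = p.
Proof.
  intros (_ & H & _) Hk Hx.
  specialize (H (Z.to_nat (k - p)) ltac:(lia)).
  replace (p + Z.of_nat (Z.to_nat (k - p)))%Z with k in H by lia.
  destruct (Z.to_nat (k - p)) as [|i] eqn:E; [lia|].
  exfalso; apply (block_word_S c i); congruence.
Qed.

Lemma inf_block_only_start x p c k : inf_block x p c -> (p <= k)%Z -> x k = 2%nat -> k = p.
Proof.
  intros H Hk Hx; specialize (H (Z.to_nat (k - p))).
  replace (p + Z.of_nat (Z.to_nat (k - p)))%Z with k in H by lia.
  destruct (Z.to_nat (k - p)) as [|i] eqn:E; [lia|].
  exfalso; apply (block_word_S c i); congruence.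
Qed.

Lemma last_two x k : left_tail x k \/ exists p, (p <= k)%Z /\ x p = 2%nat /\ forall i, (p < i <= k)%Z -> x i <> 2%nat.
Proof.
  destruct (classic (left_tail x k)) as [|H]; auto; right.
  assert (H' : exists n : nat, x (k - Z.of_nat n)%Z = 2%nat).
  { apply NNPP; intros H'; apply H; intros i Hi Hx; apply H'.
    exists (Z.to_nat (k - i)); rewrite Z2Nat.id by lia.
    replace (k - (k - i))%Z with i by lia; auto. }
  destruct (dec_inh_nat_subset_has_unique_least_element
              (fun n => x (k - Z.of_nat n)%Z = 2%nat)) as (n & [Hn Hm] & _); auto.
  { intros n; apply classic. }
  exists (k - Z.of_nat n)%Z; split; [lia|]; split; auto.
  intros i Hi Hx; specialize (Hm (Z.to_nat (k - i))).
  rewrite Z2Nat.id in Hm by lia; replace (k - (k - i))%Z with i in Hm by lia.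
  specialize (Hm Hx); lia.
Qed.

Lemma block_at x p : inX x -> x p = 2%nat ->
  (exists l c, fin_block x p l c) \/ exists c, inf_block x p c.
Proof.
  intros Hx Hp.
  destruct (classic (exists l : nat, x (p + Z.of_nat l + 1)%Z = 2%nat)) as [H|H].
  - left; destruct (dec_inh_nat_subset_has_unique_least_element
      (fun l => x (p + Z.of_nat l + 1)%Z = 2%nat)) as (l & [Hl Hm] & _); auto.
    { intros n; apply classic. }
    exists l, (fun i => andb (Nat.ltb i l) (Nat.eqb (x (p + Z.of_nat i + 1)%Z) 1)).
    split; [split|split]; auto.
    + intros i Hi; destruct (Nat.ltb_spec i l); auto; lia.
    (* The letter before the next 2 is not 2 by minimality and not 0 because 02 does not occur, so
       it is 1. *)
    + intros j ->; destruct (Nat.ltb_spec j (S j)); [simpl|lia].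
      destruct (Hx (p + Z.of_nat j + 1)%Z) as [H1 H2].
      replace (p + Z.of_nat j + 1 + 1)%Z with (p + Z.of_nat (S j) + 1)%Z in H2 by lia.
      assert (x (p + Z.of_nat j + 1)%Z <> 2%nat) by (intros E; apply Hm in E; lia).
      apply Nat.eqb_eq; lia.
    + intros [|i] Hi; simpl block_word; [rewrite Z.add_0_r; auto|].
      destruct (Nat.ltb_spec i l); [simpl andb|lia].
      assert (x (p + Z.of_nat i + 1)%Z <> 2%nat) by (intros E; apply Hm in E; lia).
      replace (p + Z.of_nat (S i))%Z with (p + Z.of_nat i + 1)%Z by lia.
      destruct (Hx (p + Z.of_nat i + 1)%Z) as [Hb1 Hb2].
      destruct (Nat.eqb_spec (x (p + Z.of_nat i + 1)%Z) 1); lia.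
  - right; exists (fun i => Nat.eqb (x (p + Z.of_nat i + 1)%Z) 1); intros [|i]; simpl block_word.
    + rewrite Z.add_0_r; auto.
    + assert (x (p + Z.of_nat i + 1)%Z <> 2%nat) by (intros E; apply H; eauto).
      replace (p + Z.of_nat (S i))%Z with (p + Z.of_nat i + 1)%Z by lia.
      destruct (Hx (p + Z.of_nat i + 1)%Z) as [Hb1 Hb2].
      destruct (Nat.eqb_spec (x (p + Z.of_nat i + 1)%Z) 1); lia.
Qed.

Lemma trichotomy x k : inX x ->
  left_tail x k \/ (exists p l c, fin_block x p l c /\ (p <= k <= p + Z.of_nat l)%Z) \/
  (exists p c, inf_block x p c /\ (p <= k)%Z).
Proof.
  intros Hx; destruct (last_two x k) as [H|(p & Hpk & Hp & Hno)]; auto; right.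
  destruct (block_at x p Hx Hp) as [(l & c & H)|(c & H)]; [left|right; eauto].
  exists p, l, c; split; auto; split; auto.
  destruct H as (_ & _ & He).
  destruct (Z_le_gt_dec k (p + Z.of_nat l)); auto.
  exfalso; apply (Hno (p + Z.of_nat l + 1)%Z); auto; lia.
Qed.

Lemma fin_block_unique x p l c l' c' : fin_block x p l c -> fin_block x p l' c' -> l = l' /\ c = c'.
Proof.
  intros H H'.
  assert (E : l = l').
  { destruct (lt_eq_lt_dec l l') as [[h|h]|h]; auto.
    - pose proof (fin_block_only_start x p l' c' (p + Z.of_nat l + 1) H' ltac:(lia) (proj2 (proj2 H))); lia.
    - pose proof (fin_block_only_start x p l c (p + Z.of_nat l' + 1) H ltac:(lia) (proj2 (proj2 H'))); lia. }
  subst l'; split; auto; apply functional_extensionality; intros i.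
  destruct H as ([H1 _] & H2 & _), H' as ([H1' _] & H2' & _).
  destruct (Nat.lt_ge_cases i l).
  - apply block_word_inj; rewrite <- H2, <- H2' by lia; auto.
  - rewrite H1, H1'; auto.
Qed.

(* y is the image configuration of x under g, and the point at time t of the flow line of [x, 0] is
   sent to time tau t of the flow line of [y, 0]. *)
Record line_map (g : cantor -> cantor) (x y : config) (tau : R -> R) : Prop := {
  line_map_src : inX x;
  line_map_tgt : inX y;
  line_map_incr_bij : incr_bij tau;
  line_map_fin_block : forall p l c, fin_block x p l c -> exists q l', fin_block y q l' (g c) /\
    forall s, 0 <= s <= INR l + 1 -> block_coord l s = block_coord l' (tau (IZR p + s) - IZR q);
  line_map_inf_block : forall p c, inf_block x p c ->
    exists q a b, inf_block y q (g c) /\ repl_prefix g c a b /\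
    forall s, 0 <= s -> contr_iter a s = contr_iter b (tau (IZR p + s) - IZR q);
  line_map_left_tail : forall k, left_tail x k -> exists j,
    (forall t, t <= IZR k + 1 -> tau t = t + IZR j) /\
    (forall i, (i <= k)%Z -> y (i + j)%Z = x i) }.

Lemma incr_bij_inverse f : incr_bij f ->
  exists h, incr_bij h /\ (forall r, f (h r) = r) /\ forall t, h (f t) = t.
Proof.
  intros [Hm Hs].
  set (h := fun r => proj1_sig (constructive_indefinite_description _ (Hs r))).
  assert (E : forall r, f (h r) = r).
  { intros r; unfold h; destruct constructive_indefinite_description; auto. }
  assert (E' : forall t, h (f t) = t) by (intros; apply (lt_inj f Hm), E).
  exists h; repeat split; auto.
  - intros s t H; apply (lt_lt_inv f Hm); rewrite !E; auto.
  - intros r; exists (f r); auto.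
Qed.

Lemma IZR_of_nat n : IZR (Z.of_nat n) = INR n.
Proof. symmetry; apply INR_IZR_INZ. Qed.

(** The coordinate of a finite block is 0 and 1 at its ends whatever its length, so ends go to
    ends. *)
Lemma fin_block_ends (tau : R -> R) p q l l' :
  (forall s, 0 <= s <= INR l + 1 -> block_coord l s = block_coord l' (tau (IZR p + s) - IZR q)) ->
  tau (IZR p) = IZR q /\ tau (IZR p + INR l + 1) = IZR q + INR l' + 1.
Proof.
  intros H; pose proof (pos_INR l); split.
  - specialize (H 0 ltac:(lra)); rewrite block_coord_0, Rplus_0_r in H.
    assert (E : tau (IZR p) - IZR q = 0) by (apply (block_coord_inj l'); rewrite block_coord_0;
      auto); lra.
  - specialize (H (INR l + 1) ltac:(lra)); rewrite block_coord_end in H; rewrite Rplus_assoc.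
    assert (E : tau (IZR p + (INR l + 1)) - IZR q = INR l' + 1)
      by (apply (block_coord_inj l'); rewrite block_coord_end; auto); lra.
Qed.

Lemma inf_block_end (tau : R -> R) p q a b :
  (forall s, 0 <= s -> contr_iter a s = contr_iter b (tau (IZR p + s) - IZR q)) ->
  tau (IZR p) = IZR q.
Proof.
  intros H; specialize (H 0 ltac:(lra)); rewrite contr_iter_0, Rplus_0_r in H.
  assert (E : tau (IZR p) - IZR q = 0) by (apply (contr_iter_inj b); rewrite contr_iter_0; auto);
    lra.
Qed.

Lemma line_map_id x : inX x -> line_map (fun c => c) x x (fun t => t).
Proof.
  intros Hx; split; auto.
  - split; eauto.
  - intros p l c H; exists p, l; split; auto; intros s _; f_equal; lra.
  - intros p c H; exists p, 0%nat, 0%nat; split; auto; split.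
    + intros c' _; split; auto; lia.
    + intros s _; simpl; lra.
  - intros k H; exists 0%Z; split; intros; [lra|f_equal; lia].
Qed.

Lemma line_map_shift_src g x y tau j :
  line_map g x y tau -> line_map g (shiftZ j x) y (fun t => tau (t + IZR j)).
Proof.
  intros H; split; try apply H.
  - apply inX_shiftZ, H.
  - destruct (line_map_incr_bij _ _ _ _ H) as [Hm Hs]; split.
    + intros s t h; apply Hm; lra.
    + intros r; destruct (Hs r) as [s E]; exists (s - IZR j); rewrite <- E; f_equal; lra.
  - intros p l c (H1 & H2 & H3);
    destruct (line_map_fin_block _ _ _ _ H (p + j)%Z l c) as (q & l' & H4 & H5).
    + unfold shiftZ in *; split; auto; split.
      * intros i Hi; rewrite <- H2 by auto; f_equal; lia.
      * rewrite <- H3; f_equal; lia.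
    + exists q, l'; split; auto; intros s Hs; rewrite H5, plus_IZR by auto.
      do 2 f_equal; f_equal; lra.
  - intros p c Hb; destruct (line_map_inf_block _ _ _ _ H (p + j)%Z c) as (q & a & b & H1 & H2 & H3).
    + intros i; rewrite <- Hb; unfold shiftZ; f_equal; lia.
    + exists q, a, b; split; auto; split; auto; intros s Hs; rewrite H3, plus_IZR by auto.
      do 2 f_equal; f_equal; lra.
  - intros k Hk; destruct (line_map_left_tail _ _ _ _ H (k + j)%Z) as (i & H1 & H2).
    + intros n Hn; specialize (Hk (n - j)%Z ltac:(lia)); unfold shiftZ in Hk.
      replace (n - j + j)%Z with n in Hk by lia; auto.
    + exists (i + j)%Z; split.
      * intros t Ht; rewrite H1 by (rewrite plus_IZR; lra); rewrite plus_IZR; lra.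
      * intros n Hn; unfold shiftZ; rewrite <- H2 by lia; f_equal; lia.
Qed.

(** On finite blocks the coordinate of the middle block simply drops out. On infinite blocks the two
    relations first have to be brought to the same number of contractions in the middle. *)
Lemma line_map_comp f g x y z tau tau' :
  line_map f x y tau -> line_map g y z tau' ->
    line_map (fun c => g (f c)) x z (fun t => tau' (tau t)).
Proof.
  intros H H'; pose proof (line_map_incr_bij _ _ _ _ H) as [Hm Hs];
    pose proof (line_map_incr_bij _ _ _ _ H') as [Hm' Hs'].
  split; [apply H|apply H'| | | |].
  - split; auto; intros r; destruct (Hs' r) as [s <-]; destruct (Hs s) as [t <-]; eauto.
  - intros p l c Hb; destruct (line_map_fin_block _ _ _ _ H p l c Hb) as (q & l1 & H1 & H2).
    destruct (line_map_fin_block _ _ _ _ H' q l1 _ H1) as (q2 & l2 & H3 & H4).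
    exists q2, l2; split; auto; intros s Hsr; rewrite H2 by auto.
    destruct (fin_block_ends _ _ _ _ _ H2) as [E1 E2].
    rewrite H4; [do 2 f_equal; f_equal; lra|].
    pose proof (lt_le tau Hm (IZR p) (IZR p + s) ltac:(lra)).
    pose proof (lt_le tau Hm (IZR p + s) (IZR p + INR l + 1) ltac:(lra)); lra.
  - intros p c Hb; destruct (line_map_inf_block _ _ _ _ H p c Hb) as (q & a & b & H1 & H2 & H3).
    destruct (line_map_inf_block _ _ _ _ H' q _ H1) as (q2 & a' & b' & H4 & H5 & H6).
    (* The same padding to max(b, a') as for the composition of prefix replacements. *)
    exists q2, (a + (a' - b))%nat, (b' + (b - a'))%nat; split; auto; split.
    + apply repl_prefix_comp with (b + (a' - b))%nat; [apply repl_prefix_extend; auto|].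
      replace (b + (a' - b))%nat with (a' + (b - a'))%nat by lia; apply repl_prefix_extend; auto.
    + intros s Hsr; rewrite (Nat.add_comm a), (Nat.add_comm b'), !contr_iter_add, H3 by auto.
      rewrite <- contr_iter_add.
      replace (a' - b + b)%nat with (b - a' + a')%nat by lia; rewrite contr_iter_add, H6.
      * do 3 f_equal; f_equal; lra.
      * pose proof (inf_block_end _ _ _ _ _ H3).
        pose proof (lt_le tau Hm (IZR p) (IZR p + s) ltac:(lra)); lra.
  - intros k Hk; destruct (line_map_left_tail _ _ _ _ H k Hk) as (j & H1 & H2).
    destruct (line_map_left_tail _ _ _ _ H' (k + j)%Z) as (j' & H3 & H4).
    + intros i Hi; replace i with ((i - j) + j)%Z by lia; rewrite H2 by lia; apply Hk; lia.
    + exists (j + j')%Z; split.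
      * intros t Ht; rewrite H1, H3, plus_IZR; auto; rewrite ?plus_IZR; lra.
      * intros i Hi; rewrite Z.add_assoc, H4, H2 by lia; auto.
Qed.

(** * Locality, uniqueness and continuity of the image *)

(** As soon as a block shows one letter more than the prefix that g replaces, its image obeys the
    infinite prescription with these lengths, whether or not the block ends later. So nearby
    configurations have nearby images even when one block is finite and the other is not. *)
Lemma long_block g x y tau p c a b K :
  line_map g x y tau -> (forall i, (i <= K)%nat -> x (p + Z.of_nat i)%Z = block_word c i) ->
  repl_prefix g c a b -> (a + 1 <= K)%nat ->
  exists q, tau (IZR p) = IZR q /\
    (forall s, 0 <= s <= INR K + 1 -> contr_iter a s = contr_iter b (tau (IZR p + s) - IZR q)) /\
    (forall i, (i + a <= K + b)%nat -> y (q + Z.of_nat i)%Z = block_word (g c) i).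
Proof.
  intros H Hc Hv HK.
  assert (Hp : x p = 2%nat) by (specialize (Hc 0%nat ltac:(lia)); simpl in Hc;
    rewrite Z.add_0_r in Hc; auto).
  assert (Hlet : forall c0, (forall i, (i < K)%nat -> c0 i = c i) ->
            forall i, (i + a <= K + b)%nat -> block_word (g c0) i = block_word (g c) i).
  { intros c0 H0 [|i] Hi; auto; simpl.
    destruct (Hv c0) as [H1 H2]; [intros; apply H0; lia|].
    replace (g c0 i) with (g c i); auto.
    destruct (Nat.lt_ge_cases i b); [symmetry; auto|].
    replace i with (b + (i - b))%nat by lia.
    rewrite H2, (repl_prefix_tail _ _ _ _ _ Hv), H0; auto; lia. }
  destruct (block_at x p (line_map_src _ _ _ _ H) Hp) as [(l & c0 & Hb)|(c0 & Hb)].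
  - assert (Hl : (K <= l)%nat).
    { destruct (Nat.le_gt_cases K l); auto; destruct Hb as (_ & _ & Hb).
      replace (p + Z.of_nat l + 1)%Z with (p + Z.of_nat (S l))%Z in Hb by lia.
      rewrite Hc in Hb by lia; exfalso; eapply block_word_S; eauto. }
    assert (H0 : forall i, (i < K)%nat -> c0 i = c i).
    { intros i Hi; apply block_word_inj; rewrite <- Hc by lia; symmetry; apply Hb; lia. }
    assert (Hv0 : repl_prefix g c0 a b) by (apply (repl_prefix_agree _ c); auto; intros;
      apply H0; lia).
    destruct (line_map_fin_block _ _ _ _ H _ _ _ Hb) as (q & l' & H1 & H2).
    destruct (fin_block_ends _ _ _ _ _ H2) as [E1 _].
    (* Since l > a, the final 1 of the word lies in the tail that g copies. *)
    assert (El : l' = (l - a + b)%nat).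
    { apply (support_size_unique (g c0)); [apply H1|]; destruct Hb as ([F1 F2] & _); split.
      - intros i Hi; replace i with (b + (i - b))%nat by lia.
        rewrite (repl_prefix_tail _ _ _ _ _ Hv0); apply F1; lia.
      - intros j Hj; replace j with (b + (j - b))%nat by lia.
        rewrite (repl_prefix_tail _ _ _ _ _ Hv0); apply F2; lia. }
    exists q; split; auto; split.
    + intros s Hs; apply (block_coord_shift l l'); try lia; apply H2.
      apply le_INR in Hl; lra.
    + intros i Hi; rewrite <- (Hlet c0) by auto; apply H1; lia.
  - assert (H0 : forall i, (i < K)%nat -> c0 i = c i).
    { intros i Hi; apply block_word_inj; rewrite <- Hc by lia; symmetry; apply Hb. }
    assert (Hv0 : repl_prefix g c0 a b) by (apply (repl_prefix_agree _ c); auto; intros;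
      apply H0; lia).
    destruct (line_map_inf_block _ _ _ _ H _ _ Hb) as (q & a' & b' & H1 & Hv' & H2).
    exists q; split; [eapply inf_block_end; eauto|]; split.
    + intros s Hs; pose proof (repl_prefix_lag _ _ _ _ _ _ Hv0 Hv').
      (* Contract a' more times on both sides: equality of the lags gives a' + b = a + b', which
         reduces the claim to the relation for a' and b'. *)
      apply (contr_iter_inj a'); rewrite <- !contr_iter_add, (Nat.add_comm a' a).
      replace (a' + b)%nat with (a + b')%nat by lia; rewrite !contr_iter_add; f_equal.
      apply H2; lra.
    + intros i Hi; rewrite <- (Hlet c0) by auto; apply H1.
Qed.

Lemma long_block_unit g x y tau p c a b K :
  line_map g x y tau -> (forall i, (i <= K)%nat -> x (p + Z.of_nat i)%Z = block_word c i) ->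
  repl_prefix g c a b -> (1 <= a)%nat -> (1 <= b)%nat -> (a + 1 <= K)%nat ->
  exists j, (forall t, IZR p + INR K <= t <= IZR p + INR K + 1 -> tau t = t + IZR j) /\
    y (p + Z.of_nat K + j)%Z = x (p + Z.of_nat K)%Z.
Proof.
  intros H Hc Hv Ha Hb HK.
  destruct (long_block _ _ _ _ _ _ _ _ _ H Hc Hv HK) as (q & H1 & H2 & H3).
  (* q - p is the displacement of the leading 2, and b - a the change of length of the prefix. *)
  exists (q - p + Z.of_nat b - Z.of_nat a)%Z; split.
  - intros t Ht; apply le_INR in HK; rewrite plus_INR in HK; simpl in HK.
    pose proof (pos_INR a); pose proof (pos_INR K).
    pose proof (H2 (t - IZR p) ltac:(lra)) as E.
    apply contr_iter_translation in E; auto; [|lra].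
    replace (IZR p + (t - IZR p)) with t in E by lra.
    rewrite minus_IZR, plus_IZR, minus_IZR, !IZR_of_nat; lra.
  - replace (p + Z.of_nat K + (q - p + Z.of_nat b - Z.of_nat a))%Z
      with (q + Z.of_nat (b + (K - a)))%Z by lia.
    rewrite H3, Hc by lia.
    replace (b + (K - a))%nat with (S (b + (K - a - 1))) by lia.
    replace K with (S (a + (K - a - 1))) at 2 by lia; simpl.
    rewrite (repl_prefix_tail _ _ _ _ _ Hv); auto.
Qed.

(** Times are compared on the closed segment, so that neighbouring segments share a point and must
    have the same j. Letters are compared on the half-open one, since the letter read at the right
    end belongs to the next segment. *)
Definition same_near (k : Z) (tau : R -> R) (y : config) (tau' : R ->
  R) (y' : config) (j : Z) : Prop :=
  forall t, IZR k <= t <= IZR k + 1 -> tau' t = tau t + IZR j /\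
    (t < IZR k + 1 -> forall i, IZR i <= tau t < IZR i + 1 -> y' (i + j)%Z = y i).

Lemma local_fin_block g x y tau x' y' tau' p l c k :
  line_map g x y tau -> line_map g x' y' tau' -> fin_block x p l c -> fin_block x' p l c ->
  (p <= k <= p + Z.of_nat l)%Z -> exists j, same_near k tau y tau' y' j.
Proof.
  intros H H' Hb Hb' Hk.
  destruct (line_map_fin_block _ _ _ _ H _ _ _ Hb) as (q & l1 & H1 & H2).
  destruct (line_map_fin_block _ _ _ _ H' _ _ _ Hb') as (q' & l2 & H1' & H2').
  destruct (fin_block_ends _ _ _ _ _ H2) as [E1 E2].
  assert (l2 = l1) by (apply (support_size_unique (g c)); [apply H1'|apply H1]); subst l2.
  exists (q' - q)%Z; intros t Ht.
  assert (Hpt : IZR p <= t) by (assert (IZR p <= IZR k) by (apply IZR_le; lia); lra).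
  assert (Hkl : IZR k <= IZR p + INR l)
    by (rewrite <- IZR_of_nat, <- plus_IZR; apply IZR_le; lia).
  specialize (H2 (t - IZR p) ltac:(lra)); specialize (H2' (t - IZR p) ltac:(lra)).
  rewrite H2 in H2'; apply block_coord_inj in H2'.
  replace (IZR p + (t - IZR p)) with t in H2' by lra.
  rewrite minus_IZR; split; [lra|].
  intros Ht' i Hi; destruct (line_map_incr_bij _ _ _ _ H) as [Hm _].
  pose proof (lt_le tau Hm _ _ Hpt); pose proof (Hm t (IZR p + INR l + 1) ltac:(lra)) as Hlt.
  assert (q < i + 1)%Z by (apply lt_IZR; rewrite plus_IZR; lra).
  assert (i < q + Z.of_nat l1 + 1)%Z by (apply lt_IZR; rewrite !plus_IZR, IZR_of_nat; lra).
  destruct H1 as (_ & H1 & _), H1' as (_ & H1' & _).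
  replace (i + (q' - q))%Z with (q' + Z.of_nat (Z.to_nat (i - q)))%Z by lia.
  rewrite H1', <- H1 by lia; f_equal; lia.
Qed.

Lemma local_long g x y tau x' y' tau' p c a b K k :
  line_map g x y tau -> line_map g x' y' tau' ->
  (forall i, (i <= K)%nat -> x (p + Z.of_nat i)%Z = block_word c i) ->
  (forall i, (i <= K)%nat -> x' (p + Z.of_nat i)%Z = block_word c i) ->
  repl_prefix g c a b -> (1 <= a)%nat -> (1 <= b)%nat -> (a + 1 <= K)%nat ->
  (p <= k <= p + Z.of_nat K)%Z -> exists j, same_near k tau y tau' y' j.
Proof.
  intros H H' Hc Hc' Hv Ha Hb HK Hk.
  destruct (long_block _ _ _ _ _ _ _ _ _ H Hc Hv HK) as (q & E1 & H2 & H3).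
  destruct (long_block _ _ _ _ _ _ _ _ _ H' Hc' Hv HK) as (q' & E1' & H2' & H3').
  exists (q' - q)%Z; intros t Ht.
  assert (Hpt : IZR p <= t) by (assert (IZR p <= IZR k) by (apply IZR_le; lia); lra).
  assert (HkK : IZR k <= IZR p + INR K)
    by (rewrite <- IZR_of_nat, <- plus_IZR; apply IZR_le; lia).
  assert (Hend : tau (IZR p + (INR K + 1)) = IZR q + INR K + 1 - INR a + INR b).
  { pose proof (pos_INR K); apply le_INR in HK; rewrite plus_INR in HK; simpl in HK.
    specialize (H2 (INR K + 1) ltac:(lra)); apply contr_iter_translation in H2; auto; lra. }
  specialize (H2 (t - IZR p) ltac:(lra)); specialize (H2' (t - IZR p) ltac:(lra)).
  rewrite H2 in H2'; apply contr_iter_inj in H2'.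
  replace (IZR p + (t - IZR p)) with t in H2' by lra.
  rewrite minus_IZR; split; [lra|].
  intros Ht' i Hi; destruct (line_map_incr_bij _ _ _ _ H) as [Hm _].
  pose proof (lt_le tau Hm _ _ Hpt); pose proof (Hm t (IZR p + (INR K + 1)) ltac:(lra)) as Hlt.
  assert (q < i + 1)%Z by (apply lt_IZR; rewrite plus_IZR; lra).
  assert (i < q + Z.of_nat K + 1 - Z.of_nat a + Z.of_nat b)%Z
    by (apply lt_IZR; rewrite plus_IZR, minus_IZR, !plus_IZR, !IZR_of_nat; lra).
  replace (i + (q' - q))%Z with (q' + Z.of_nat (Z.to_nat (i - q)))%Z by lia.
  rewrite H3', <- H3 by lia; f_equal; lia.
Qed.

(** The delicate case is a coordinate of x with no 2 to its left: x' may still have a distant one.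
    Near k the image of x' is then a translation that copies the letter, exactly as for x. *)
Lemma local_continuity g x y tau k : prefix_replacing g -> line_map g x y tau ->
  exists M : nat, forall x' y' tau', line_map g x' y' tau' ->
    (forall i, (Z.abs (i - k) <= Z.of_nat M)%Z -> x' i = x i) ->
    exists j, same_near k tau y tau' y' j.
Proof.
  intros [L HV] H.
  destruct (trichotomy x k (line_map_src _ _ _ _ H)) as [Hk|[(p & l & c & Hb & Hk)|
    (p & c & Hb & Hk)]].
  (* On this radius x' agrees with x and so has no 2 up to k; any earlier 2 puts k deeper in its
     block than a + 1, because a <= L. *)
  - exists (L + 2)%nat; intros x' y' tau' H' Hx.
    destruct (line_map_left_tail _ _ _ _ H k Hk) as (j & H1 & H2).
    assert (Hj : exists j', (forall t, IZR k <= t <= IZR k + 1 -> tau' t = t + IZR j') /\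
                            y' (k + j')%Z = x' k).
    { assert (Hlong : forall p c, (p <= k)%Z -> x' p = 2%nat ->
        (forall i, (i <= Z.to_nat (k - p))%nat -> x' (p + Z.of_nat i)%Z = block_word c i) ->
        exists j', (forall t, IZR k <= t <= IZR k + 1 -> tau' t = t + IZR j') /\
                            y' (k + j')%Z = x' k).
      { intros p c Hp Hx2 Hc; destruct (HV c) as (a & b & Ha & Hb & Hv).
        assert (p < k - Z.of_nat (L + 2))%Z.
        { destruct (Z_lt_ge_dec p (k - Z.of_nat (L + 2))); auto; exfalso.
          apply (Hk p); auto; rewrite <- Hx by lia; auto. }
        destruct (long_block_unit _ _ _ _ _ _ _ _ _ H' Hc Hv) as (j' & H3 & H4); try lia.
        exists j'; rewrite Z2Nat.id in H4 by lia.
        replace (p + (k - p))%Z with k in H4 by lia; split; auto.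
        intros t Ht; apply H3.
        rewrite <- IZR_of_nat, Z2Nat.id, minus_IZR by lia; lra. }
      destruct (trichotomy x' k (line_map_src _ _ _ _ H'))
        as [Hk'|[(p & l & c & Hb & Hk')|(p & c & Hb & Hk')]].
      - destruct (line_map_left_tail _ _ _ _ H' k Hk') as (j' & H1' & H2'); exists j'; split.
        + intros t Ht; apply H1'; lra.
        + apply H2'; lia.
      - apply (Hlong p c); [lia|eapply fin_block_start; eauto|].
        intros i Hi; apply Hb; lia.
      - apply (Hlong p c); [lia|eapply inf_block_start; eauto|].
        intros i Hi; apply Hb. }
    destruct Hj as (j' & H1' & H2').
    exists (j' - j)%Z; intros t Ht; rewrite H1, H1', minus_IZR by lra; split; [lra|].
    intros Ht' i Hi; assert (i = (k + j)%Z).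
    { apply Z.le_antisymm; apply Z.lt_succ_r, lt_IZR; unfold Z.succ; rewrite !plus_IZR; lra. }
    subst i; replace (k + j + (j' - j))%Z with (k + j')%Z by lia.
    rewrite H2', H2, Hx by lia; auto.
  (* The radius covers the whole block and the 2 that closes it. *)
  - exists (l + 1)%nat; intros x' y' tau' H' Hx.
    apply (local_fin_block g x y tau x' y' tau' p l c); auto.
    destruct Hb as (H1 & H2 & H3); split; auto; split.
    + intros i Hi; rewrite Hx by lia; auto.
    + rewrite Hx by lia; auto.
  - destruct (HV c) as (a & b & Ha & Hb' & Hv).
    set (K := (Z.to_nat (k - p) + a + 1)%nat).
    exists K; intros x' y' tau' H' Hx.
    apply (local_long g x y tau x' y' tau' p c a b K); auto; try lia.
    + intros i Hi; rewrite Hx by lia; apply Hb.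
Qed.

Lemma same_near_next k tau y tau' y' j j' :
  same_near k tau y tau' y' j -> same_near (k + 1) tau y tau' y' j' -> j = j'.
Proof.
  intros H H'; destruct (H (IZR k + 1) ltac:(lra)) as [E _].
  destruct (H' (IZR k + 1)) as [E' _]; [rewrite plus_IZR; lra|].
  apply eq_IZR; lra.
Qed.

Lemma same_near_range (A B : Z) tau y tau' y' : (A <= B)%Z ->
  (forall k, (A <= k <= B)%Z -> exists j, same_near k tau y tau' y' j) ->
  exists j, forall k, (A <= k <= B)%Z -> same_near k tau y tau' y' j.
Proof.
  intros HAB H; destruct (H A ltac:(lia)) as [j Hj]; exists j.
  intros k [Hk HkB]; revert HkB; pattern k; apply Zlt_lower_bound_ind with (z := A); auto.
  clear k Hk; intros k IH Hk HkB.
  destruct (Z.eq_dec k A) as [->|]; auto.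
  destruct (H k ltac:(lia)) as [j' Hj'].
  rewrite (same_near_next (k - 1) tau y tau' y' j j'); auto.
  - apply IH; lia.
  - replace (k - 1 + 1)%Z with k by lia; auto.
Qed.

(** Apply locality with x' = x. Adjacent segments share an end point, so the local offsets are one
    global integer. *)
Lemma line_map_unique g x y tau y' tau' : prefix_replacing g -> line_map g x y tau ->
  line_map g x y' tau' ->
  exists j, y' = shiftZ j y /\ forall t, tau' t = tau t - IZR j.
Proof.
  intros HV H H'.
  assert (Hn : forall k, exists j, same_near k tau y tau' y' j).
  { intros k; destruct (local_continuity g x y tau k HV H) as [M HM].
    apply (HM x y' tau'); auto. }
  destruct (Hn 0%Z) as [j Hj].
  assert (Hall : forall k, same_near k tau y tau' y' j).
  { intros k.
    destruct (same_near_range (Z.min 0 k) (Z.max 0 k) tau y tau' y') as [j' Hj']; auto; [lia|].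
    destruct (Hj 0 ltac:(lra)) as [E1 _].
    destruct (Hj' 0%Z ltac:(lia) 0 ltac:(lra)) as [E2 _].
    assert (j = j') by (apply eq_IZR; lra); subst j'; apply Hj'; lia. }
  exists (- j)%Z; split.
  - apply functional_extensionality; intros n; unfold shiftZ.
    destruct (line_map_incr_bij _ _ _ _ H) as [_ Hs]; destruct (Hs (IZR (n + - j))) as [t Ht].
    pose proof (flo_spec t).
    destruct (Hall (flo t) t ltac:(lra)) as [_ E].
    rewrite <- (E ltac:(lra) (n + - j)%Z) by lra; f_equal; lia.
  - intros t; pose proof (flo_spec t).
    destruct (Hall (flo t) t ltac:(lra)) as [E _]; rewrite opp_IZR; lra.
Qed.

Lemma incr_bij_continuous f t eps : incr_bij f -> 0 < eps ->
  exists d, 0 < d /\ forall t', Rabs (t' - t) < d -> Rabs (f t' - f t) < eps.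
Proof.
  intros [Hm Hs] He; destruct (Hs (f t - eps)) as [a Ha]; destruct (Hs (f t + eps)) as [b Hb].
  assert (a < t) by (apply (lt_lt_inv f Hm); lra).
  assert (t < b) by (apply (lt_lt_inv f Hm); lra).
  exists (Rmin (t - a) (b - t)); split; [apply Rmin_pos; lra|].
  intros t' Ht'; apply Rabs_def2 in Ht'.
  pose proof (Rmin_l (t - a) (b - t)); pose proof (Rmin_r (t - a) (b - t)).
  pose proof (Hm a t' ltac:(lra)); pose proof (Hm t' b ltac:(lra)).
  apply Rabs_def1; lra.
Qed.

Lemma line_map_continuous g x y tau t N eps : prefix_replacing g -> line_map g x y tau -> 0 < eps ->
  exists M d, 0 < d /\ forall x' y' tau' t', line_map g x' y' tau' -> agree M x x' ->
    Rabs (t' - t) < d -> exists j, agree N y (shiftZ j y') /\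
      Rabs (tau' t' - IZR j - tau t) < eps.
Proof.
  intros HV H He; pose proof (line_map_incr_bij _ _ _ _ H) as Hi; pose proof Hi as [Hm Hs].
  destruct (Hs (- INR N)) as [t1 Ht1]; destruct (Hs (INR N)) as [t2 Ht2].
  (* The segments from A to B contain the preimage of [-N, N] and all points within distance 1 of
     t. *)
  set (A := Z.min (flo t1) (flo t - 1)); set (B := Z.max (flo t2) (flo t + 1)).
  assert (HM : exists M : nat, forall x' y' tau', line_map g x' y' tau' -> agree M x x' ->
            forall k, (A <= k <= B)%Z -> exists j, same_near k tau y tau' y' j).
  { clearbody A B; clear - HV H.
    assert (HM : forall n : nat, exists M : nat, forall x' y' tau', line_map g x' y' tau' ->
              agree M x x' -> forall k, (A <= k < A + Z.of_nat n)%Z ->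
              exists j, same_near k tau y tau' y' j).
    { induction n as [|n [M IH]].
      - exists 0%nat; intros; lia.
      - destruct (local_continuity g x y tau (A + Z.of_nat n) HV H) as [M' HM'].
        exists (M + M' + Z.to_nat (Z.abs (A + Z.of_nat n)))%nat.
        intros x' y' tau' H' Hx k Hk.
        destruct (Z.eq_dec k (A + Z.of_nat n)) as [->|].
        + apply (HM' x'); auto; intros i Hi; apply Hx; lia.
        + apply (IH x' y' tau'); auto; [|lia]; intros i Hi; apply Hx; lia. }
    destruct (HM (Z.to_nat (B + 1 - A))) as [M HM']; exists M.
    intros; apply (HM' x'); auto; lia. }
  destruct HM as [M HM]; destruct (incr_bij_continuous tau t eps Hi He) as (d & Hd & Hcont).
  exists M, (Rmin d 1); split; [apply Rmin_pos; lra|].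
  intros x' y' tau' t' H' Hx Ht'.
  pose proof (Rmin_l d 1); pose proof (Rmin_r d 1); pose proof (flo_spec t) as Hft.
  destruct (same_near_range A B tau y tau' y') as [j Hj]; [lia|eauto|].
  exists j; split.
  - intros n Hn; unfold shiftZ.
    destruct (Hs (IZR n)) as [u Hu]; pose proof (flo_spec u) as Hfu.
    assert (HA : (flo t1 <= flo u)%Z).
    { pose proof (flo_spec t1).
      assert (t1 <= u).
      { apply (lt_le_inv tau Hm); rewrite Ht1, Hu, <- IZR_of_nat, <- opp_IZR; apply IZR_le; lia. }
      apply Z.lt_succ_r, lt_IZR; unfold Z.succ; rewrite plus_IZR; lra. }
    assert (HB : (flo u <= flo t2)%Z).
    { pose proof (flo_spec t2).
      assert (u <= t2).
      { apply (lt_le_inv tau Hm); rewrite Ht2, Hu, <- IZR_of_nat; apply IZR_le; lia. }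
      apply Z.lt_succ_r, lt_IZR; unfold Z.succ; rewrite plus_IZR; lra. }
    destruct (Hj (flo u) ltac:(lia) u ltac:(lra)) as [_ E].
    apply E; lra.
  - apply Rabs_def2 in Ht' as Ht2'; pose proof (flo_spec t') as Hft'.
    assert (HA : (flo t - 1 <= flo t')%Z).
    { apply Z.lt_succ_r, lt_IZR; unfold Z.succ; rewrite plus_IZR, minus_IZR; lra. }
    assert (HB : (flo t' <= flo t + 1)%Z).
    { apply Z.lt_succ_r, lt_IZR; unfold Z.succ; rewrite !plus_IZR; lra. }
    destruct (Hj (flo t') ltac:(lia) t' ltac:(lra)) as [E _].
    rewrite E; replace (tau t' + IZR j - IZR j - tau t) with (tau t' - tau t) by lra.
    apply Hcont; lra.
Qed.

(** * Existence of the image of a flow line *)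

Lemma Z_step_mono (f : Z -> R) : (forall k, f k < f (k + 1)%Z) ->
  forall i j, (i <= j)%Z -> f i <= f j.
Proof.
  intros Hf i j Hij; replace j with (i + Z.of_nat (Z.to_nat (j - i)))%Z by lia.
  induction (Z.to_nat (j - i)) as [|n IH]; [rewrite Z.add_0_r; lra|].
  replace (i + Z.of_nat (S n))%Z with (i + Z.of_nat n + 1)%Z by lia.
  specialize (Hf (i + Z.of_nat n)%Z); lra.
Qed.

Lemma flo_lt s t : s < t -> flo s = flo t \/ (flo s + 1 <= flo t)%Z.
Proof.
  intros H; pose proof (flo_spec s); pose proof (flo_spec t).
  assert (flo s < flo t + 1)%Z by (apply lt_IZR; rewrite plus_IZR; lra); lia.
Qed.

(** The jumps between neighbouring pieces are integers, so translating the pieces by the partial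
    sums J of the jumps removes them. *)
Lemma glue (sg : Z -> R -> R) :
  (forall k s t, s < t -> sg k s < sg k t) ->
  (forall k, exists d, sg k (IZR k + 1) = sg (k + 1)%Z (IZR k + 1) + IZR d) ->
  exists tau J, (forall k t, IZR k <= t <= IZR k + 1 -> tau t = sg k t + IZR (J k)) /\
    forall s t, s < t -> tau s < tau t.
Proof.
  intros Hm Hd.
  set (d := fun k => proj1_sig (constructive_indefinite_description _ (Hd k))).
  assert (Ed : forall k, sg k (IZR k + 1) = sg (k + 1)%Z (IZR k + 1) + IZR (d k)).
  { intros k; unfold d; destruct constructive_indefinite_description; auto. }
  destruct (Z_partial_sums d) as [J HJ].
  set (tau := fun t => sg (flo t) t + IZR (J (flo t))).
  assert (Et : forall k t, IZR k <= t <= IZR k + 1 -> tau t = sg k t + IZR (J k)).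
  { intros k t Ht; unfold tau; destruct (Rle_lt_dec (IZR k + 1) t).
    - assert (t = IZR k + 1) by lra; subst t.
      rewrite (flo_unique (IZR k + 1) (k + 1)) by (rewrite plus_IZR; lra).
      rewrite HJ, plus_IZR, Ed; lra.
    - rewrite (flo_unique t k); lra. }
  exists tau, J; split; auto.
  assert (Hk : forall k, tau (IZR k) < tau (IZR (k + 1))).
  { intros k; rewrite plus_IZR, !(Et k) by lra; apply Rplus_lt_compat_r, Hm; lra. }
  intros s t Hst; pose proof (flo_spec s); pose proof (flo_spec t).
  destruct (flo_lt s t Hst) as [E|E].
  - assert (E' : IZR (flo s) = IZR (flo t)) by (f_equal; auto).
    rewrite (Et (flo s) s), (Et (flo s) t) by lra.
    apply Rplus_lt_compat_r; auto.
  - apply Rlt_le_trans with (tau (IZR (flo s + 1))).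
    { rewrite plus_IZR, !(Et (flo s)) by lra; apply Rplus_lt_compat_r, Hm; lra. }
    apply Rle_trans with (tau (IZR (flo t))).
    { apply (Z_step_mono (fun k => tau (IZR k))); auto. }
    rewrite !(Et (flo t)) by lra; apply Rplus_le_compat_r.
    apply (lt_le (sg (flo t))); auto; lra.
Qed.

Lemma Z_crossing (f : Z -> R) r k1 k2 : f k1 <= r -> r < f k2 -> (k1 <= k2)%Z ->
  exists k, f k <= r < f (k + 1)%Z.
Proof.
  intros H1 H2 H; replace k2 with (k1 + Z.of_nat (Z.to_nat (k2 - k1)))%Z in H2 by lia.
  induction (Z.to_nat (k2 - k1)) as [|n IH]; [rewrite Z.add_0_r in H2; lra|].
  destruct (Rlt_le_dec r (f (k1 + Z.of_nat n)%Z)); auto.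
  exists (k1 + Z.of_nat n)%Z; split; auto.
  replace (k1 + Z.of_nat n + 1)%Z with (k1 + Z.of_nat (S n))%Z by lia; auto.
Qed.

(** Infinitely many increasing pieces could still add up to a bounded map, so unboundedness at the
    integers is asked for separately. A value is then reached inside the segment where it is
    crossed. *)
Lemma glue_surj (sg : Z -> R -> R) (tau : R -> R) (J : Z -> Z) :
  (forall k, incr_bij (sg k)) ->
  (forall k t, IZR k <= t <= IZR k + 1 -> tau t = sg k t + IZR (J k)) ->
  (forall s t, s < t -> tau s < tau t) ->
  (forall N : nat, exists k, INR N <= tau (IZR k)) ->
  (forall N : nat, exists k, tau (IZR k) <= - INR N) ->
  forall r, exists t, tau t = r.
Proof.
  intros Hs Et Hm Hu Hl r.
  destruct (INR_unbounded (Rabs r)) as [N HN].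
  destruct (Hu N) as [k2 H2]; destruct (Hl N) as [k1 H1].
  pose proof (Rle_abs r); pose proof (Rle_abs (- r)); rewrite Rabs_Ropp in *.
  destruct (Z_crossing (fun k => tau (IZR k)) r k1 k2) as (k & Hk1 & Hk2); try lra.
  { apply le_IZR, (lt_le_inv tau Hm); lra. }
  rewrite plus_IZR in Hk2.
  destruct (Hs k) as [Hmk Hsk]; destruct (Hsk (r - IZR (J k))) as [t Ht].
  assert (IZR k <= t).
  { apply (lt_le_inv _ Hmk); rewrite (Et k) in Hk1; lra. }
  assert (t <= IZR k + 1).
  { apply (lt_le_inv _ Hmk); rewrite (Et k) in Hk2; lra. }
  exists t; rewrite (Et k); lra.
Qed.

Lemma block_point_lt l s t : s < t -> block_point l s < block_point l t.
Proof. intros H; apply (lt_lt_inv (block_coord l)); [apply block_coord_lt|];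
  rewrite !block_coord_block_point; auto. Qed.

Lemma block_point_block_coord l t : block_point l (block_coord l t) = t.
Proof. apply (block_coord_inj l), block_coord_block_point. Qed.

Lemma block_point_0 l : block_point l 0 = 0.
Proof. apply (block_coord_inj l); rewrite block_coord_block_point, block_coord_0; auto. Qed.

Lemma block_point_1 l : block_point l 1 = INR l + 1.
Proof. apply (block_coord_inj l); rewrite block_coord_block_point, block_coord_end; auto. Qed.

Definition expand_iter (n : nat) : R -> R := Nat.iter n expand.

Lemma expand_iter_contr_iter n t : expand_iter n (contr_iter n t) = t.
Proof. apply (contr_iter_inj n), contr_iter_expand_iter. Qed.

Lemma expand_iter_lt n s t : s < t -> expand_iter n s < expand_iter n t.
Proof.
  intros H; apply (lt_lt_inv (contr_iter n)); [apply contr_iter_lt|]; unfold expand_iter;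
    rewrite !contr_iter_expand_iter; auto.
Qed.

Definition fin_map (p : Z) (l l' : nat) : R ->
  R := fun t => IZR p + block_point l' (block_coord l (t - IZR p)).
Definition inf_map (p : Z) (a b : nat) : R ->
  R := fun t => IZR p + expand_iter b (contr_iter a (t - IZR p)).
Definition block_letter (p : Z) (c : cantor) : config := fun i => block_word c (Z.to_nat (i - p)).

Lemma fin_map_incr_bij p l l' : incr_bij (fin_map p l l').
Proof.
  split; unfold fin_map.
  - intros s t H; apply Rplus_lt_compat_l, block_point_lt, block_coord_lt; lra.
  - intros r; exists (IZR p + block_point l (block_coord l' (r - IZR p))).
    replace (IZR p + block_point l (block_coord l' (r - IZR p)) - IZR p) with
      (block_point l (block_coord l' (r - IZR p))) by lra.
    rewrite block_coord_block_point, block_point_block_coord; lra.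
Qed.

Lemma inf_map_incr_bij p a b : incr_bij (inf_map p a b).
Proof.
  split; unfold inf_map.
  - intros s t H; apply Rplus_lt_compat_l, expand_iter_lt, contr_iter_lt; lra.
  - intros r; exists (IZR p + expand_iter a (contr_iter b (r - IZR p))).
    replace (IZR p + expand_iter a (contr_iter b (r - IZR p)) - IZR p)
      with (expand_iter a (contr_iter b (r - IZR p))) by lra.
    unfold expand_iter at 2; rewrite contr_iter_expand_iter, expand_iter_contr_iter; lra.
Qed.

Lemma fin_map_start p l l' : fin_map p l l' (IZR p) = IZR p.
Proof. unfold fin_map; rewrite Rminus_diag, block_coord_0, block_point_0; lra. Qed.

Lemma fin_map_end p l l' : fin_map p l l' (IZR p + INR l + 1) = IZR p + INR l' + 1.
Proof.
  unfold fin_map; replace (IZR p + INR l + 1 - IZR p) with (INR l + 1) by lra.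
  rewrite block_coord_end, block_point_1; lra.
Qed.

Lemma inf_map_start p a b : inf_map p a b (IZR p) = IZR p.
Proof.
  unfold inf_map; rewrite Rminus_diag, contr_iter_0.
  pose proof (expand_iter_contr_iter b 0) as E; rewrite contr_iter_0 in E; lra.
Qed.

(* A local solution of [line_map] near the coordinate k, anchored so that the leading 2 of the block
   of k stays in place; neighbouring charts differ by integer translations. *)
Definition chart (g : cantor -> cantor) (av bv : cantor -> nat) (x : config) (k : Z)
    (ch : (R -> R) * config) : Prop :=
  (left_tail x k /\ ch = (fun t => t, x)) \/
  (exists p l c l', fin_block x p l c /\ (p <= k <= p + Z.of_nat l)%Z /\ support_size (g c) l' /\
     ch = (fin_map p l l', block_letter p (g c))) \/
  (exists p c, inf_block x p c /\ (p <= k)%Z /\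
     ch = (inf_map p (av c) (bv c), block_letter p (g c))).

Lemma chart_left_tail g av bv x k ch : chart g av bv x k ch -> left_tail x k ->
  ch = (fun t => t, x).
Proof.
  intros [[_ E]|[(p & l & c & l' & H1 & H2 & _)|(p & c & H1 & H2 & _)]] H; auto; exfalso.
  - apply (H p); [lia|eapply fin_block_start; eauto].
  - apply (H p); [lia|eapply inf_block_start; eauto].
Qed.

Lemma chart_fin_block g av bv x k ch p l c : chart g av bv x k ch -> fin_block x p l c ->
  (p <= k <= p + Z.of_nat l)%Z ->
  exists l', support_size (g c) l' /\ ch = (fin_map p l l', block_letter p (g c)).
Proof.
  intros [[HL _]|[(p0 & l0 & c0 & l' & H1 & H2 & H3 & H4)|(p0 & c0 & H1 & H2 & _)]] H Hk.
  - exfalso; apply (HL p); [lia|eapply fin_block_start; eauto].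
  - assert (p = p0).
    { destruct (Z_le_gt_dec p p0).
      - symmetry; apply (fin_block_only_start _ _ _ _ _ H); [lia|eapply fin_block_start; eauto].
      - apply (fin_block_only_start _ _ _ _ _ H1); [lia|eapply fin_block_start; eauto]. }
    subst p0; destruct (fin_block_unique _ _ _ _ _ _ H H1) as [<- <-]; eauto.
  - exfalso; assert (p = p0).
    { destruct (Z_le_gt_dec p p0).
      - symmetry; apply (fin_block_only_start _ _ _ _ _ H); [lia|eapply inf_block_start; eauto].
      - apply (inf_block_only_start _ _ _ _ H1); [lia|eapply fin_block_start; eauto]. }
    subst p0; pose proof (inf_block_only_start _ _ _ (p + Z.of_nat l + 1) H1 ltac:(lia) (proj2 (proj2 H))); lia.
Qed.

Lemma chart_inf_block g av bv x k ch p c : chart g av bv x k ch -> inf_block x p c -> (p <= k)%Z ->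
  ch = (inf_map p (av c) (bv c), block_letter p (g c)).
Proof.
  intros [[HL _]|[(p0 & l0 & c0 & l' & H1 & H2 & H3 & H4)|(p0 & c0 & H1 & H2 & H3)]] H Hk.
  - exfalso; apply (HL p); [lia|eapply inf_block_start; eauto].
  - exfalso; assert (p = p0).
    { destruct (Z_le_gt_dec p p0).
      - symmetry; apply (inf_block_only_start _ _ _ _ H); [lia|eapply fin_block_start; eauto].
      - apply (fin_block_only_start _ _ _ _ _ H1); [lia|eapply inf_block_start; eauto]. }
    subst p0; pose proof (inf_block_only_start _ _ _ (p + Z.of_nat l0 + 1) H ltac:(lia) (proj2 (proj2 H1))); lia.
  - assert (p = p0).
    { destruct (Z_le_gt_dec p p0).
      - symmetry; apply (inf_block_only_start _ _ _ _ H); [lia|eapply inf_block_start; eauto].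
      - apply (inf_block_only_start _ _ _ _ H1); [lia|eapply inf_block_start; eauto]. }
    subst p0; assert (c = c0).
    { apply functional_extensionality; intros i; apply block_word_inj; rewrite <- H, <- H1; auto. }
    subst; auto.
Qed.

Lemma chart_start g av bv x k ch : inX x -> chart g av bv x k ch -> x k = 2%nat ->
  fst ch (IZR k) = IZR k /\ snd ch k = 2%nat.
Proof.
  intros Hx H Hk; destruct (block_at x k Hx Hk) as [(l & c & Hb)|(c & Hb)].
  - destruct (chart_fin_block _ _ _ _ _ _ _ _ _ H Hb ltac:(lia)) as (l' & _ & ->); simpl; split.
    + apply fin_map_start.
    + unfold block_letter; rewrite Z.sub_diag; auto.
  - rewrite (chart_inf_block _ _ _ _ _ _ _ _ H Hb ltac:(lia)); simpl; split.
    + apply inf_map_start.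
    + unfold block_letter; rewrite Z.sub_diag; auto.
Qed.

Lemma chart_incr_bij g av bv x k ch : chart g av bv x k ch -> incr_bij (fst ch).
Proof.
  intros [[_ ->]|[(p & l & c & l' & _ & _ & _ & ->)|(p & c & _ & _ & ->)]]; simpl.
  - split; eauto.
  - apply fin_map_incr_bij.
  - apply inf_map_incr_bij.
Qed.

Lemma left_tail_next x k : left_tail x k -> left_tail x (k + 1) \/ x (k + 1)%Z = 2%nat.
Proof.
  intros H; destruct (Nat.eq_dec (x (k + 1)%Z) 2); auto; left; intros i Hi.
  destruct (Z.eq_dec i (k + 1)) as [->|]; auto; apply H; lia.
Qed.

(** Within one block, or within the left tail, the charts coincide. At a boundary the next chart
    fixes its leading 2 and the previous one takes an integer value, so the jump is an integer. *)
Lemma chart_step g av bv x k ch ch' : inX x ->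
  chart g av bv x k ch -> chart g av bv x (k + 1) ch' ->
  exists d, fst ch (IZR k + 1) = fst ch' (IZR k + 1) + IZR d.
Proof.
  intros Hx H H'.
  assert (Hst : x (k + 1)%Z = 2%nat -> fst ch' (IZR k + 1) = IZR k + 1).
  { intros E; destruct (chart_start _ _ _ _ _ _ Hx H' E) as [F _].
    rewrite plus_IZR in F; auto. }
  destruct (trichotomy x k Hx) as [Hk|[(p & l & c & Hb & Hk)|(p & c & Hb & Hk)]].
  - exists 0%Z; rewrite (chart_left_tail _ _ _ _ _ _ H Hk); simpl.
    destruct (left_tail_next x k Hk) as [H1|H1].
    + rewrite (chart_left_tail _ _ _ _ _ _ H' H1); simpl; lra.
    + rewrite Hst; auto; lra.
  - destruct (chart_fin_block _ _ _ _ _ _ _ _ _ H Hb Hk) as (l' & Hl & ->); simpl.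
    destruct (Z.eq_dec k (p + Z.of_nat l)) as [->|].
    + rewrite Hst by apply Hb.
      rewrite plus_IZR, IZR_of_nat, fin_map_end.
      exists (Z.of_nat l' - Z.of_nat l)%Z; rewrite minus_IZR, !IZR_of_nat; lra.
    + destruct (chart_fin_block _ _ _ _ _ _ _ _ _ H' Hb ltac:(lia)) as (l2 & Hl2 & ->); simpl.
      rewrite (support_size_unique _ _ _ Hl Hl2); exists 0%Z; lra.
  - rewrite (chart_inf_block _ _ _ _ _ _ _ _ H Hb Hk), (chart_inf_block _ _ _ _ _ _ _ _ H' Hb ltac:(lia)).
    exists 0%Z; lra.
Qed.

(** Two neighbouring copies of the same piece agree at the shared end point only if their offsets
    are equal. *)
Lemma glue_const (sg : Z -> R -> R) tau J A B :
  (forall k t, IZR k <= t <= IZR k + 1 -> tau t = sg k t + IZR (J k)) ->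
  (forall k, (A <= k <= B)%Z -> sg k = sg A) ->
  (forall k, (A <= k <= B)%Z -> J k = J A) /\
  (forall t, (A <= B)%Z -> IZR A <= t <= IZR B + 1 -> tau t = sg A t + IZR (J A)).
Proof.
  intros Et Hs.
  assert (HJ : forall k, (A <= k <= B)%Z -> J k = J A).
  { intros k [Hk HkB]; revert HkB; pattern k; apply Zlt_lower_bound_ind with (z := A); auto.
    clear k Hk; intros k IH Hk HkB; destruct (Z.eq_dec k A) as [->|]; auto.
    rewrite <- (IH (k - 1)%Z) by lia.
    pose proof (Et k (IZR k) ltac:(lra)) as E1.
    pose proof (Et (k - 1)%Z (IZR k)) as E2; rewrite minus_IZR in E2; specialize (E2 ltac:(lra)).
    rewrite (Hs k) in E1 by lia; rewrite (Hs (k - 1)%Z) in E2 by lia.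
    apply eq_IZR; lra. }
  split; auto; intros t HAB Ht.
  destruct (Rle_lt_dec (IZR B) t).
  - rewrite (Et B) by lra; rewrite Hs, HJ by lia; auto.
  - pose proof (flo_spec t).
    assert (A < flo t + 1)%Z by (apply lt_IZR; rewrite plus_IZR; lra).
    assert (flo t < B)%Z by (apply lt_IZR; lra).
    rewrite (Et (flo t)) by lra; rewrite Hs, HJ by lia; auto.
Qed.

Lemma block_word_le c i : (block_word c i <= 2)%nat.
Proof. destruct i; simpl; auto; destruct (c i); lia. Qed.

(** That 02 does not occur in y comes for free: a nonempty finite image word ends in 1, an infinite
    image block has no further 2, and the letter before the first 2 is the one of x. *)
Lemma line_map_intro g x y tau : inX x -> incr_bij tau ->
  (forall p l c, fin_block x p l c -> exists q l', fin_block y q l' (g c) /\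
    forall s, 0 <= s <= INR l + 1 -> block_coord l s = block_coord l' (tau (IZR p + s) - IZR q)) ->
  (forall p c, inf_block x p c -> exists q a b, inf_block y q (g c) /\ repl_prefix g c a b /\
    forall s, 0 <= s -> contr_iter a s = contr_iter b (tau (IZR p + s) - IZR q)) ->
  (forall k, left_tail x k -> exists j,
    (forall t, t <= IZR k + 1 -> tau t = t + IZR j) /\
    (forall i, (i <= k)%Z -> y (i + j)%Z = x i)) ->
  line_map g x y tau.
Proof.
  intros Hx Hi HF HI HL; split; auto.
  destruct Hi as [Hm Hs]; intros n; destruct (Hs (IZR n)) as [t Ht]; pose proof (flo_spec t) as Hf.
  destruct (trichotomy x (flo t) Hx) as [Hk|[(p & l & c & Hb & Hk)|(p & c & Hb & Hk)]].
  - destruct (HL _ Hk) as (j & H1 & H2); rewrite H1 in Ht by lra.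
    assert (E : flo t = (n - j)%Z) by (apply flo_unique; rewrite minus_IZR; lra).
    specialize (H2 (flo t) ltac:(lia)); rewrite E in H2.
    replace (n - j + j)%Z with n in H2 by lia; rewrite H2.
    destruct (Hx (n - j)%Z) as [X1 X2]; split; auto; intros [Y1 Y2]; apply X2; split; auto.
    destruct (left_tail_next x (flo t) Hk) as [Hk'|]; [|rewrite E in *; auto].
    exfalso; destruct (HL _ Hk') as (j' & H1' & H2').
    assert (j' = j).
    { apply eq_IZR; specialize (H1 t ltac:(lra)); specialize (H1' t); rewrite plus_IZR in H1'.
      specialize (H1' ltac:(lra)); lra. }
    subst j'; apply (Hk' (flo t + 1)%Z); [lia|]; rewrite <- H2', <- Y2 by lia; f_equal; lia.
  - destruct (HF _ _ _ Hb) as (q & l' & (F1 & F2 & F3) & H2).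
    destruct (fin_block_ends _ _ _ _ _ H2) as [E1 E2].
    assert (IZR p <= t) as Hp by (assert (IZR p <= IZR (flo t)) by (apply IZR_le; lia); lra).
    assert (t < IZR p + INR l + 1) as Hl.
    { assert (IZR (flo t) <= IZR p + INR l)
        by (rewrite <- IZR_of_nat, <- plus_IZR; apply IZR_le; lia); lra. }
    apply (lt_le tau Hm) in Hp; apply Hm in Hl.
    assert (q <= n)%Z by (apply le_IZR; lra).
    assert (n < q + Z.of_nat l' + 1)%Z by (apply lt_IZR; rewrite !plus_IZR, IZR_of_nat; lra).
    pose proof (F2 (Z.to_nat (n - q)) ltac:(lia)) as Y.
    replace (q + Z.of_nat (Z.to_nat (n - q)))%Z with n in Y by lia.
    rewrite Y; split; [apply block_word_le|]; intros [Y1 Y2].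
    destruct (Z.to_nat (n - q)) as [|i] eqn:Ei; [discriminate|].
    destruct (Nat.eq_dec (S i) l') as [El|El].
    + destruct F1 as [_ F1]; simpl in Y1; rewrite (F1 i) in Y1; auto; discriminate.
    + apply (block_word_S (g c) (S i)); rewrite <- F2 by lia.
      rewrite <- Y2; f_equal; lia.
  - destruct (HI _ _ Hb) as (q & a & b & H1 & _ & H2).
    pose proof (inf_block_end _ _ _ _ _ H2) as E1.
    assert (IZR p <= t) as Hp by (assert (IZR p <= IZR (flo t)) by (apply IZR_le; lia); lra).
    apply (lt_le tau Hm) in Hp.
    assert (q <= n)%Z by (apply le_IZR; lra).
    pose proof (H1 (Z.to_nat (n - q))) as Y.
    replace (q + Z.of_nat (Z.to_nat (n - q)))%Z with n in Y by lia.
    rewrite Y; split; [apply block_word_le|]; intros [Y1 Y2].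
    apply (block_word_S (g c) (Z.to_nat (n - q))); rewrite <- H1, <- Y2; f_equal; lia.
Qed.

Lemma line_map_exists g x : prefix_replacing g -> inX x -> exists y tau, line_map g x y tau.
Proof.
  intros [L HV] Hx.
  assert (HAB : exists AB : cantor ->
    nat * nat, forall c, repl_prefix g c (fst (AB c)) (snd (AB c))).
  { exists (fun c => proj1_sig (constructive_indefinite_description
      (fun ab => repl_prefix g c (fst ab) (snd ab))
      (let '(ex_intro _ a (ex_intro _ b (conj _ (conj _ H)))) := HV c in ex_intro _ (a, b) H))).
    intros c; destruct constructive_indefinite_description; auto. }
  destruct HAB as [AB HAB]; set (av := fun c => fst (AB c)); set (bv := fun c => snd (AB c)).
  assert (Hfin : forall p l c, fin_block x p l c -> exists l', support_size (g c) l').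
  (* Replacing a prefix keeps all but finitely many digits equal to 0. *)
  { intros p l c ([H1 _] & _); destruct (support_size_exists (g c) (bv c + l)) as (l' & _ & H);
    eauto.
    intros i Hi; replace i with (bv c + (i - bv c))%nat by lia.
    rewrite (repl_prefix_tail _ _ _ _ _ (HAB c)); apply H1; lia. }
  assert (Hch : forall k, exists ch, chart g av bv x k ch).
  { intros k; destruct (trichotomy x k Hx) as [Hk|[(p & l & c & Hb & Hk)|(p & c & Hb & Hk)]].
    - eexists; left; eauto.
    - destruct (Hfin p l c Hb) as [l' Hl]; eexists; right; left; exists p, l, c, l'; eauto.
    - eexists; right; right; exists p, c; eauto. }
  assert (HC : exists C : Z -> (R -> R) * config, forall k, chart g av bv x k (C k)).
  { exists (fun k => proj1_sig (constructive_indefinite_description _ (Hch k))).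
    intros k; destruct constructive_indefinite_description; auto. }
  destruct HC as [C HC]; set (sg := fun k => fst (C k)).
  destruct (glue sg) as (tau & J & Et & Hm).
  { intros k; apply (chart_incr_bij _ _ _ _ _ _ (HC k)). }
  { intros k; apply (chart_step g av bv x); auto. }
  assert (TF : forall p l c, fin_block x p l c -> exists l', support_size (g c) l' /\
     (forall k, (p <= k <= p + Z.of_nat l)%Z -> J k = J p /\ snd (C k) = block_letter p (g c)) /\
     forall t, IZR p <= t <= IZR p + INR l + 1 -> tau t = fin_map p l l' t + IZR (J p)).
  { intros p l c Hb; destruct (chart_fin_block _ _ _ _ _ _ _ _ _ (HC p) Hb ltac:(lia)) as (l' & Hl & E).
    assert (Hk : forall k, (p <= k <= p + Z.of_nat l)%Z ->
              C k = (fin_map p l l', block_letter p (g c))).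
    { intros k Hk; destruct (chart_fin_block _ _ _ _ _ _ _ _ _ (HC k) Hb Hk) as (l2 & Hl2 & E2).
      rewrite E2, (support_size_unique _ _ _ Hl Hl2); auto. }
    destruct (glue_const sg tau J p (p + Z.of_nat l) Et) as [G1 G2].
    { intros k Hk'; unfold sg; rewrite !Hk by lia; auto. }
    exists l'; split; auto; split.
    - intros k Hk'; rewrite Hk by auto; auto.
    - intros t Ht; rewrite G2; [unfold sg; rewrite E; auto|lia|].
      rewrite plus_IZR, IZR_of_nat; lra. }
  assert (TI : forall p c, inf_block x p c ->
     (forall k, (p <= k)%Z -> J k = J p /\ snd (C k) = block_letter p (g c)) /\
     forall t, IZR p <= t -> tau t = inf_map p (av c) (bv c) t + IZR (J p)).
  { intros p c Hb.
    assert (Hk : forall k, (p <= k)%Z -> C k = (inf_map p (av c) (bv c), block_letter p (g c)))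
      by (intros k Hk; apply (chart_inf_block _ _ _ _ _ _ _ _ (HC k) Hb Hk)).
    assert (G : forall B, (p <= B)%Z -> _)
      by (intros B HB; apply (glue_const sg tau J p B Et);
          intros k Hk'; unfold sg; rewrite !Hk by lia; auto).
    split.
    - intros k Hk'; rewrite Hk by auto; split; auto; apply (G k); lia.
    - intros t Ht; pose proof (flo_spec t).
      assert (p < flo t + 1)%Z by (apply lt_IZR; rewrite plus_IZR; lra).
      destruct (G (flo t) ltac:(lia)) as [_ G2]; rewrite G2; [unfold sg; rewrite Hk; auto;
        lia|lia|lra]. }
  assert (TL : forall k, left_tail x k ->
     (forall i, (i <= k)%Z -> J i = J k /\ snd (C i) = x) /\
     forall t, t <= IZR k + 1 -> tau t = t + IZR (J k)).
  { intros k Hk.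
    assert (Hi : forall i, (i <= k)%Z -> C i = (fun t => t, x)).
    { intros i Hi; apply (chart_left_tail _ _ _ _ _ _ (HC i)); intros n Hn; apply Hk; lia. }
    assert (G : forall A, (A <= k)%Z -> _)
      by (intros A HA; apply (glue_const sg tau J A k Et);
          intros i Hi'; unfold sg; rewrite !Hi by lia; auto).
    assert (HJ : forall i, (i <= k)%Z -> J i = J k)
      by (intros i Hi'; symmetry; apply (G i); lia).
    split.
    - intros i Hi'; rewrite Hi by auto; auto.
    - intros t Ht; pose proof (flo_spec t); destruct (Z_le_gt_dec (flo t) k).
      + destruct (G (flo t) l) as [_ G2]; rewrite G2; [|lia|lra].
        unfold sg; rewrite Hi, HJ by auto; auto.
      + assert (IZR k + 1 <= IZR (flo t)) by (rewrite <- plus_IZR; apply IZR_le; lia).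
        rewrite (Et k) by lra; unfold sg; rewrite Hi by lia; auto. }
  assert (Tstart : forall p, x p = 2%nat -> tau (IZR p) = IZR (p + J p)).
  { intros p Hp; rewrite (Et p) by lra; rewrite plus_IZR.
    unfold sg; rewrite (proj1 (chart_start _ _ _ _ _ _ Hx (HC p) Hp)); auto. }
  assert (Hup : forall N : nat, exists k, INR N <= tau (IZR k)).
  (* Each step to the right raises the integer bound by 1. *)
  { assert (Hup : forall N : nat, exists k, IZR (flo (tau 0%R) + Z.of_nat N) <= tau (IZR k)).
    { induction N as [|N [k IH]].
      { exists 0%Z; rewrite Z.add_0_r; pose proof (flo_spec (tau 0)); lra. }
      replace (flo (tau 0%R) + Z.of_nat (S N))%Z with (flo (tau 0%R) + Z.of_nat N + 1)%Z by lia.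
      set (M := (flo (tau 0%R) + Z.of_nat N)%Z) in *.
      destruct (trichotomy x k Hx) as [Hk|[(p & l & c & Hb & Hk)|(p & c & Hb & Hk)]].
      - exists (k + 1)%Z; destruct (TL k Hk) as [_ H]; rewrite !plus_IZR.
        rewrite H in * by lra; lra.
      - exists (p + Z.of_nat l + 1)%Z; rewrite Tstart by apply Hb; apply IZR_le.
        (* A 2 is sent to an integer time, so a strict gain over the integer M is a gain of at least
           1. *)
        assert (M < p + Z.of_nat l + 1 + J (p + Z.of_nat l + 1))%Z; [|lia].
        apply lt_IZR; rewrite <- Tstart by apply Hb.
        apply Rle_lt_trans with (1 := IH), Hm, IZR_lt; lia.
      - destruct (TI p c Hb) as [_ H].
        destruct (inf_map_incr_bij p (av c) (bv c)) as [_ Hs].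
        destruct (Hs (IZR (M + 1) - IZR (J p))) as [t Ht].
        exists (Z.max p (flo t + 1)); rewrite H by (apply IZR_le; lia).
        assert (t <= IZR (Z.max p (flo t + 1))).
        { pose proof (flo_spec t).
          assert (IZR (flo t + 1) <= IZR (Z.max p (flo t + 1))) by (apply IZR_le; lia).
          rewrite plus_IZR in *; lra. }
        pose proof (lt_le _ (proj1 (inf_map_incr_bij p (av c) (bv c))) _ _ H0); lra. }
    intros N; destruct (Hup (Z.to_nat (Z.of_nat N - flo (tau 0%R)))) as [k Hk].
    exists k; apply Rle_trans with (2 := Hk); rewrite <- IZR_of_nat; apply IZR_le; lia. }
  assert (Hdown : forall N : nat, exists k, tau (IZR k) <= - INR N).
  { assert (Hdown : forall N : nat, exists k, tau (IZR k) <= IZR (flo (tau 0%R) + 1 - Z.of_nat N)).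
    { induction N as [|N [k IH]].
      { exists 0%Z; pose proof (flo_spec (tau 0)); rewrite Z.sub_0_r, plus_IZR; lra. }
      replace (flo (tau 0%R) + 1 - Z.of_nat (S N))%Z with
        (flo (tau 0%R) + 1 - Z.of_nat N - 1)%Z by lia.
      set (M := (flo (tau 0%R) + 1 - Z.of_nat N)%Z) in *.
      (* From a 2 one moves left by a unit in the left tail, or to the 2 of the preceding block,
         which has a strictly smaller integer image. The preceding block cannot be infinite, as p
         lies after it. *)
      assert (Hp : forall p, (p <= k)%Z -> x p = 2%nat -> exists k', tau (IZR k') <= IZR (M - 1)).
      { intros p Hpk Hp.
        assert (HpM : tau (IZR p) <= IZR M).
        { apply Rle_trans with (2 := IH), (lt_le tau Hm), IZR_le; lia. }
        destruct (trichotomy x (p - 1) Hx)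
          as [Hk|[(p' & l & c & Hb & Hk)|(p' & c & Hb & Hk)]].
        - exists (p - 1)%Z; destruct (TL _ Hk) as [_ H].
          rewrite minus_IZR in H; rewrite (H (IZR p)) in HpM by lra.
          rewrite !minus_IZR, H by lra; lra.
        - exists p'; pose proof (fin_block_start _ _ _ _ Hb) as Hp'.
          rewrite Tstart by auto; apply IZR_le.
          assert (p' + J p' < M)%Z; [|lia].
          apply lt_IZR; rewrite <- Tstart by auto.
          apply Rlt_le_trans with (2 := HpM), Hm, IZR_lt; lia.
        - exfalso; pose proof (inf_block_only_start _ _ _ p Hb ltac:(lia) Hp); lia. }
      destruct (trichotomy x k Hx) as [Hk|[(p & l & c & Hb & Hk)|(p & c & Hb & Hk)]].
      - exists (k - 1)%Z; destruct (TL k Hk) as [_ H].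
        rewrite !minus_IZR; rewrite H in * by lra; lra.
      - apply (Hp p); [lia|eapply fin_block_start; eauto].
      - apply (Hp p); [lia|eapply inf_block_start; eauto]. }
    intros N; destruct (Hdown (Z.to_nat (flo (tau 0%R) + 1 + Z.of_nat N))) as [k Hk].
    exists k; apply Rle_trans with (1 := Hk); rewrite <- IZR_of_nat, <- opp_IZR; apply IZR_le;
      lia. }
  assert (Hs : forall r, exists t, tau t = r).
  { apply (glue_surj sg tau J); auto; intros k; apply (chart_incr_bij _ _ _ _ _ _ (HC k)). }
  destruct (incr_bij_inverse tau (conj Hm Hs)) as (taui & _ & Ti & iT).
  (* The letter at i is read in the chart of the segment that covers time i, after undoing the
     offset of that segment. *)
  set (y := fun i => snd (C (flo (taui (IZR i)))) (i - J (flo (taui (IZR i))))%Z).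
  assert (Hy : forall k t i, IZR k <= t < IZR k + 1 -> tau t = IZR i ->
            y i = snd (C k) (i - J k)%Z).
  { intros k t i Hk Ht; unfold y; rewrite <- Ht, iT, (flo_unique t k) by auto; auto. }
  exists y, tau; apply line_map_intro; auto; [split; auto| | |].
  - intros p l c Hb; destruct (TF p l c Hb) as (l' & Hl & HJ & H).
    assert (Hrel : forall s, 0 <= s <= INR l + 1 ->
              block_coord l s = block_coord l' (tau (IZR p + s) - IZR (p + J p))).
    { intros s Hs'; rewrite H, plus_IZR by lra; unfold fin_map.
      replace (IZR p + s - IZR p) with s by lra.
      rewrite <- (block_coord_block_point l' (block_coord l s)) at 1; f_equal; lra. }
    destruct (fin_block_ends _ _ _ _ _ Hrel) as [E1 E2].
    exists (p + J p)%Z, l'; split; auto; split; auto; split.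
    + intros i Hi; destruct (Hs (IZR (p + J p + Z.of_nat i))) as [t Ht].
      apply le_INR in Hi; rewrite plus_IZR, IZR_of_nat in Ht; pose proof (pos_INR i).
      assert (IZR p <= t) by (apply (lt_le_inv tau Hm); lra).
      assert (t < IZR p + INR l + 1) by (apply (lt_lt_inv tau Hm); lra).
      pose proof (flo_spec t).
      assert (p < flo t + 1)%Z by (apply lt_IZR; rewrite plus_IZR; lra).
      assert (flo t < p + Z.of_nat l + 1)%Z
        by (apply lt_IZR; rewrite !plus_IZR, IZR_of_nat; lra).
      rewrite (Hy (flo t) t) by (rewrite ?plus_IZR, ?IZR_of_nat; rewrite ?plus_IZR in Ht; lra).
      destruct (HJ (flo t)) as [-> ->]; [lia|].
      unfold block_letter; f_equal; lia.
    + destruct Hb as (_ & _ & Hb).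
      rewrite (Hy (p + Z.of_nat l + 1)%Z (IZR (p + Z.of_nat l + 1))); [|lra|].
      (* The next chart is anchored at its own 2; comparing the two values of [tau] there identifies
         the position. *)
      * replace (p + J p + Z.of_nat l' + 1 - J (p + Z.of_nat l + 1))%Z
          with (p + Z.of_nat l + 1)%Z.
        { apply (chart_start _ _ _ _ _ _ Hx (HC _)); auto. }
        rewrite <- IZR_of_nat in E2; rewrite <- IZR_of_nat in E2; rewrite <- !plus_IZR in E2.
        rewrite Tstart in E2 by auto; apply eq_IZR in E2; lia.
      * rewrite !plus_IZR, !IZR_of_nat; rewrite plus_IZR in E2; auto.
  - intros p c Hb; destruct (TI p c Hb) as [HJ H].
    exists (p + J p)%Z, (av c), (bv c).
    assert (Hrel : forall s, 0 <= s ->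
              contr_iter (av c) s = contr_iter (bv c) (tau (IZR p + s) - IZR (p + J p))).
    { intros s Hs'; rewrite H, plus_IZR by lra; unfold inf_map.
      replace (IZR p + s - IZR p) with s by lra.
      rewrite <- (contr_iter_expand_iter (bv c) (contr_iter (av c) s)) at 1; f_equal;
        unfold expand_iter; lra. }
    pose proof (inf_block_end _ _ _ _ _ Hrel) as E1.
    split; [|split; [apply HAB|auto]].
    intros i; destruct (Hs (IZR (p + J p + Z.of_nat i))) as [t Ht].
    pose proof (pos_INR i).
    assert (IZR p <= t).
    { apply (lt_le_inv tau Hm); rewrite Ht, E1, (plus_IZR (p + J p)), IZR_of_nat; lra. }
    pose proof (flo_spec t).
    assert (p < flo t + 1)%Z by (apply lt_IZR; rewrite plus_IZR; lra).
    rewrite (Hy (flo t) t) by (auto; lra).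
    destruct (HJ (flo t)) as [-> ->]; [lia|].
    unfold block_letter; f_equal; lia.
  - intros k Hk; destruct (TL k Hk) as [HJ H]; exists (J k); split; auto.
    intros i Hi; destruct (HJ i Hi) as [E1 E2].
    rewrite (Hy i (IZR i)); [|lra|].
    + rewrite E1, E2; f_equal; lia.
    + rewrite H, plus_IZR; auto.
      apply IZR_le in Hi; lra.
Qed.

(** * The homomorphism *)

(** All images of the flow line differ by integer shifts and give the same point of the torus, so
    any choice will do. *)
Definition phi (g : cantor -> cantor) (p : TX) : TX :=
  epsilon (inhabits p) (fun p' => exists y tau (hy : inX y),
    line_map g (TX_cfg p) y tau /\ p' = mkT y hy (tau (TX_time p))).

Lemma phi_spec g x y tau hx hy t : prefix_replacing g -> line_map g x y tau ->
  phi g (mkT x hx t) = mkT y hy (tau t).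
Proof.
  intros HV H; unfold phi.
  match goal with |- epsilon ?i ?P = _ => pose proof (epsilon_spec i P) as E end.
  (* [mkT] stores the configuration shifted by the floor of t, so the line map is moved along with
     it. *)
  pose proof (line_map_shift_src _ _ _ _ (flo t) H) as H'.
  destruct E as (y' & tau' & hy' & HR & E).
  { exists (mkT y hy (tau (t - IZR (flo t) + IZR (flo t)))), y.
    eexists; exists hy; split; [exact H'|reflexivity]. }
  rewrite E; clear E; change (TX_cfg (mkT x hx t)) with (shiftZ (flo t) x) in HR.
  change (TX_time (mkT x hx t)) with (t - IZR (flo t)).
  destruct (line_map_unique _ _ _ _ _ _ HV H' HR) as (j & -> & Ht).
  symmetry; apply (mkT_shift _ _ _ _ _ _ j); auto.
  rewrite Ht; replace (t - IZR (flo t) + IZR (flo t)) with t; lra.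
Qed.

Lemma phi_continuous g : prefix_replacing g -> contT (phi g).
Proof.
  intros HV U HU x t Hx HO.
  destruct (line_map_exists g x HV Hx) as (y & tau & H).
  pose proof (line_map_tgt _ _ _ _ H) as Hy.
  destruct (HU y (tau t) Hy) as (N & eps & He & Hnb).
  { intros hy; rewrite <- (phi_spec g x y tau Hx hy t HV H); auto. }
  destruct (line_map_continuous g x y tau t N eps HV H He) as (M & d & Hd & Hc).
  exists M, d; split; auto; intros x' t' Hx' Hag Ht' hx'.
  destruct (line_map_exists g x' HV Hx') as (y' & tau' & H').
  pose proof (line_map_tgt _ _ _ _ H') as Hy'.
  destruct (Hc x' y' tau' t' H' Hag Ht') as (j & Hj & Hjt).
  rewrite (phi_spec g x' y' tau' hx' Hy' t' HV H').
  rewrite (mkT_shift y' Hy' (tau' t') (shiftZ j y') (inX_shiftZ j y' Hy') (tau' t' - IZR j) j);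
    [|auto|lra].
  apply (Hnb (shiftZ j y') (tau' t' - IZR j)); auto using inX_shiftZ.
Qed.

Lemma phi_comp f g : prefix_replacing f -> prefix_replacing g ->
  forall p, phi (fun c => g (f c)) p = phi g (phi f p).
Proof.
  intros Hf Hg p; rewrite <- (mkT_self p).
  destruct (line_map_exists f _ Hf (TX_inX p)) as (y & tau & H).
  pose proof (line_map_tgt _ _ _ _ H) as Hy.
  destruct (line_map_exists g y Hg Hy) as (z & tau' & H').
  pose proof (line_map_tgt _ _ _ _ H') as Hz.
  rewrite (phi_spec f _ y tau _ Hy _ Hf H), (phi_spec g _ z tau' _ Hz _ Hg H').
  apply (phi_spec _ _ z (fun t => tau' (tau t))).
  - apply prefix_replacing_comp; auto.
  - apply (line_map_comp f g _ y); auto.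
Qed.

Lemma phi_id p : phi (fun c => c) p = p.
Proof.
  rewrite <- (mkT_self p) at 1.
  rewrite (phi_spec _ _ _ _ _ (TX_inX p) _ prefix_replacing_id (line_map_id _ (TX_inX p))).
  apply mkT_self.
Qed.

Lemma phi_homeo g h : prefix_bij g h -> homeoT (phi g).
Proof.
  intros (Hg & Hh & E1 & E2); exists (phi h); repeat split; auto using phi_continuous; intros p.
  - rewrite <- phi_comp by auto.
    replace (fun c => h (g c)) with (fun c : cantor => c); [apply phi_id|].
    apply functional_extensionality; auto.
  - rewrite <- phi_comp by auto.
    replace (fun c => g (h c)) with (fun c : cantor => c); [apply phi_id|].
    apply functional_extensionality; auto.
Qed.

Lemma phi_reparam g p y tau : prefix_replacing g -> line_map g (TX_cfg p) y tau ->
  flow_reparam (phi g) p (fun s => tau (TX_time p + s) - tau (TX_time p)).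
Proof.
  intros HV H; pose proof (line_map_tgt _ _ _ _ H) as Hy;
    destruct (line_map_incr_bij _ _ _ _ H) as [Hm Hs].
  split; [rewrite Rplus_0_r; lra|]; split; [|split].
  - intros r s Hrs; apply Rplus_lt_compat_r, Hm; lra.
  - intros r; destruct (Hs (r + tau (TX_time p))) as [t Ht]; exists (t - TX_time p).
    replace (TX_time p + (t - TX_time p)) with t by lra; lra.
  - intros s; unfold flow at 1; rewrite (phi_spec g _ y tau _ Hy _ HV H).
    assert (E : phi g p = mkT y Hy (tau (TX_time p)))
      by (rewrite <- (mkT_self p) at 1; apply phi_spec; auto).
    rewrite E, flow_mkT.
    f_equal; lra.
Qed.

(** * Piecewise linearity *)

(** Closure under concatenation is built in, which avoids lists of breakpoints until
    [PLon_breakpoints]. *)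
Inductive PLon (f : R -> R) : R -> R -> Prop :=
| PLon_affine a b m c : a < b -> (forall r, a <= r <= b -> f r = m * r + c) -> PLon f a b
| PLon_cat a b c : PLon f a b -> PLon f b c -> PLon f a c.

Lemma PLon_lt f a b : PLon f a b -> a < b.
Proof. induction 1; lra. Qed.

Lemma PLon_ext f g a b : PLon f a b -> (forall r, a <= r <= b -> g r = f r) -> PLon g a b.
Proof.
  induction 1 as [a b m c H H'|a b c H1 IH1 H2 IH2]; intros E.
  - apply (PLon_affine _ _ _ m c); auto; intros r Hr; rewrite E; auto.
  - apply PLon_lt in H1; apply PLon_lt in H2.
    apply (PLon_cat _ _ b); [apply IH1|apply IH2]; intros; apply E; lra.
Qed.

Lemma PLon_sub f a b : PLon f a b -> forall a' b', a <= a' -> a' < b' -> b' <= b -> PLon f a' b'.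
Proof.
  induction 1 as [a b m c H H'|a b c H1 IH1 H2 IH2]; intros a' b' Ha Hab Hb.
  - apply (PLon_affine _ _ _ m c); auto; intros r Hr; apply H'; lra.
  - destruct (Rle_lt_dec b' b); [apply IH1; lra|].
    destruct (Rle_lt_dec b a'); [apply IH2; lra|].
    apply (PLon_cat _ _ b); [apply IH1|apply IH2]; lra.
Qed.

Lemma PLon_comp_affine f m c a b : 0 < m ->
  PLon f a b -> PLon (fun t => f (m * t + c)) ((a - c) / m) ((b - c) / m).
Proof.
  intros Hm; induction 1 as [a b n d H H'|a b e H1 IH1 H2 IH2].
  - apply (PLon_affine _ _ _ (n * m) (n * c + d)).
    + apply Rmult_lt_compat_r; [apply Rinv_0_lt_compat; auto|lra].
    + intros r [Hr1 Hr2]; rewrite H'; [ring|].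
      apply (Rmult_le_compat_l m) in Hr1; [|lra]; apply (Rmult_le_compat_l m) in Hr2; [|lra].
      replace (m * ((a - c) / m)) with (a - c) in Hr1 by (field; lra).
      replace (m * ((b - c) / m)) with (b - c) in Hr2 by (field; lra); lra.
  - eapply PLon_cat; eauto.
Qed.

Definition PL (f : R -> R) : Prop := forall a b, a < b -> PLon f a b.

Lemma PL_affine m c : PL (fun t => m * t + c).
Proof. intros a b H; apply (PLon_affine _ _ _ m c); auto. Qed.

Lemma PL_comp_affine f m c : 0 < m -> PL f -> PL (fun t => f (m * t + c)).
Proof.
  intros Hm Hf a b H.
  replace a with ((m * a + c - c) / m) by (field; lra).
  replace b with ((m * b + c - c) / m) by (field; lra).
  apply PLon_comp_affine; auto; apply Hf.
  apply Rplus_lt_compat_r, Rmult_lt_compat_l; auto.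
Qed.

Lemma PL_split f s : (forall a b, a < b -> b <= s -> PLon f a b) ->
  (forall a b, a < b -> s <= a -> PLon f a b) -> PL f.
Proof.
  intros H1 H2 a b H; destruct (Rle_lt_dec b s); auto; destruct (Rle_lt_dec s a); auto.
  apply (PLon_cat _ _ s); [apply H1|apply H2]; lra.
Qed.

Lemma PL_comp_contr f : PL f -> PL (fun t => f (contr t)).
Proof.
  intros Hf; apply (PL_split _ 3); intros a b Hab Hb.
  - apply (PLon_ext (fun t => f (2 / 3 * t + 0))); [apply PL_comp_affine; auto; lra|].
    intros r Hr; rewrite contr_lo by lra; f_equal; lra.
  - apply (PLon_ext (fun t => f (1 * t + -1))); [apply PL_comp_affine; auto; lra|].
    intros r Hr; rewrite contr_hi by lra; f_equal; lra.
Qed.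

Lemma PL_comp_expand f : PL f -> PL (fun t => f (expand t)).
Proof.
  intros Hf; apply (PL_split _ 2); intros a b Hab Hb.
  - apply (PLon_ext (fun t => f (3 / 2 * t + 0))); [apply PL_comp_affine; auto; lra|].
    intros r Hr; rewrite expand_lo by lra; f_equal; lra.
  - apply (PLon_ext (fun t => f (1 * t + 1))); [apply PL_comp_affine; auto; lra|].
    intros r Hr; rewrite expand_hi by lra; f_equal; lra.
Qed.

Lemma PL_comp_contr_iter n f : PL f -> PL (fun t => f (contr_iter n t)).
Proof.
  revert f; induction n; intros f Hf; auto.
  apply (IHn (fun t => f (contr t))), PL_comp_contr; auto.
Qed.

Lemma PL_comp_expand_iter n f : PL f -> PL (fun t => f (expand_iter n t)).
Proof.
  revert f; induction n; intros f Hf; auto.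
  apply (IHn (fun t => f (expand t))), PL_comp_expand; auto.
Qed.

Lemma line_map_PL g x y tau : line_map g x y tau -> PL tau.
Proof.
  intros H.
  assert (Hunit : forall k, PLon tau (IZR k) (IZR k + 1)).
  { intros k; destruct (trichotomy x k (line_map_src _ _ _ _ H))
      as [Hk|[(p & l & c & Hb & Hk)|(p & c & Hb & Hk)]].
    - destruct (line_map_left_tail _ _ _ _ H _ Hk) as (j & H1 & _).
      apply (PLon_affine _ _ _ 1 (IZR j)); [lra|]; intros r Hr; rewrite H1; lra.
    - destruct (line_map_fin_block _ _ _ _ H _ _ _ Hb) as (q & l' & _ & H1).
      (* The formula for [tau] on a finite block, padded with trivial factors and summands so that
         every layer is literally an affine map, a contraction or an expansion. *)
      assert (HP : PL (fun t => 1 * expand_iter l'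
                 (/ coord_scale l' * (coord_scale l * contr_iter l (1 * t + - IZR p) + 0) + 0) + IZR q)).
      { apply (PL_comp_affine (fun t => 1 * expand_iter l'
                 (/ coord_scale l' * (coord_scale l * contr_iter l t + 0) + 0) + IZR q)); [lra|].
        apply (PL_comp_contr_iter l (fun t => 1 * expand_iter l'
                 (/ coord_scale l' * (coord_scale l * t + 0) + 0) + IZR q)).
        apply (PL_comp_affine (fun t => 1 * expand_iter l' (/ coord_scale l' * t + 0) + IZR q));
          [apply coord_scale_pos|].
        apply (PL_comp_affine (fun t => 1 * expand_iter l' t + IZR q));
          [apply Rinv_0_lt_compat, coord_scale_pos|].
        apply (PL_comp_expand_iter l' (fun t => 1 * t + IZR q)), PL_affine. }
      apply (PLon_ext _ _ _ _ (HP (IZR k) (IZR k + 1) ltac:(lra))); intros r Hr.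
      assert (IZR p <= IZR k) by (apply IZR_le; lia).
      assert (IZR k <= IZR p + INR l)
        by (rewrite <- IZR_of_nat, <- plus_IZR; apply IZR_le; lia).
      specialize (H1 (r - IZR p) ltac:(lra)).
      replace (IZR p + (r - IZR p)) with r in H1 by lra.
      apply (f_equal (block_point l')) in H1; rewrite block_point_block_coord in H1;
        unfold block_point, block_coord in H1.
      replace (/ coord_scale l' * (coord_scale l * contr_iter l (1 * r + - IZR p) + 0) + 0)
        with (coord_scale l * contr_iter l (r - IZR p) / coord_scale l').
      + unfold expand_iter; lra.
      + unfold Rdiv; replace (1 * r + - IZR p) with (r - IZR p) by lra; ring.
    - destruct (line_map_inf_block _ _ _ _ H _ _ Hb) as (q & a & b & _ & _ & H1).
      assert (HP : PL (fun t => 1 * expand_iter b (contr_iter a (1 * t + - IZR p)) + IZR q)).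
      { apply (PL_comp_affine (fun t => 1 * expand_iter b (contr_iter a t) + IZR q)); [lra|].
        apply (PL_comp_contr_iter a (fun t => 1 * expand_iter b t + IZR q)).
        apply (PL_comp_expand_iter b (fun t => 1 * t + IZR q)), PL_affine. }
      apply (PLon_ext _ _ _ _ (HP (IZR k) (IZR k + 1) ltac:(lra))); intros r Hr.
      assert (IZR p <= IZR k) by (apply IZR_le; lia).
      specialize (H1 (r - IZR p) ltac:(lra)).
      replace (IZR p + (r - IZR p)) with r in H1 by lra.
      replace (1 * r + - IZR p) with (r - IZR p) by lra.
      rewrite H1, expand_iter_contr_iter; lra. }
  assert (Hn : forall k n, PLon tau (IZR k) (IZR k + INR (S n))).
  { intros k n; induction n as [|n IH]; [apply Hunit|].
    apply (PLon_cat _ _ _ _ IH).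
    replace (IZR k + INR (S n)) with (IZR (k + Z.of_nat (S n)))
      by (rewrite plus_IZR, IZR_of_nat; auto).
    replace (IZR k + INR (S (S n))) with (IZR (k + Z.of_nat (S n)) + 1); [apply Hunit|].
    rewrite plus_IZR, IZR_of_nat, (S_INR (S n)); lra. }
  intros a b Hab; pose proof (flo_spec a); destruct (INR_unbounded (b - IZR (flo a))) as [n Hb].
  apply (PLon_sub _ _ _ (Hn (flo a) n)); rewrite ?S_INR; lra.
Qed.

Lemma PLon_breakpoints f a b : PLon f a b ->
  exists (n : nat) (br : nat -> R), br 0%nat = a /\ br n = b /\
    (forall i, (i < n)%nat -> br i < br (S i)) /\
    (forall i, (i < n)%nat -> exists m c, forall r, br i <= r <= br (S i) -> f r = m * r + c).
Proof.
  induction 1 as [a b m c H H'|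
    a b c _ (n & br & H1 & H2 & H3 & H4) _ (n' & br' & H1' & H2' & H3' & H4')].
  - exists 1%nat, (fun i => match i with O => a | _ => b end); repeat split; auto.
    + intros [|i] Hi; auto; lia.
    + intros [|i] Hi; [eauto|lia].
  - set (B := fun i => if Nat.leb i n then br i else br' (i - n)%nat).
    assert (HB1 : forall i, (i <= n)%nat -> B i = br i).
    { intros i Hi; unfold B; destruct (Nat.leb_spec i n); auto; lia. }
    assert (HB2 : forall i, B (n + i)%nat = br' i).
    { intros i; unfold B; destruct (Nat.leb_spec (n + i) n).
      - replace i with 0%nat by lia; rewrite Nat.add_0_r; congruence.
      - f_equal; lia. }
    exists (n + n')%nat, B; rewrite HB1, HB2 by lia; repeat split; auto.
    + intros i Hi; destruct (Nat.lt_ge_cases i n).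
      * rewrite !HB1 by lia; auto.
      * replace i with (n + (i - n))%nat by lia; rewrite <- Nat.add_succ_r, !HB2; apply H3'; lia.
    + intros i Hi; destruct (Nat.lt_ge_cases i n).
      * rewrite !HB1 by lia; auto.
      * replace i with (n + (i - n))%nat by lia; rewrite <- Nat.add_succ_r, !HB2; apply H4'; lia.
Qed.

Lemma PL_piecewise_linear f d : PL f -> piecewise_linear (fun t => f t - d).
Proof.
  intros Hf a b Hab; destruct (PLon_breakpoints _ _ _ (Hf a b Hab)) as (n & br & H1 & H2 & H3 & H4).
  exists n, br; repeat split; auto; intros i Hi; destruct (H4 i Hi) as (m & c & H).
  exists m, (c - d); intros r Hr; rewrite H by auto; lra.
Qed.

Lemma phi_reparam_PL g p : prefix_replacing g ->
  exists f, flow_reparam (phi g) p f /\ piecewise_linear f.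
Proof.
  intros HV; destruct (line_map_exists g _ HV (TX_inX p)) as (y & tau & H).
  eexists; split; [apply (phi_reparam g p y tau HV H)|].
  apply (PL_piecewise_linear (fun s => tau (TX_time p + s))).
  intros a b Hab; apply (PLon_ext (fun s => tau (1 * s + TX_time p))).
  - apply (PL_comp_affine tau 1 (TX_time p)); auto; [lra|]; eapply line_map_PL; eauto.
  - intros r _; f_equal; lra.
Qed.

(** * Isotopies preserve flow lines *)

(** Connectedness of [a, b], by the supremum of the points where P holds. *)
Lemma locally_constant (P : R -> Prop) a b : a <= b ->
  (forall u, a <= u <= b -> exists e, 0 < e /\
     forall v, a <= v <= b -> Rabs (v - u) < e -> (P u <-> P v)) ->
  P a -> P b.
Proof.
  intros Hab Hloc Ha.
  set (E := fun u => a <= u <= b /\ P u).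
  destruct (completeness E) as [s [Hs1 Hs2]].
  { exists b; intros u [Hu _]; lra. }
  { exists a; split; auto; lra. }
  assert (Has : a <= s) by (apply Hs1; split; auto; lra).
  assert (Hsb : s <= b) by (apply Hs2; intros u [Hu _]; lra).
  destruct (Hloc s ltac:(lra)) as (e & He & Hnb).
  assert (HPs : P s).
  { apply NNPP; intros HN; assert (s <= s - e); [|lra]; apply Hs2; intros u [Hu HPu].
    destruct (Rle_lt_dec u (s - e)); auto; exfalso; apply HN, (Hnb u); auto.
    assert (u <= s) by (apply Hs1; split; auto).
    apply Rabs_def1; lra. }
  destruct (Rle_lt_dec b s) as [|Hlt]; [replace b with s by lra; auto|].
  set (v := Rmin b (s + e / 2)).
  assert (Hv : s < v <= b /\ v <= s + e / 2).
  { unfold v; split; [split; [apply Rmin_glb_lt; lra|apply Rmin_l]|apply Rmin_r]. }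
  assert (HPv : P v).
  { apply (Hnb v); auto; [lra|]; apply Rabs_def1; lra. }
  assert (v <= s) by (apply Hs1; split; auto; lra); lra.
Qed.

(** Times representing the same point differ by an integer, and within distance 1/2 of s by less
    than 1. So the letter at i is well defined on this open set. *)
Lemma openT_chart s i a :
  openT (fun p => exists y (hy : inX y) r, p = mkT y hy r /\ Rabs (r - s) < / 2 /\ y i = a).
Proof.
  intros x t Hx HO; destruct (HO Hx) as (y & hy & r & E & Hr & Ha).
  destruct (mkT_inv _ _ _ _ _ _ E) as (j & -> & ->).
  exists (Z.to_nat (Z.abs (i + j))), (/ 2 - Rabs (r - s)); split; [lra|].
  intros x' t' Hx' Hag Ht' hx'.
  exists (shiftZ j x'), (inX_shiftZ j x' hx'), (t' - IZR j); split; [|split].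
  - apply (mkT_shift _ _ _ _ _ _ j); auto; lra.
  - replace (t' - IZR j - s) with ((t' - (r + IZR j)) + (r - s)) by lra.
    eapply Rle_lt_trans; [apply Rabs_triang|]; lra.
  - rewrite <- Ha; unfold shiftZ; apply Hag; lia.
Qed.

Definition same_line (p q : TX) : Prop := exists s, q = flow s p.

Lemma same_line_mkT x hx t y hy s :
  same_line (mkT x hx t) (mkT y hy s) <-> exists j, y = shiftZ j x.
Proof.
  split.
  - intros [r Hr]; rewrite flow_mkT in Hr; symmetry in Hr.
    destruct (mkT_inv _ _ _ _ _ _ Hr) as (j & E & _); eauto.
  - intros [j E]; exists (s + IZR j - t); rewrite flow_mkT; symmetry.
    apply (mkT_shift _ _ _ _ _ _ j); auto; lra.
Qed.

Lemma same_line_refl p : same_line p p.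
Proof. rewrite <- (mkT_self p); apply same_line_mkT; exists 0%Z; rewrite shiftZ_0; auto. Qed.

Lemma same_line_sym p q : same_line p q -> same_line q p.
Proof.
  rewrite <- (mkT_self p), <- (mkT_self q), !same_line_mkT; intros [j ->].
  exists (- j)%Z; rewrite shiftZ_add, Z.add_opp_diag_r, shiftZ_0; auto.
Qed.

Lemma same_line_trans p q r : same_line p q -> same_line q r -> same_line p r.
Proof.
  rewrite <- (mkT_self p), <- (mkT_self q), <- (mkT_self r), !same_line_mkT.
  intros [j ->] [k ->]; exists (j + k)%Z; rewrite shiftZ_add; auto.
Qed.

Definition pathT (c : R -> TX) : Prop :=
  forall U, openT U -> forall u, 0 <= u <= 1 -> U (c u) ->
    exists e, 0 < e /\ forall v, 0 <= v <= 1 -> Rabs (v - u) < e -> U (c v).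

(* In the chart of all [y, r] with |r - s| < 1/2 the configuration y is determined by the point,
   and each of its letters is a locally constant function on the path. *)
Lemma path_local_line c u : pathT c -> 0 <= u <= 1 ->
  exists e, 0 < e /\ forall v, 0 <= v <= 1 -> Rabs (v - u) < e -> same_line (c u) (c v).
Proof.
  intros Hc Hu; set (x := TX_cfg (c u)); set (s := TX_time (c u)).
  pose proof (TX_inX (c u)) as Hx; fold x in Hx.
  assert (Hcu : c u = mkT x Hx s).
  { rewrite <- (mkT_self (c u)) at 1; apply (mkT_shift _ _ _ _ _ _ 0%Z).
    - rewrite shiftZ_0; auto.
    - unfold s; lra. }
  set (W := fun i a p => exists y (hy : inX y) r, p = mkT y hy r /\ Rabs (r - s) < / 2 /\ y i = a).
  assert (Hself : forall i, W i (x i) (c u)).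
  { intros i; exists x, Hx, s; split; auto; split; auto.
    rewrite Rminus_diag, Rabs_R0; lra. }
  destruct (Hc _ (openT_chart s 0 (x 0%Z)) u Hu (Hself 0%Z)) as (e & He & Hnb).
  exists e; split; auto; intros v Hv Hvu.
  assert (Hin : forall w, Rmin u v <= w <= Rmax u v -> 0 <= w <= 1 /\ exists y (hy : inX y) r,
             c w = mkT y hy r /\ Rabs (r - s) < / 2).
  { intros w Hw; pose proof (Rmin_glb u v 0 ltac:(lra) ltac:(lra)).
    pose proof (Rmax_lub u v 1 ltac:(lra) ltac:(lra)); split; [lra|].
    destruct (Hnb w) as (y & hy & r & E1 & E2 & _); [lra| |eauto 6].
    apply Rabs_def2 in Hvu; apply Rabs_def1; unfold Rmin, Rmax in Hw; destruct Rle_dec; lra. }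
  assert (Huniq : forall y hy r y' hy' r', mkT y hy r = mkT y' hy' r' ->
            Rabs (r - s) < / 2 -> Rabs (r' - s) < / 2 -> y = y').
  { intros y hy r y' hy' r' E H1 H2; destruct (mkT_inv _ _ _ _ _ _ E) as (j & -> & ->).
    apply Rabs_def2 in H1; apply Rabs_def2 in H2.
    assert (j < 1)%Z by (apply lt_IZR; lra); assert (-1 < j)%Z by (apply lt_IZR; lra).
    replace j with 0%Z by lia; rewrite shiftZ_0; auto. }
  assert (Hloc : forall i w, Rmin u v <= w <= Rmax u v -> exists e', 0 < e' /\
            forall w', Rmin u v <= w' <= Rmax u v -> Rabs (w' - w) < e' ->
              (W i (x i) (c w) <-> W i (x i) (c w'))).
  { intros i w Hw; destruct (Hin w Hw) as (Hw1 & y & hy & r & E & Hr).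
    destruct (Hc (W i (y i)) (openT_chart s i (y i)) w Hw1) as (e' & He' & Hnb').
    { exists y, hy, r; auto. }
    exists e'; split; auto; intros w' Hw' Hd; destruct (Hin w' Hw') as (Hw1' & _).
    destruct (Hnb' w' Hw1' Hd) as (y' & hy' & r' & E' & Hr' & Hi').
    split; intros (y2 & hy2 & r2 & E2 & Hr2 & Hi2).
    - rewrite E in E2; apply Huniq in E2; auto; subst y2.
      exists y', hy', r'; split; auto; split; auto; congruence.
    - rewrite E' in E2; apply Huniq in E2; auto; subst y2.
      exists y, hy, r; split; auto; split; auto; congruence. }
  assert (Hv' : forall i, W i (x i) (c v)).
  { intros i; destruct (Rle_lt_dec u v).
    - rewrite Rmin_left, Rmax_right in Hloc by lra.
      apply (locally_constant (fun w => W i (x i) (c w)) u v); auto.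
    - rewrite Rmin_right, Rmax_left in Hloc by lra.
      apply NNPP; intros HN.
      (* [locally_constant] propagates from left to right; for v < u the negation is carried from v
         to u, where it is false. *)
      apply (locally_constant (fun w => ~ W i (x i) (c w)) v u); auto; [lra|].
      intros w Hw; destruct (Hloc i w Hw) as (e' & He' & H); exists e'; split; auto.
      intros w' Hw' Hd; specialize (H w' Hw' Hd); tauto. }
  destruct (Hv' 0%Z) as (y & hy & r & E & Hr & _).
  rewrite Hcu, E; apply same_line_mkT; exists 0%Z; rewrite shiftZ_0.
  apply functional_extensionality; intros i.
  destruct (Hv' i) as (y' & hy' & r' & E' & Hr' & Hi).
  rewrite E in E'; apply Huniq in E'; auto; subst y'; auto.
Qed.

Lemma path_same_line c : pathT c -> same_line (c 0) (c 1).
Proof.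
  intros Hc; apply (locally_constant (fun u => same_line (c 0) (c u)) 0 1);
    [lra| |apply same_line_refl].
  intros u Hu; destruct (path_local_line c u Hc Hu) as (e & He & H); exists e; split; auto.
  intros v Hv Hd; specialize (H v Hv Hd); split; intros H0.
  - eapply same_line_trans; eauto.
  - eapply same_line_trans; eauto using same_line_sym.
Qed.

Lemma isotopic_same_line F G x hx t :
  isotopic F G -> same_line (F (mkT x hx t)) (G (mkT x hx t)).
Proof.
  intros (H & <- & <- & _ & Hc).
  apply (path_same_line (fun u => H u (mkT x hx t))); intros U HU u Hu HUu.
  destruct (Hc U HU u x t Hu hx) as (N & e & He & Hnb).
  { intros hx'; rewrite (proof_irrelevance _ hx' hx); auto. }
  exists e; split; auto; intros v Hv Hd; apply (Hnb v x t); auto.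
  - intros n _; auto.
  - rewrite Rminus_diag, Rabs_R0; auto.
Qed.

Definition test_config (c : cantor) : config :=
  fun n => if (n <? 0)%Z then 1%nat else block_word c (Z.to_nat n).

Lemma test_config_inf_block c : inf_block (test_config c) 0 c.
Proof.
  intros i; unfold test_config; destruct (Z.ltb_spec (0 + Z.of_nat i) 0); [lia|]; f_equal; lia.
Qed.

Lemma test_config_left_tail c : left_tail (test_config c) (-1).
Proof. intros i Hi; unfold test_config; destruct (Z.ltb_spec i 0); lia. Qed.

Lemma test_config_inX c : inX (test_config c).
Proof.
  intros n; unfold test_config.
  destruct (Z.ltb_spec n 0); [split; lia|]; destruct (Z.ltb_spec (n + 1) 0); [lia|].
  split; [apply block_word_le|]; intros [_ H1].
  replace (Z.to_nat (n + 1)) with (S (Z.to_nat n)) in H1 by lia.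
  apply block_word_S in H1; auto.
Qed.

Lemma test_config_image g c y tau : line_map g (test_config c) y tau ->
  exists q, inf_block y q (g c) /\ left_tail y (q - 1).
Proof.
  intros H.
  destruct (line_map_inf_block _ _ _ _ H _ _ (test_config_inf_block c)) as (q & a & b & H1 & _ & H2).
  destruct (line_map_left_tail _ _ _ _ H _ (test_config_left_tail c)) as (j & H3 & H4).
  pose proof (inf_block_end _ _ _ _ _ H2) as E; rewrite H3 in E by lra.
  assert (q = j) by (apply eq_IZR; lra); subst q.
  exists j; split; auto; intros i Hi.
  replace i with ((i - j) + j)%Z by lia; rewrite H4 by lia; apply test_config_left_tail; lia.
Qed.

(** The two images of a test configuration lie on one flow line, so they differ by a shift. Each
    contains a single 2; aligning these fixes the shift, and the letters after the 2 spell f(c) and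
    g(c). *)
Lemma phi_isotopic_inj f g : prefix_replacing f -> prefix_replacing g ->
  isotopic (phi f) (phi g) -> f = g.
Proof.
  intros Hf Hg HI; apply functional_extensionality; intros c.
  pose proof (test_config_inX c) as Hx.
  destruct (line_map_exists f _ Hf Hx) as (y & tau & H);
    destruct (line_map_exists g _ Hg Hx) as (y' & tau' & H').
  pose proof (isotopic_same_line _ _ _ Hx 0 HI) as HS.
  rewrite (phi_spec f _ _ _ _ (line_map_tgt _ _ _ _ H) _ Hf H) in HS.
  rewrite (phi_spec g _ _ _ _ (line_map_tgt _ _ _ _ H') _ Hg H') in HS.
  apply same_line_mkT in HS; destruct HS as [j ->].
  destruct (test_config_image _ _ _ _ H) as (q & H1 & H2).
  destruct (test_config_image _ _ _ _ H') as (q' & H1' & H2').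
  pose proof (inf_block_start _ _ _ H1') as Hq'; unfold shiftZ in Hq'.
  assert (q' + j = q)%Z.
  { destruct (Z_lt_ge_dec (q' + j) q).
    - exfalso; apply (H2 (q' + j)%Z); auto; lia.
    - apply (inf_block_only_start _ _ _ _ H1); auto; lia. }
  apply functional_extensionality; intros i; apply block_word_inj.
  rewrite <- H1, <- H1'; unfold shiftZ; f_equal; lia.
Qed.

(** * Local rules *)

Lemma matchAt_cons x k a u : matchAt x k (a :: u) <-> x k = a /\ matchAt x (k + 1) u.
Proof.
  split.
  - intros H; split.
    + specialize (H 0%nat); simpl in H; rewrite Z.add_0_r in H; apply H; lia.
    + intros i Hi; specialize (H (S i)); simpl in H.
      rewrite <- H by lia; f_equal; lia.
  - intros [H1 H2] [|i] Hi; simpl in *; [rewrite Z.add_0_r; auto|].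
    rewrite <- H2 by lia; f_equal; lia.
Qed.

Lemma matchAt_nil x k : matchAt x k [].
Proof. intros i Hi; simpl in Hi; lia. Qed.

Lemma matchAt_app x k u v :
  matchAt x k (u ++ v) <-> matchAt x k u /\ matchAt x (k + Z.of_nat (length u)) v.
Proof.
  revert k; induction u as [|a u IH]; intros k; simpl app.
  - rewrite Z.add_0_r; split; [split; auto using matchAt_nil|tauto].
  - rewrite !matchAt_cons, IH; simpl length.
    replace (k + 1 + Z.of_nat (length u))%Z with (k + Z.of_nat (S (length u)))%Z by lia; tauto.
Qed.

Definition rmatch (x : config) (k : Z) (r : word * word * word * word) : Prop :=
  let '(u, v, w, _) := r in
  matchAt x (k - Z.of_nat (length u)) u /\ matchAt x k v /\
  matchAt x (k + Z.of_nat (length v)) w.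

Definition replaces (y : config) (tau : R -> R) (k : Z) (v v' : word) : Prop :=
  exists q, tau (IZR k) = IZR q /\ matchAt y q v' /\
    forall s, 0 <= s <= INR (length v) ->
      tau (IZR k + s) = IZR q + s * INR (length v') / INR (length v).

(** Each rule is compared with the image line on its own; that the rules cut every configuration
    into blocks is the separate finite check [check_rules]. *)
Definition rule_sound (g : cantor -> cantor) (L : local_rule) : Prop :=
  forall x y tau k u v w v', line_map g x y tau -> In (u, v, w, v') L ->
    rmatch x k (u, v, w, v') -> replaces y tau k v v'.

Definition cantor_of (w : word) : cantor := fun i => Nat.eqb (nth i w 0%nat) 1.

Lemma block_word_cantor_of w i : Forall (fun a => (a <= 1)%nat) w ->
  block_word (cantor_of w) (S i) = nth i w 0%nat.
Proof.
  intros H; simpl; unfold cantor_of.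
  assert (nth i w 0 <= 1)%nat.
  { revert i; induction H; intros [|i]; simpl; auto. }
  destruct (Nat.eqb_spec (nth i w 0%nat) 1); lia.
Qed.

Lemma cantor_of_app w w' i : (i < length w)%nat -> cantor_of (w ++ w') i = cantor_of w i.
Proof. intros; unfold cantor_of; rewrite app_nth1; auto. Qed.

(** With at most two letters after the 2 on both sides the block coordinates are linear, so equality
    of coordinates is the affine map of the rule. *)
Lemma replaces_linear y tau k q w w' :
  (length w <= 2)%nat -> (length w' <= 2)%nat ->
  tau (IZR k) = IZR q -> Forall (fun a => (a <= 1)%nat) w' ->
  (forall i, (i <= length w')%nat -> y (q + Z.of_nat i)%Z = block_word (cantor_of w') i) ->
  (forall s, 0 <= s <= INR (length w) + 1 ->
     block_coord (length w) s = block_coord (length w') (tau (IZR k + s) - IZR q)) ->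
  replaces y tau k (2%nat :: w) (2%nat :: w').
Proof.
  intros Hw Hw' E Hb Hy H; exists q; split; auto; split.
  - intros [|i] Hi; rewrite Hy by (simpl in Hi; lia); auto; apply (block_word_cantor_of w' i); auto.
  - intros s Hs; simpl length in *; rewrite !S_INR in *.
    specialize (H s Hs); rewrite block_coord_linear in H by (auto; lra).
    pose proof (pos_INR (length w)); pose proof (pos_INR (length w')).
    assert (F : s * (INR (length w') + 1) / (INR (length w) + 1) <= INR (length w') + 1).
    { apply (Rmult_le_reg_r (INR (length w) + 1)); [lra|].
      unfold Rdiv; rewrite Rmult_assoc, Rinv_l by lra; nra. }
    assert (G : tau (IZR k + s) - IZR q = s * (INR (length w') + 1) / (INR (length w) + 1)).
    { apply (block_coord_inj (length w')); rewrite (block_coord_linear _ (s * _ / _)), <- H by auto.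
      field; lra. }
    lra.
Qed.

(** The case of a block closed by the next 2. *)
Lemma replaces_finite g x y tau k w w' a b :
  line_map g x y tau -> matchAt x k ((2%nat :: w) ++ [2%nat]) -> repl_prefix g (cantor_of w) a b ->
  (length w <= a <= 2)%nat -> (length w' <= b <= 2)%nat ->
  (forall i, (i < b)%nat -> g (cantor_of w) i = cantor_of w' i) ->
  Forall (fun a => (a <= 1)%nat) w -> Forall (fun a => (a <= 1)%nat) w' ->
  support_size (cantor_of w) (length w) -> support_size (cantor_of w') (length w') ->
  replaces y tau k (2%nat :: w) (2%nat :: w').
Proof.
  intros H Hm Hv Ha Hb Hg Hw Hw' Hz Hz'.
  apply matchAt_app in Hm; destruct Hm as [Hm He]; apply matchAt_cons in He; destruct He as [He _].
  assert (fin_block x k (length w) (cantor_of w)) as HF.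
  { split; auto; split.
    - intros [|i] Hi; rewrite Hm by (simpl; lia); auto; symmetry;
      apply (block_word_cantor_of w i); auto.
    - rewrite <- He; f_equal; simpl length; lia. }
  destruct (line_map_fin_block _ _ _ _ H _ _ _ HF) as (q & l' & H1 & H2).
  (* Beyond the lengths a and b both sequences take the default digit 0. *)
  assert (E : g (cantor_of w) = cantor_of w').
  { apply functional_extensionality; intros i; destruct (Nat.lt_ge_cases i b); auto.
    replace i with (b + (i - b))%nat by lia; rewrite (repl_prefix_tail _ _ _ _ _ Hv).
    unfold cantor_of; rewrite !nth_overflow; auto; lia. }
  rewrite E in H1; assert (l' = length w') by (eapply support_size_unique; [apply H1|auto]);
    subst l'.
  apply (replaces_linear y tau k q); auto; try lia.
  - apply (fin_block_ends _ _ _ _ _ H2).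
  - apply H1.
Qed.

(** The case of a block that continues after w. Its next letter supplies the one extra letter that
    [long_block] asks for. *)
Lemma replaces_long g x y tau k w w' :
  line_map g x y tau -> matchAt x k (2%nat :: w) ->
  (x (k + Z.of_nat (length (2%nat :: w)))%Z <= 1)%nat ->
  repl_prefix g (cantor_of w) (length w) (length w') ->
  (1 <= length w <= 2)%nat -> (1 <= length w' <= 2)%nat ->
  (forall i, (i < length w')%nat -> g (cantor_of w) i = cantor_of w' i) ->
  Forall (fun a => (a <= 1)%nat) w -> Forall (fun a => (a <= 1)%nat) w' ->
  replaces y tau k (2%nat :: w) (2%nat :: w').
Proof.
  intros H Hm He Hv Ha Hb Hg Hw Hw'.
  set (e := x (k + Z.of_nat (length (2%nat :: w)))%Z) in *.
  assert (Hwe : Forall (fun a => (a <= 1)%nat) (w ++ [e])) by (apply Forall_app; auto).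
  assert (Hag : forall i, (i < length w)%nat -> cantor_of (w ++ [e]) i = cantor_of w i)
    by (intros; apply cantor_of_app; auto).
  assert (Hv' : repl_prefix g (cantor_of (w ++ [e])) (length w) (length w')) by (eapply repl_prefix_agree; eauto).
  destruct (long_block g x y tau k (cantor_of (w ++ [e])) (length w) (length w') (length w + 1))
    as (q & E & H1 & H2); auto.
  { assert (Hm' : matchAt x k ((2%nat :: w) ++ [e])).
    { apply matchAt_app; split; auto; apply matchAt_cons; split; auto using matchAt_nil. }
    intros [|i] Hi; rewrite Hm' by (simpl; rewrite ?length_app; simpl; lia); auto.
    symmetry; apply (block_word_cantor_of (w ++ [e]) i); auto. }
  apply (replaces_linear y tau k q); auto; try lia.
  - intros i Hi; rewrite H2 by lia; destruct i as [|i]; auto; simpl.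
    destruct (Hv _ Hag) as [F _]; rewrite F, Hg by lia; auto.
  - intros s Hs; apply (block_coord_shift_inv _ _ (length w) (length w')); try lia.
    apply H1; rewrite plus_INR; simpl; lra.
Qed.

(** For the rules that keep a single letter: it lies in the left tail or deep enough in its block to
    be translated. The third hypothesis is where the left context of the rule enters. *)
Lemma replaces_unit g x y tau k :
  line_map g x y tau -> x k <> 2%nat ->
  (forall c K, (forall i, (i <= K)%nat -> x (k - Z.of_nat K + Z.of_nat i)%Z = block_word c i) ->
     exists a b, repl_prefix g c a b /\ (1 <= a)%nat /\ (1 <= b)%nat /\ (a + 1 <= K)%nat) ->
  replaces y tau k [x k] [x k].
Proof.
  intros H Hk Hc.
  assert (Hj : exists j, (forall t, IZR k <= t <= IZR k + 1 -> tau t = t + IZR j) /\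
                         y (k + j)%Z = x k).
  { assert (Hlong : forall p c, (p <= k)%Z ->
      (forall i, (i <= Z.to_nat (k - p))%nat -> x (p + Z.of_nat i)%Z = block_word c i) ->
      exists j, (forall t, IZR k <= t <= IZR k + 1 -> tau t = t + IZR j) /\ y (k + j)%Z = x k).
    { intros p c Hp Hl; set (K := Z.to_nat (k - p)) in *.
      destruct (Hc c K) as (a & b & Hv & Ha & Hb & HK).
      { intros i Hi; rewrite <- Hl by auto; f_equal; lia. }
      destruct (long_block_unit _ _ _ _ _ _ _ _ _ H Hl Hv Ha Hb HK) as (j & H3 & H4).
      replace (p + Z.of_nat K)%Z with k in H4 by lia; exists j; split; auto.
      intros t Ht; apply H3; unfold K; rewrite <- IZR_of_nat, Z2Nat.id, minus_IZR by lia; lra. }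
    destruct (trichotomy x k (line_map_src _ _ _ _ H)) as [Hk'|[(p & l & c & Hb & Hk')|
      (p & c & Hb & Hk')]].
    - destruct (line_map_left_tail _ _ _ _ H k Hk') as (j & H1 & H2); exists j; split.
      + intros t Ht; apply H1; lra.
      + apply H2; lia.
    - apply (Hlong p c); [lia|]; intros i Hi; apply Hb; lia.
    - apply (Hlong p c); [lia|]; intros i Hi; apply Hb. }
  destruct Hj as (j & H1 & H2); exists (k + j)%Z; split; [|split].
  - rewrite H1, plus_IZR; lra.
  - apply matchAt_cons; split; auto using matchAt_nil.
  - intros s Hs; simpl in *; rewrite H1, plus_IZR by lra; field.
Qed.

(** * A finite check that the rules cut every configuration into blocks *)

Definition window (x : config) (k : Z) (n : nat) : word :=
  map (fun i => x (k + Z.of_nat i)%Z) (seq 0 n).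

Lemma window_length x k n : length (window x k n) = n.
Proof. unfold window; rewrite length_map, length_seq; auto. Qed.

Lemma window_nth x k n i : (i < n)%nat -> nth i (window x k n) 0%nat = x (k + Z.of_nat i)%Z.
Proof.
  intros Hi; unfold window.
  rewrite (nth_indep _ _ (x (k + Z.of_nat 0)%Z)) by (rewrite length_map, length_seq; auto).
  rewrite (map_nth (fun i => x (k + Z.of_nat i)%Z)), seq_nth by auto; auto.
Qed.

Lemma window_S x k n : window x k (S n) = x k :: window x (k + 1) n.
Proof.
  unfold window; simpl; rewrite Z.add_0_r, <- seq_shift, map_map; f_equal.
  apply map_ext; intros i; f_equal; lia.
Qed.

Definition slice (o n : nat) (w : word) : word := firstn n (skipn o w).

Lemma window_slice x k n o m : (o + m <= n)%nat ->
  slice o m (window x k n) = window x (k + Z.of_nat o) m.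
Proof.
  intros H; unfold slice; revert k n H; induction o as [|o IH]; intros k n H.
  - rewrite Z.add_0_r; simpl skipn; revert k n H; induction m as [|m IHm]; intros k n H; auto.
    destruct n as [|n]; [lia|]; rewrite !window_S; simpl; rewrite IHm by lia; auto.
  - destruct n as [|n]; [lia|]; rewrite window_S; simpl skipn; rewrite IH by lia; f_equal; lia.
Qed.

Definition occursb (w : word) (o : nat) (u : word) : bool :=
  if list_eq_dec Nat.eq_dec (slice o (length u) w) u then Nat.leb (o + length u) (length w) else false.

Lemma occursb_window x k n o u : occursb (window x k n) o u = true -> matchAt x (k + Z.of_nat o) u.
Proof.
  unfold occursb; destruct list_eq_dec as [E|]; [|discriminate].
  rewrite window_length; intros H; apply Nat.leb_le in H; rewrite window_slice in E by auto.
  intros i Hi; rewrite <- E, window_nth; auto.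
Qed.

Definition rmatchb (w : word) (o : nat) (r : word * word * word * word) : bool :=
  let '(u, v, w', _) := r in
  andb (Nat.leb (length u) o)
    (andb (occursb w (o - length u) u) (andb (occursb w o v) (occursb w (o + length v) w'))).

Lemma rmatchb_window x k n o r : rmatchb (window x k n) o r = true -> rmatch x (k + Z.of_nat o) r.
Proof.
  destruct r as [[[u v] w] v']; unfold rmatchb, rmatch; intros H.
  repeat (apply Bool.andb_true_iff in H; destruct H as [? H]).
  apply Nat.leb_le in H0; split; [|split].
  - apply occursb_window in H1; replace (k + Z.of_nat o - Z.of_nat (length u))%Z
      with (k + Z.of_nat (o - length u))%Z by lia; auto.
  - eapply occursb_window; eauto.
  - apply occursb_window in H; replace (k + Z.of_nat o + Z.of_nat (length v))%Z
      with (k + Z.of_nat (o + length v))%Z by lia; auto.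
Qed.

Definition rsrc (r : word * word * word * word) : word := let '(_, v, _, _) := r in v.

(* Whether a block starts at the last letter of the three-letter word w. *)
Definition markb (L : local_rule) (w : word) : bool :=
  orb (Nat.eqb (nth 2 w 0%nat) 2)
    (existsb (fun r => andb (Nat.eqb (length (rsrc r)) 1) (rmatchb w 2 r)) L).

Fixpoint no02 (w : word) : bool :=
  match w with
  | a :: (b :: _) as w' => andb (negb (andb (Nat.eqb a 0) (Nat.eqb b 2))) (no02 w')
  | _ => true
  end.

Fixpoint words (n : nat) : list word :=
  match n with
  | O => [[]]
  | S n => filter no02 (flat_map (fun w => [0 :: w; 1 :: w; 2 :: w]) (words n))
  end%nat.

Lemma no02_window x k n : inX x -> no02 (window x k n) = true.
Proof.
  intros Hx; revert k; induction n as [|n IH]; intros k; auto.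
  specialize (IH (k + 1)%Z); rewrite window_S; destruct n as [|n]; auto.
  rewrite window_S in *; simpl in *; rewrite IH, Bool.andb_true_r.
  destruct (Hx k) as [_ H]; destruct (Nat.eqb_spec (x k) 0), (Nat.eqb_spec (x (k + 1)%Z) 2); auto.
Qed.

Lemma words_window x k n : inX x -> In (window x k n) (words n).
Proof.
  intros Hx; revert k; induction n as [|n IH]; intros k; [simpl; auto|].
  simpl words; apply filter_In; split; [|apply no02_window; auto].
  rewrite window_S; apply in_flat_map; exists (window x (k + 1) n); split; auto.
  destruct (Hx k) as [H _]; simpl.
  destruct (x k) as [|[|[|]]]; auto; lia.
Qed.

(** Six letters suffice: two before the mark at index 2, a source of length at most 3, and the
    letter after it, at which the next mark is tested. *)
Definition check_succ (L : local_rule) : bool :=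
  forallb (fun w => implb (markb L (slice 0 3 w))
    (existsb (fun r => andb (rmatchb w 2 r) (markb L (slice (length (rsrc r)) 3 w))) L)) (words 6).

(** The mirror image, with the given mark at the last of the six letters and its predecessor d
    letters earlier. *)
Definition check_pred (L : local_rule) : bool :=
  forallb (fun w => implb (markb L (slice 3 3 w))
    (existsb (fun d => existsb (fun r => andb (Nat.eqb (length (rsrc r)) d)
       (andb (rmatchb w (5 - d) r) (markb L (slice (3 - d) 3 w)))) L) [1; 2; 3]%nat)) (words 6).

(** Every three consecutive coordinates contain a mark, so that the chain of blocks has a starting
    point. *)
Definition check_cover (L : local_rule) : bool :=
  forallb (fun w => existsb (fun d => markb L (slice d 3 w)) [0; 1; 2]%nat) (words 5).

Definition nonempty_rules (L : local_rule) : bool :=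
  forallb (fun r => let '(_, v, _, v') := r in
    andb (Nat.ltb 0 (length v)) (andb (Nat.ltb 0 (length v')) (Nat.leb (length v) 3))) L.

Definition check_rules (L : local_rule) : bool :=
  andb (andb (check_succ L) (check_pred L)) (andb (check_cover L) (nonempty_rules L)).

(** Every window of x is among the words that were checked, so at each mark some rule leads to a
    next mark and some rule leads there from a previous one; [Z_chain] joins them. *)
Lemma rule_chain L x k0 : check_rules L = true -> inX x ->
  exists p : Z -> Z, (p 0%Z <= k0)%Z /\
    forall n, exists r, In r L /\ rmatch x (p n) r /\
      p (n + 1)%Z = (p n + Z.of_nat (length (rsrc r)))%Z.
Proof.
  intros HL Hx; unfold check_rules in HL.
  apply Bool.andb_true_iff in HL; destruct HL as [HL HL'].
  apply Bool.andb_true_iff in HL; destruct HL as [Hs Hp].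
  apply Bool.andb_true_iff in HL'; destruct HL' as [Hc Hne].
  unfold check_succ, check_pred, check_cover, nonempty_rules in *.
  rewrite forallb_forall in Hs, Hp, Hc, Hne.
  set (S := fun k => markb L (window x (k - 2) 3) = true).
  specialize (Hc _ (words_window x (k0 - 4) 5 Hx)); apply existsb_exists in Hc.
  destruct Hc as (d & Hd & Hm); rewrite window_slice in Hm by (simpl in Hd; lia).
  destruct (Z_chain Z S (fun k k' => exists r, In r L /\ rmatch x k r /\
              k' = (k + Z.of_nat (length (rsrc r)))%Z) (k0 - 2 + Z.of_nat d)%Z) as (p & Hp0 & _ & Hch).
  - unfold S; rewrite <- Hm; do 2 f_equal; lia.
  - intros k Hk; specialize (Hs _ (words_window x (k - 2) 6 Hx)).
    rewrite window_slice in Hs by lia; rewrite Z.add_0_r in Hs; unfold S in Hk; rewrite Hk in Hs.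
    apply existsb_exists in Hs; destruct Hs as (r & Hr & Hs).
    apply Bool.andb_true_iff in Hs; destruct Hs as [H1 H2].
    apply rmatchb_window in H1; replace (k - 2 + Z.of_nat 2)%Z with k in H1 by lia.
    exists (k + Z.of_nat (length (rsrc r)))%Z; split; eauto.
    specialize (Hne r Hr); destruct r as [[[u v] w] v']; simpl in *.
    apply Bool.andb_true_iff in Hne; destruct Hne as [_ Hne].
    apply Bool.andb_true_iff in Hne; destruct Hne as [_ Hne]; apply Nat.leb_le in Hne.
    unfold S; rewrite window_slice in H2 by lia; rewrite <- H2; do 2 f_equal; lia.
  - intros k Hk; specialize (Hp _ (words_window x (k - 5) 6 Hx)).
    rewrite window_slice in Hp by lia; unfold S in Hk.
    replace (k - 5 + Z.of_nat 3)%Z with (k - 2)%Z in Hp by lia; rewrite Hk in Hp.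
    unfold implb in Hp; apply existsb_exists in Hp; destruct Hp as (e & He & Hp).
    assert (1 <= e <= 3)%nat by (simpl in He; lia).
    apply existsb_exists in Hp; destruct Hp as (r & Hr & Hp).
    apply Bool.andb_true_iff in Hp; destruct Hp as [H1 Hp]; apply Nat.eqb_eq in H1.
    apply Bool.andb_true_iff in Hp; destruct Hp as [H2 H3].
    apply rmatchb_window in H2; replace (k - 5 + Z.of_nat (5 - e))%Z with
      (k - Z.of_nat e)%Z in H2 by lia.
    exists (k - Z.of_nat e)%Z; split.
    + unfold S; rewrite window_slice in H3 by lia; rewrite <- H3; do 2 f_equal; lia.
    + exists r; split; auto; split; auto; lia.
  - exists p; split; auto; rewrite Hp0; simpl in Hd; lia.
Qed.

Lemma nonempty_rules_spec L u v w v' : nonempty_rules L = true -> In (u, v, w, v') L ->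
  (0 < length v)%nat /\ (0 < length v')%nat.
Proof.
  unfold nonempty_rules; rewrite forallb_forall; intros H Hi; specialize (H _ Hi); simpl in H.
  apply Bool.andb_true_iff in H; destruct H as [H1 H]; apply Bool.andb_true_iff in H;
    destruct H as [H2 _].
  apply Nat.ltb_lt in H1; apply Nat.ltb_lt in H2; auto.
Qed.

(** * From sound rules to the homeomorphism that they define *)

Lemma increasing_covers (p : Z -> Z) t : (forall n, (p n < p (n + 1))%Z) ->
  exists n, IZR (p n) <= t < IZR (p (n + 1)%Z).
Proof.
  intros Hp.
  assert (Hup : forall m : nat, (p 0 + Z.of_nat m <= p (Z.of_nat m))%Z).
  { induction m as [|m IH]; [simpl; lia|]; specialize (Hp (Z.of_nat m)).
    replace (Z.of_nat (S m)) with (Z.of_nat m + 1)%Z by lia; lia. }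
  assert (Hdn : forall m : nat, (p (- Z.of_nat m) <= p 0 - Z.of_nat m)%Z).
  { induction m as [|m IH]; [simpl; lia|]; specialize (Hp (- Z.of_nat (S m))%Z).
    replace (- Z.of_nat (S m) + 1)%Z with (- Z.of_nat m)%Z in Hp by lia; lia. }
  set (m := Z.to_nat (Z.abs (flo t - p 0%Z) + 1)); pose proof (flo_spec t).
  apply (Z_crossing (fun n => IZR (p n)) t (- Z.of_nat m) (Z.of_nat m)); [| |lia].
  - specialize (Hdn m); assert (p (- Z.of_nat m) <= flo t)%Z by lia.
    apply IZR_le in H0; lra.
  - specialize (Hup m); assert (flo t + 1 <= p (Z.of_nat m))%Z by lia.
    apply IZR_le in H0; rewrite plus_IZR in H0; lra.
Qed.

(** Names the target position as the floor of [tau] at k, so that the targets of consecutive blocks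
    can be seen to be adjacent. *)
Lemma replaces_flo y tau k v v' : (0 < length v)%nat -> replaces y tau k v v' ->
  let z := flo (tau (IZR k)) in
  tau (IZR k) = IZR z /\ matchAt y z v' /\
  flo (tau (IZR (k + Z.of_nat (length v)))) = (z + Z.of_nat (length v'))%Z /\
  forall s, 0 <= s <= INR (length v) ->
    tau (IZR k + s) = IZR z + s * INR (length v') / INR (length v).
Proof.
  intros Hv (q & E & Hm & H); simpl.
  assert (Ez : flo (tau (IZR k)) = q) by (apply flo_unique; rewrite E; lra).
  rewrite Ez; split; auto; split; auto; split; auto.
  apply flo_unique; apply lt_INR in Hv; simpl in Hv.
  rewrite !plus_IZR, !IZR_of_nat, H by lra.
  replace (INR (length v) * INR (length v') / INR (length v)) with (INR (length v')) by (field;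
    lra).
  lra.
Qed.

(** The check provides one decomposition. For an arbitrary one, soundness determines [tau] and the
    letters of the image block by block, so every decomposition describes the same point. *)
Lemma rule_sound_defined_by g L : prefix_replacing g -> check_rules L = true -> rule_sound g L ->
  defined_by L (phi g).
Proof.
  intros HV HL Hs.
  assert (Hne : nonempty_rules L = true).
  { unfold check_rules in HL; rewrite !Bool.andb_true_iff in HL; tauto. }
  split.
  - intros x t Hx; destruct (rule_chain L x 0 HL Hx) as (p0 & _ & Hp0).
    destruct (line_map_exists g x HV Hx) as (y & tau & H).
    assert (Hinc : forall n, (p0 n < p0 (n + 1))%Z).
    { intros n; destruct (Hp0 n) as ([[[u v] w] v'] & Hr & _ & E); simpl in E.
      pose proof (nonempty_rules_spec _ _ _ _ _ Hne Hr); lia. }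
    (* The blocks are renumbered so that block 0 contains t. *)
    destruct (increasing_covers p0 t Hinc) as [n0 Hn0].
    set (p := fun n => p0 (n0 + n)%Z).
    assert (Hp : forall n, exists u v w v', In (u, v, w, v') L /\ rmatch x (p n) (u, v, w, v') /\
              p (n + 1)%Z = (p n + Z.of_nat (length v))%Z).
    { intros n; unfold p; rewrite Z.add_assoc.
      destruct (Hp0 (n0 + n)%Z) as ([[[u v] w] v'] & Hr); exists u, v, w, v'; auto. }
    set (z := fun n => flo (tau (IZR (p n)))).
    exists (shiftZ (z 0%Z) y), (tau t - IZR (z 0%Z)), p, (fun n => z n - z 0%Z)%Z.
    assert (Hz : forall n, (z n < z (n + 1))%Z).
    { intros n; destruct (Hp n) as (u & v & w & v' & Hr & Hm & E).
      destruct (nonempty_rules_spec _ _ _ _ _ Hne Hr) as [Hv Hv'].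
      destruct (replaces_flo _ _ _ _ _ Hv (Hs _ _ _ _ _ _ _ _ H Hr Hm)) as (_ & _ & E' & _).
      rewrite <- E in E'; unfold z; lia. }
    split; [intros n; unfold p; rewrite Z.add_assoc; auto|].
    split; [intros n; specialize (Hz n); lia|].
    split; [unfold p; rewrite Z.add_0_r; auto|].
    split; [lia|]; split.
    + intros n; destruct (Hp n) as (u & v & w & v' & Hr & Hm & E).
      destruct (nonempty_rules_spec _ _ _ _ _ Hne Hr) as [Hv Hv'].
      destruct (replaces_flo _ _ _ _ _ Hv (Hs _ _ _ _ _ _ _ _ H Hr Hm)) as (_ & Hy & E' & _).
      exists u, v, w, v'; destruct Hm as (M1 & M2 & M3); rewrite <- E in E'.
      repeat split; auto.
      * rewrite E; auto.
      * unfold z; rewrite E'; lia.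
      * intros i Hi; unfold shiftZ; rewrite <- Hy by auto; f_equal; unfold z; lia.
    + destruct (Hp 0%Z) as (u & v & w & v' & Hr & Hm & E).
      destruct (nonempty_rules_spec _ _ _ _ _ Hne Hr) as [Hv Hv'].
      destruct (replaces_flo _ _ _ _ _ Hv (Hs _ _ _ _ _ _ _ _ H Hr Hm)) as (_ & _ & E' & Ht).
      rewrite <- E in E'; simpl in E, E'.
      assert (Hpt : IZR (p 0%Z) <= t < IZR (p 0%Z) + INR (length v)).
      { rewrite <- IZR_of_nat, <- plus_IZR, <- E; unfold p; rewrite Z.add_0_r; auto. }
      specialize (Ht (t - IZR (p 0%Z)) ltac:(lra)).
      replace (IZR (p 0%Z) + (t - IZR (p 0%Z))) with t in Ht by lra.
      replace (z 1 - z 0 - (z 0 - z 0))%Z with (Z.of_nat (length v')) by (unfold z; lia).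
      replace (p 1 - p 0)%Z with (Z.of_nat (length v)) by lia.
      rewrite !IZR_of_nat; unfold z; lra.
  - intros x hx t y' s (p & q & Hp & Hq & Ht & Hq0 & Hr & Hs').
    destruct (line_map_exists g x HV hx) as (y & tau & H);
      pose proof (line_map_tgt _ _ _ _ H) as Hy.
    set (z := fun n => flo (tau (IZR (p n)))).
    assert (Hn : forall n, exists v', q (n + 1)%Z = (q n + Z.of_nat (length v'))%Z /\
              z (n + 1)%Z = (z n + Z.of_nat (length v'))%Z /\
              matchAt y' (q n) v' /\ matchAt y (z n) v' /\
              forall t, IZR (p n) <= t <= IZR (p (n + 1)%Z) ->
                tau t = IZR (z n) + (t - IZR (p n)) * INR (length v') / IZR (p (n + 1)%Z - p n)).
    { intros n; destruct (Hr n) as (u & v & w & v' & Hi & M1 & E & M2 & M3 & Eq & My).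
      destruct (nonempty_rules_spec _ _ _ _ _ Hne Hi) as [Hv Hv'].
      assert (Hm : rmatch x (p n) (u, v, w, v')) by (repeat split; auto; rewrite <- E; auto).
      destruct (replaces_flo _ _ _ _ _ Hv (Hs _ _ _ _ _ _ _ _ H Hi Hm)) as (_ & Hz & E' & Htau).
      rewrite <- E in E'; exists v'; repeat split; auto.
      intros r Hr'; rewrite E, plus_IZR, IZR_of_nat in Hr'.
      specialize (Htau (r - IZR (p n)) ltac:(lra)).
      replace (IZR (p n) + (r - IZR (p n))) with r in Htau by lra.
      replace (p (n + 1) - p n)%Z with (Z.of_nat (length v)) by lia.
      rewrite IZR_of_nat; auto. }
    (* Both sequences grow by the length of v' at each block, and q starts at 0. *)
    assert (Hzq : forall n, z n = (q n + z 0%Z)%Z).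
    { assert (Hstep : forall n, (z (n + 1) - q (n + 1) = z n - q n)%Z).
      { intros n; destruct (Hn n) as (v' & E1 & E2 & _); lia. }
      intros n; enough (z n - q n = z 0%Z - q 0%Z)%Z by lia.
      induction n using Z.peano_ind; auto.
      - unfold Z.succ; rewrite Hstep; auto.
      - specialize (Hstep (Z.pred n)); replace (Z.pred n + 1)%Z with n in Hstep by lia; lia. }
    assert (Ey : y' = shiftZ (z 0%Z) y).
    { apply functional_extensionality; intros i; unfold shiftZ.
      destruct (increasing_covers q (IZR i) Hq) as (n & H1 & H2).
      apply le_IZR in H1; apply lt_IZR in H2.
      destruct (Hn n) as (v' & E1 & _ & My' & My & _).
      specialize (My' (Z.to_nat (i - q n)) ltac:(lia));
        specialize (My (Z.to_nat (i - q n)) ltac:(lia)).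
      rewrite Hzq in My; rewrite <- My in My'; rewrite Z2Nat.id in My' by lia.
      replace (q n + (i - q n))%Z with i in My' by lia; rewrite My'; f_equal; lia. }
    subst y'; exists (inX_shiftZ _ _ Hy).
    rewrite (phi_spec g x y tau hx Hy t HV H); apply (mkT_shift _ _ _ _ _ _ (z 0%Z)); auto.
    destruct (Hn 0%Z) as (v' & E1 & _ & _ & _ & Htau); simpl in E1, Htau.
    rewrite Htau, Hs' by lra; replace (q 1 - q 0)%Z with (Z.of_nat (length v')) by lia.
    rewrite IZR_of_nat; lra.
Qed.

(** * The rules of the three generators *)

Lemma gen_a_repl_prefix c : repl_prefix gen_a c 2 2.
Proof.
  assert (H : forall c i, gen_a c (2 + i)%nat = c (2 + i)%nat).
  { intros d i; unfold gen_a; destruct (d 0%nat); auto.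
    rewrite (prepend_hi [false; negb (d 1%nat)]); unfold tail2; f_equal; lia. }
  intros c' Hc'; split; auto.
  intros i Hi; unfold gen_a; rewrite !(Hc' 0%nat), !(Hc' 1%nat) by lia.
  destruct (c 0%nat); [apply Hc'; auto|]; rewrite !prepend_lo by auto; auto.
Qed.

Lemma gen_b_repl_prefix c : repl_prefix gen_b c 2 2.
Proof.
  assert (H : forall c i, gen_b c (2 + i)%nat = c (2 + i)%nat).
  { intros d i; unfold gen_b; destruct (d 0%nat), (d 1%nat); auto;
    [rewrite (prepend_hi [false; true])|rewrite (prepend_hi [true; true])
    |rewrite (prepend_hi [true; false])]; unfold tail2; f_equal; lia. }
  intros c' Hc'; split; auto.
  intros i Hi; unfold gen_b; rewrite !(Hc' 0%nat), !(Hc' 1%nat) by lia.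
  destruct (c 0%nat), (c 1%nat); try (rewrite !prepend_lo by auto; auto); apply Hc'; auto.
Qed.

Lemma gen_c_repl_prefix c :
  (c 0%nat = true -> repl_prefix gen_c c 1 2) /\
  (c 0%nat = false -> c 1%nat = false -> repl_prefix gen_c c 2 1) /\
  (c 0%nat = false -> c 1%nat = true -> repl_prefix gen_c c 2 2).
Proof.
  split; [|split].
  - intros H c' Hc'; unfold gen_c; rewrite (Hc' 0%nat), H by lia; split.
    + intros i Hi; rewrite !prepend_lo by auto; auto.
    + intros i; rewrite (prepend_hi [false; false]); unfold tail1; f_equal; lia.
  - intros H H' c' Hc'; unfold gen_c; rewrite (Hc' 0%nat), (Hc' 1%nat), H, H' by lia; split.
    + intros i Hi; rewrite !prepend_lo by auto; auto.
    + intros i; rewrite (prepend_hi [true]); unfold tail2; f_equal; lia.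
  - intros H H' c' Hc'; unfold gen_c; rewrite (Hc' 0%nat), (Hc' 1%nat), H, H' by lia; split; auto.
Qed.

Lemma gen_a_prefix_replacing : prefix_replacing gen_a.
Proof. exists 2%nat; intros c; exists 2%nat, 2%nat; split; [lia|]; split; [lia|];
  apply gen_a_repl_prefix. Qed.

Lemma gen_b_prefix_replacing : prefix_replacing gen_b.
Proof. exists 2%nat; intros c; exists 2%nat, 2%nat; split; [lia|]; split; [lia|];
  apply gen_b_repl_prefix. Qed.

Lemma gen_c_prefix_replacing : prefix_replacing gen_c.
Proof.
  exists 2%nat; intros c; destruct (gen_c_repl_prefix c) as (H1 & H2 & H3).
  destruct (c 0%nat); [|destruct (c 1%nat)].
  - exists 1%nat, 2%nat; split; [lia|]; split; [lia|]; auto.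
  - exists 2%nat, 2%nat; split; [lia|]; split; [lia|]; auto.
  - exists 2%nat, 1%nat; split; [lia|]; split; [lia|]; auto.
Qed.

Lemma check_rule_a : check_rules rule_a = true.
Proof. vm_compute; reflexivity. Qed.

Lemma check_rule_b : check_rules rule_b = true.
Proof. vm_compute; reflexivity. Qed.

Lemma check_rule_c : check_rules rule_c = true.
Proof. vm_compute; reflexivity. Qed.

Lemma support_size_cantor_of w : (w <> [] -> last w 0%nat = 1%nat) ->
  support_size (cantor_of w) (length w).
Proof.
  intros H; split.
  - intros i Hi; unfold cantor_of; rewrite nth_overflow; auto.
  - destruct w as [|a w] using rev_ind; [discriminate|].
    rewrite length_app, Nat.add_1_r; intros j [= <-]; rewrite last_last in H.
    unfold cantor_of; rewrite app_nth2, Nat.sub_diag, H; auto; destruct w; discriminate.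
Qed.

(** This is why a rule whose source ends in 0, such as (200), can do without a right context: the
    block is known to continue. *)
Lemma no_zero_before_two x k u : inX x -> matchAt x k (u ++ [0%nat]) ->
  (x (k + Z.of_nat (length (u ++ [0%nat])))%Z <= 1)%nat.
Proof.
  intros Hx H; apply matchAt_app in H; destruct H as [_ H].
  apply matchAt_cons in H; destruct H as [H _]; rewrite length_app; simpl length.
  destruct (Hx (k + Z.of_nat (length u))%Z) as [_ H1].
  destruct (Hx (k + Z.of_nat (length u + 1))%Z) as [H2 _].
  replace (k + Z.of_nat (length u) + 1)%Z with (k + Z.of_nat (length u + 1))%Z in H1 by lia; lia.
Qed.

(** Either the block continues, or it is closed by a 2. In the second case w ends in 1, hence by the
    last hypothesis so does w', and the finite prescription gives the same affine map. *)
Lemma replaces_open g x y tau k w w' a b :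
  line_map g x y tau -> matchAt x k (2%nat :: w) ->
  repl_prefix g (cantor_of w) a b -> a = length w -> b = length w' ->
  (1 <= a <= 2)%nat -> (1 <= b <= 2)%nat ->
  (forall i, (i < b)%nat -> g (cantor_of w) i = cantor_of w' i) ->
  Forall (fun a => (a <= 1)%nat) w -> Forall (fun a => (a <= 1)%nat) w' ->
  (last w 0%nat = 1%nat -> last w' 0%nat = 1%nat \/
     (x (k + Z.of_nat (length (2%nat :: w)))%Z <= 1)%nat) ->
  replaces y tau k (2%nat :: w) (2%nat :: w').
Proof.
  intros H Hm Hv -> -> Ha Hb Hg Hw Hw' Hlast.
  assert (Hx := line_map_src _ _ _ _ H).
  set (e := x (k + Z.of_nat (length (2%nat :: w)))%Z) in *.
  destruct (Nat.le_gt_cases e 1) as [He|He]; [apply (replaces_long g x y tau); auto|].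
  assert (He2 : e = 2%nat) 
    by (pose proof (proj1 (Hx (k + Z.of_nat (length (2%nat :: w)))%Z)); unfold e in *; lia).
  assert (Hl : last w 0%nat = 1%nat).
  { destruct w as [|d w _] using rev_ind; [simpl in Ha; lia|]; rewrite last_last.
    apply Forall_app in Hw; destruct Hw as [_ Hw]; inversion Hw; subst.
    destruct d as [|[|]]; auto; [|lia]; exfalso.
    pose proof (no_zero_before_two x k (2%nat :: w) Hx Hm); unfold e in He; simpl app in *; lia. }
  destruct (Hlast Hl) as [Hl'|]; [|lia].
  apply (replaces_finite g x y tau k w w' (length w) (length w')); auto; try lia.
  - apply matchAt_app; split; auto; apply matchAt_cons; split; auto using matchAt_nil.
  - apply support_size_cantor_of; auto.
  - apply support_size_cantor_of; auto.
Qed.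

Lemma replaces_unit_22 g x y tau k c : (forall c, repl_prefix g c 2 2) -> line_map g x y tau ->
  x k = c -> (c <= 1)%nat -> (x (k - 1)%Z <= 1)%nat -> (x (k - 2)%Z <= 1)%nat ->
  replaces y tau k [c] [c].
Proof.
  intros Hv H <- H0 H1 H2; apply (replaces_unit g x); auto; [lia|].
  intros d K HK; exists 2%nat, 2%nat; split; auto; split; auto; split; auto.
  (* A depth below 3 would put the 2 of the block at k, k - 1 or k - 2. *)
  destruct (Nat.le_gt_cases 3 K); auto.
  specialize (HK 0%nat ltac:(lia)); simpl in HK.
  destruct K as [|[|[|K]]]; try lia; simpl in HK.
  - replace (k - 0 + 0)%Z with k in HK by lia; lia.
  - replace (k - 1 + 0)%Z with (k - 1)%Z in HK by lia; lia.
  - replace (k - 2 + 0)%Z with (k - 2)%Z in HK by lia; lia.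
Qed.

Lemma abg_rule_sound g : (forall c, repl_prefix g c 2 2) -> rule_sound g rule_abg.
Proof.
  intros Hv x y tau k u v w v' H Hi Hm.
  assert (E : exists a b c, (a <= 1)%nat /\ (b <= 1)%nat /\ (c <= 1)%nat /\
            (u, v, w, v') = ([a; b], [c], [], [c])).
  { simpl in Hi; repeat (destruct Hi as [Hi|Hi]; [rewrite <- Hi; do 3 eexists; repeat split; lia|]).
    contradiction. }
  destruct E as (a & b & c & Ha & Hb & Hc & [= -> -> -> ->]).
  destruct Hm as (M1 & M2 & _);
  repeat rewrite matchAt_cons in M1; repeat rewrite matchAt_cons in M2; simpl length in M1.
  replace (k - Z.of_nat 2 + 1)%Z with (k - 1)%Z in M1 by lia.
  replace (k - Z.of_nat 2)%Z with (k - 2)%Z in M1 by lia.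
  apply (replaces_unit_22 g x); auto; lia.
Qed.

Lemma rule_sound_app g L L' : rule_sound g L -> rule_sound g L' -> rule_sound g (L ++ L').
Proof.
  intros H H' x y tau k u v w v' HR Hi; apply in_app_or in Hi; destruct Hi; eauto.
Qed.

Lemma rule_context x k (v : word) e : matchAt x (k + Z.of_nat (length v)) [e] -> (e <= 1)%nat ->
  (x (k + Z.of_nat (length v))%Z <= 1)%nat.
Proof. rewrite matchAt_cons; intros [-> _]; auto. Qed.

Ltac each_rule Hi :=
  simpl in Hi;
  repeat match type of Hi with
  | _ \/ _ => destruct Hi as [Hi|Hi]; [injection Hi as <- <- <- <-|]
  end; [..|contradiction].

Ltac solve_head :=
  intros [|[|i]] ?; first [reflexivity | lia].

(** The first alternative fits exactly the rules with right context 2; the others are treated as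
    open blocks. *)
Ltac solve_rule g x a b VRtac Hm :=
  first
  [ apply (replaces_finite g x _ _ _ _ _ a b);
    [assumption|apply matchAt_app; split; apply Hm|VRtac|simpl; lia|simpl; lia|solve_head
    |repeat constructor|repeat constructor
    |apply support_size_cantor_of; simpl; congruence|apply support_size_cantor_of; simpl;
      congruence]
  | apply (replaces_open g x _ _ _ _ _ a b);
    [assumption|apply Hm|VRtac|reflexivity|reflexivity|lia|lia|solve_head
    |repeat constructor|repeat constructor
    |simpl last; intros; first [discriminate|left; reflexivity|right; eapply rule_context;
      [apply Hm|lia]]] ].

Lemma a_rule_sound : rule_sound gen_a rule_a.
Proof.
  apply rule_sound_app; [apply abg_rule_sound, gen_a_repl_prefix|].
  intros x y tau k u v w v' H Hi Hm; each_rule Hi.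
  all: solve_rule gen_a x 2%nat 2%nat ltac:(apply gen_a_repl_prefix) Hm.
Qed.

Lemma b_rule_sound : rule_sound gen_b rule_b.
Proof.
  apply rule_sound_app; [apply abg_rule_sound, gen_b_repl_prefix|].
  intros x y tau k u v w v' H Hi Hm; each_rule Hi.
  all: solve_rule gen_b x 2%nat 2%nat ltac:(apply gen_b_repl_prefix) Hm.
Qed.

(** c replaces a prefix of length 1 in blocks that begin with 21 and of length 2 in those that begin
    with 20, so depth 2 suffices in the former and depth 3 is needed in the latter. The contexts 1
    and alpha 0 guarantee precisely this. *)
Lemma replaces_unit_c x y tau k c : line_map gen_c x y tau ->
  x k = c -> (c <= 1)%nat ->
    x (k - 1)%Z = 1%nat \/ (x (k - 1)%Z = 0%nat /\ (x (k - 2)%Z <= 1)%nat) ->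
  replaces y tau k [c] [c].
Proof.
  intros H <- H0 H1; apply (replaces_unit gen_c x); auto; [lia|].
  intros d K HK; pose proof (HK 0%nat ltac:(lia)) as HK0; simpl in HK0; rewrite Z.add_0_r in HK0.
  destruct (gen_c_repl_prefix d) as (V1 & V2 & V3).
  destruct K as [|[|K]].
  - rewrite Z.sub_0_r in HK0; lia.
  - replace (k - Z.of_nat 1)%Z with (k - 1)%Z in HK0 by lia; lia.
  - destruct (d 0%nat) eqn:E0.
    + exists 1%nat, 2%nat; repeat split; auto; try lia; apply V1; auto.
    (* At depth 2 with a 0 after the 2, the coordinate k - 1 carries 0 and k - 2 carries 2, which
       the context excludes. *)
    + destruct K as [|K].
      * pose proof (HK 1%nat ltac:(lia)) as HK1; simpl in HK1; rewrite E0 in HK1.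
        replace (k - Z.of_nat 2)%Z with (k - 2)%Z in HK0 by lia.
        replace (k - 2 + 1)%Z with (k - 1)%Z in HK1 by lia; lia.
      * destruct (d 1%nat) eqn:E1; [exists 2%nat, 2%nat|exists 2%nat, 1%nat];
          repeat split; auto; try lia; (apply V2 || apply V3); auto.
Qed.

Ltac solve_gen_c_repl_prefix :=
  idtac; match goal with |- repl_prefix _ ?c _ _ =>
    first [apply (proj1 (gen_c_repl_prefix c)) | apply (proj1 (proj2 (gen_c_repl_prefix c)))
          | apply (proj2 (proj2 (gen_c_repl_prefix c)))]; reflexivity
  end.

Ltac solve_unit_c x Hm :=
  destruct Hm as (M1 & M2 & _);
  repeat rewrite matchAt_cons in M1; repeat rewrite matchAt_cons in M2; simpl length in M1;
  apply (replaces_unit_c x); [assumption|apply M2|lia|].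

Lemma c_rule_sound : rule_sound gen_c rule_c.
Proof.
  intros x y tau k u v w v' H Hi Hm; unfold rule_c in Hi.
  apply in_app_or in Hi; destruct Hi as [Hi|Hi]; [|apply in_app_or in Hi; destruct Hi as [Hi|Hi]].
  - each_rule Hi; solve_unit_c x Hm; right.
    all: replace (k - Z.of_nat 2 + 1)%Z with (k - 1)%Z in M1 by lia.
    all: replace (k - Z.of_nat 2)%Z with (k - 2)%Z in M1 by lia; lia.
  - each_rule Hi; solve_unit_c x Hm; left.
    all: replace (k - Z.of_nat 1)%Z with (k - 1)%Z in M1 by lia; apply M1.
  - each_rule Hi.
    all: first [solve_rule gen_c x 2%nat 2%nat solve_gen_c_repl_prefix Hm
               |solve_rule gen_c x 2%nat 1%nat solve_gen_c_repl_prefix Hm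
               |solve_rule gen_c x 1%nat 2%nat solve_gen_c_repl_prefix Hm].
Qed.

Theorem theorem1p2 :
  exists phi : (cantor -> cantor) -> (TX -> TX),
    (* phi maps V into the orientation-preserving homeomorphisms *)
    (forall g, in_V g -> homeo_plus (phi g)) /\
    (* phi is a group homomorphism *)
    (forall f g, in_V f -> in_V g -> phi (fun x => g (f x)) = (fun p => phi g (phi f p))) /\
    (* phi(a) = h_a, phi(b) = h_b, phi(c) = h_c *)
    defined_by rule_a (phi gen_a) /\
    defined_by rule_b (phi gen_b) /\
    defined_by rule_c (phi gen_c) /\
    (* the image consists of homeomorphisms piecewise linear along flow lines *)
    (forall g, in_V g -> PL_along_flow (phi g)) /\
    (* composing with the quotient onto MCG(X) (isotopy classes) is injective *)
    (forall f g, in_V f -> in_V g -> isotopic (phi f) (phi g) -> f = g).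
Proof.
  exists phi.
  split; [|split; [|split; [|split; [|split; [|split]]]]].
  - intros g Hg; split.
    + destruct (in_V_inverse g Hg) as [h Hh]; apply (phi_homeo g h); auto.
    + intros p; destruct (phi_reparam_PL g p (prefix_replacing_in_V g Hg)) as (f & Hf & _); eauto.
  - intros f g Hf Hg; apply functional_extensionality; intros p.
    apply phi_comp; apply prefix_replacing_in_V; auto.
  - apply rule_sound_defined_by; auto using gen_a_prefix_replacing, check_rule_a, a_rule_sound.
  - apply rule_sound_defined_by; auto using gen_b_prefix_replacing, check_rule_b, b_rule_sound.
  - apply rule_sound_defined_by; auto using gen_c_prefix_replacing, check_rule_c, c_rule_sound.
  - intros g Hg p; apply phi_reparam_PL, prefix_replacing_in_V; auto.
  - intros f g Hf Hg; apply phi_isotopic_inj; apply prefix_replacing_in_V; auto.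
Qed.
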